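(* Let $\alpha>\frac{\ln 2}{\pi}$ be real, let $k\in(0,1)$ be the modulus determined by $K(k')/K(k)=\alpha$ with $k'=\sqrt{1-k^2}$, and write $K=K(k)$. Then $$\int_{0}^{\pi/2}\frac{\cosh \frac{x}{2\alpha}\,\cos \frac{\ln (2 \cos x)}{2\alpha}}{\cosh \frac{x}{\alpha}+\cos \frac{\ln (2 \cos x)}{\alpha}}\,dx=\frac{\pi}{8}(\alpha+2)-\frac{\alpha}{4}K.$$
   Context: For a modulus $k\in(0,1)$, the complementary modulus is $k'=\sqrt{1-k^2}$, and the complete elliptic integral of the first kind with modulus $k$ is $K=K(k)=\int_0^{\pi/2}\frac{d\varphi}{\sqrt{1-k^2\sin^2\varphi}}$; $K'=K(k')$. Given $\alpha>0$, the modulus $k$ is the one for which $\alpha=K'/K$, and $k',K,K'$ are the corresponding quantities. *)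

(* Defs.v *)
From Stdlib Require Import Reals.
From Coquelicot Require Import Coquelicot.
Open Scope R_scope.

Definition ellK (k : R) : R :=
  RInt (fun phi : R => / sqrt (1 - k ^ 2 * sin phi ^ 2)) 0 (PI / 2).

Definition comp_modulus (k : R) : R := sqrt (1 - k ^ 2).

(* At [x = PI / 2] the logarithm is applied to [0]; the (conventional) value
   there does not affect the integral over [[0, PI / 2]], since the integrand is
   bounded and continuous on [[0, PI / 2)] when [ln 2 / PI < alpha]. *)
Definition integrand (alpha x : R) : R :=
  (cosh (x / (2 * alpha)) * cos (ln (2 * cos x) / (2 * alpha))) /
  (cosh (x / alpha) + cos (ln (2 * cos x) / alpha)).

(* Main.v *)
(** Writing [1 + e^(2 i x) = 2 cos x e^(i x)] turns the integrand into
    [Re sec (log (1 + e^(2 i x)) / (2 alpha)) / 2], so the integral is a mean value over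
    the unit circle.  The condition [ln 2 / PI < alpha] keeps the positive poles of the
    secant outside the circle; the negative ones lie inside and accumulate at [-1].
    Shifting the argument of the secant by [i d] moves all poles off the upper half disc,
    where the polar Cauchy--Riemann equation [r u_r = v_th] expresses the radial derivative
    of the integral over a semicircle through the imaginary part on the real axis.  As [d]
    tends to [0] that imaginary part becomes a Poisson kernel which picks up the residue of
    each pole; the residues add up to [PI alpha] times [sum_(m >= 1) sech (PI alpha m)].

    It remains to show [sum_(m in Z) sech (PI alpha m) = 2 K / PI].  Put
    [a (x) = sum sech (x m)], [c (x) = sum sech (x (m + 1/2))] and [b = sqrt (a^2 - c^2)].
    Then [a (x) = a (2 x) + c (2 x)] and [c (x)^2 = 4 a (2 x) c (2 x)], so doubling [x] is
    an arithmetic-geometric mean step for [(a, b)] and halving [x] is one for [(a, c)] up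
    to a factor [2].  Gauss's integral [int 1 / sqrt (a^2 cos^2 + b^2 sin^2)] is invariant
    under such steps; the limits are [a, b -> 1] for [x -> oo] and, as Riemann sums of
    [sech], [x a (x), x c (x) -> PI] for [x -> 0].  This gives [K = (PI / 2) a (x)] and
    [K' = (x / 2) a (x)] for the modulus [c / a], i.e. [K' / K = x / PI]. *)
Require Import Defs.
From Stdlib Require Import Reals Lra Lia Psatz List FinFun ZArith.
From Coquelicot Require Import Coquelicot.
Open Scope R_scope.

(* Coquelicot often leaves equations typed in the carrier of an algebraic structure,
   where [ring] and [field] do not recognise the reals. *)
Ltac real_eq := match goal with |- @eq _ ?a ?b => change (@eq R a b) end.

(** * Unordered sums of nonnegative families *)

(** The identity [c (x)^2 = 4 a (2 x) c (2 x)] rests on rearranging double series, so sums are taken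
    as suprema of finite sums, for which a change of index costs nothing. Both sides become sums of
    [1 / (cosh p + cosh q)] over a lattice, with [q] an odd and [p] an even respectively odd
    multiple of [x]; along each row the terms are differences of [tanh], and the telescoped total
    does not see the parity of [p].

    At shift [0] the integral over a semicircle cannot be followed from radius [0] to [1], as poles
    lie on the way. Hence [d] tends to [0] only at two radii, one inside all poles and the unit
    circle. Between them the Poisson kernel is integrated over infinitely many windows, one around
    each pole; a tail estimate that does not depend on [d] permits exchanging the two limits. The
    residues give an alternating series of Bose factors, which geometric expansion turns into the
    series of [sech].

    The modulus is not solved for: one with the ratio [alpha] is written down by theta functions,
    and monotonicity of [K' / K] identifies it with [k]. *)

Definition lsum {I : Type} (f : I -> R) (l : list I) : R :=
  fold_right (fun i s => f i + s) 0 l.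

Definition usum {I : Type} (f : I -> R) (s : R) : Prop :=
  is_lub (fun y => exists l, NoDup l /\ y = lsum f l) s.

Definition has_eq_dec (I : Type) := forall x y : I, {x = y} + {x <> y}.

Lemma lsum_app {I : Type} (f : I -> R) (l m : list I) :
  lsum f (l ++ m) = lsum f l + lsum f m.
Proof. induction l as [|i l IH]; simpl; [ring|rewrite IH; ring]. Qed.

Lemma lsum_map {I J : Type} (f : I -> R) (g : J -> I) (l : list J) :
  lsum f (map g l) = lsum (fun j => f (g j)) l.
Proof. induction l as [|i l IH]; simpl; congruence. Qed.

Lemma lsum_nonneg {I : Type} (f : I -> R) (l : list I) :
  (forall i, 0 <= f i) -> 0 <= lsum f l.
Proof. intros Hf; induction l as [|i l IH]; simpl; [lra|specialize (Hf i); lra]. Qed.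

Lemma lsum_scal {I : Type} (f : I -> R) (c : R) (l : list I) :
  lsum (fun i => c * f i) l = c * lsum f l.
Proof. induction l as [|i l IH]; simpl; [ring|rewrite IH; ring]. Qed.

Lemma lsum_plus {I : Type} (f g : I -> R) (l : list I) :
  lsum (fun i => f i + g i) l = lsum f l + lsum g l.
Proof. induction l as [|i l IH]; simpl; [ring|rewrite IH; ring]. Qed.

Lemma lsum_incl {I : Type} (f : I -> R) (l m : list I) :
  (forall i, 0 <= f i) -> NoDup l -> incl l m -> lsum f l <= lsum f m.
Proof.
  intros Hf Hl; revert m; induction Hl as [|i l Hi Hl IH]; intros m Hm; simpl.
  - now apply lsum_nonneg.
  - destruct (in_split i m) as [m1 [m2 E]]; [apply Hm; now left|].
    assert (H : lsum f l <= lsum f (m1 ++ m2)).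
    { apply IH; intros j Hj.
      assert (Hjm : In j m) by (apply Hm; now right).
      rewrite E in Hjm; apply in_app_or in Hjm; apply in_or_app.
      destruct Hjm as [H|[H|H]]; auto; subst; contradiction. }
    rewrite E; rewrite lsum_app in *; simpl; lra.
Qed.

Lemma lsum_prod {I J : Type} (f : I -> R) (g : J -> R) (l : list I) (m : list J) :
  lsum (fun p => f (fst p) * g (snd p)) (list_prod l m) = lsum f l * lsum g m.
Proof.
  induction l as [|i l IH]; simpl; [ring|].
  rewrite lsum_app, IH, lsum_map; simpl; rewrite lsum_scal; ring.
Qed.

Lemma NoDup_list_prod {I J : Type} (l : list I) (m : list J) :
  NoDup l -> NoDup m -> NoDup (list_prod l m).
Proof.
  intros Hl Hm; induction Hl as [|i l Hi Hl IH]; simpl; [constructor|].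
  apply NoDup_app; auto.
  - apply Injective_map_NoDup; auto; intros x y E; now injection E.
  - intros [x y] H1 H2; apply in_map_iff in H1; destruct H1 as [z [E _]].
    injection E; intros; subst; apply in_prod_iff in H2; tauto.
Qed.

Lemma usum_unique {I : Type} (f : I -> R) (s t : R) : usum f s -> usum f t -> s = t.
Proof. apply is_lub_u. Qed.

Lemma usum_ge {I : Type} (f : I -> R) (s : R) (l : list I) :
  usum f s -> NoDup l -> lsum f l <= s.
Proof. intros [H _] Hl; apply H; now exists l. Qed.

Lemma usum_intro {I : Type} (f : I -> R) (s : R) :
  (forall l, NoDup l -> lsum f l <= s) ->
  (forall eps, 0 < eps -> exists l, NoDup l /\ s - eps < lsum f l) -> usum f s.
Proof.
  intros H1 H2; split.
  - intros y [l [Hl ->]]; auto.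
  - intros b Hb; apply Rnot_lt_le; intros Hbs.
    destruct (H2 (s - b)) as [l [Hl Hlt]]; [lra|].
    assert (lsum f l <= b) by (apply Hb; now exists l); lra.
Qed.

Lemma usum_approx {I : Type} (f : I -> R) (s eps : R) :
  usum f s -> 0 < eps -> exists l, NoDup l /\ s - eps < lsum f l.
Proof.
  intros [_ H] He; apply Classical_Prop.NNPP; intros Hn.
  assert (s <= s - eps); [|lra].
  apply H; intros y [l [Hl ->]].
  apply Rnot_lt_le; intros Hlt; apply Hn; now exists l.
Qed.

Lemma usum_ext {I : Type} (f g : I -> R) (s : R) :
  (forall i, f i = g i) -> usum f s -> usum g s.
Proof.
  intros E H.
  assert (El : forall l, lsum f l = lsum g l).
  { induction l as [|i l IH]; simpl; [easy|now rewrite E, IH]. }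
  apply usum_intro.
  - intros l Hl; rewrite <- El; now apply usum_ge.
  - intros eps He; destruct (usum_approx f s eps H He) as [l Hl].
    exists l; now rewrite <- El.
Qed.

Lemma usum_bij {I J : Type} (f : I -> R) (g : J -> I) (h : I -> J) (s : R) :
  (forall j, h (g j) = j) -> (forall i, g (h i) = i) ->
  usum f s -> usum (fun j => f (g j)) s.
Proof.
  intros Hhg Hgh H; apply usum_intro.
  - intros l Hl; rewrite <- lsum_map; apply usum_ge; auto.
    apply Injective_map_NoDup; auto.
    intros x y E; rewrite <- (Hhg x), <- (Hhg y); now rewrite E.
  - intros eps He; destruct (usum_approx f s eps H He) as [l [Hl Hlt]].
    exists (map h l); split.
    + apply Injective_map_NoDup; auto.
      intros x y E; rewrite <- (Hgh x), <- (Hgh y); now rewrite E.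
    + rewrite lsum_map.
      replace (lsum (fun j => f (g (h j))) l) with (lsum f l); auto.
      clear - Hgh; induction l as [|i l IH]; simpl; [easy|now rewrite Hgh, IH].
Qed.

Lemma usum_plus {I : Type} (dec : has_eq_dec I) (f g : I -> R) (s t : R) :
  (forall i, 0 <= f i) -> (forall i, 0 <= g i) ->
  usum f s -> usum g t -> usum (fun i => f i + g i) (s + t).
Proof.
  intros Hf0 Hg0 Hf Hg; apply usum_intro.
  - intros l Hl; rewrite lsum_plus.
    apply Rplus_le_compat; now apply usum_ge.
  - intros eps He.
    destruct (usum_approx f s (eps / 2) Hf) as [l [Hl Hlt]]; [lra|].
    destruct (usum_approx g t (eps / 2) Hg) as [m [Hm Hmt]]; [lra|].
    exists (nodup dec (l ++ m)); split; [apply NoDup_nodup|].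
    rewrite lsum_plus.
    assert (lsum f l <= lsum f (nodup dec (l ++ m))).
    { apply lsum_incl; auto; intros i Hi; apply nodup_In, in_or_app; auto. }
    assert (lsum g m <= lsum g (nodup dec (l ++ m))).
    { apply lsum_incl; auto; intros i Hi; apply nodup_In, in_or_app; auto. }
    lra.
Qed.

Lemma usum_scal {I : Type} (f : I -> R) (c s : R) :
  0 < c -> usum f s -> usum (fun i => c * f i) (c * s).
Proof.
  intros Hc H; apply usum_intro.
  - intros l Hl; rewrite lsum_scal; apply Rmult_le_compat_l; [lra|].
    now apply usum_ge.
  - intros eps He; destruct (usum_approx f s (eps / c) H) as [l [Hl Hlt]].
    { now apply Rdiv_lt_0_compat. }
    exists l; split; auto; rewrite lsum_scal.
    apply (Rmult_lt_compat_l c) in Hlt; auto.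
    replace (c * (s - eps / c)) with (c * s - eps) in Hlt by (field; lra); lra.
Qed.

Lemma usum_bool {I : Type} (f : bool * I -> R) (s t : R) :
  (forall i, 0 <= f i) ->
  usum (fun i => f (true, i)) s -> usum (fun i => f (false, i)) t ->
  usum f (s + t).
Proof.
  intros Hf0 Hs Ht; apply usum_intro.
  - intros l Hl.
    assert (E : exists l1 l2, NoDup l1 /\ NoDup l2 /\
      (forall i, In i l1 -> In (true, i) l) /\ (forall i, In i l2 -> In (false, i) l) /\
      lsum f l = lsum (fun i => f (true, i)) l1 + lsum (fun i => f (false, i)) l2).
    { induction Hl as [|[[|] i] l Hi Hl IH].
      - exists nil, nil; repeat split; try constructor; simpl; try tauto; lra.
      - destruct IH as [l1 [l2 [H1 [H2 [H3 [H4 H5]]]]]].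
        exists (i :: l1), l2; repeat split; auto.
        + constructor; auto.
        + intros j [<-|Hj]; [now left|right; auto].
        + intros j Hj; right; auto.
        + simpl; rewrite H5; ring.
      - destruct IH as [l1 [l2 [H1 [H2 [H3 [H4 H5]]]]]].
        exists l1, (i :: l2); repeat split; auto.
        + constructor; auto.
        + intros j Hj; right; auto.
        + intros j [<-|Hj]; [now left|right; auto].
        + simpl; rewrite H5; ring. }
    destruct E as [l1 [l2 [H1 [H2 [_ [_ ->]]]]]].
    apply Rplus_le_compat; now apply usum_ge.
  - intros eps He.
    destruct (usum_approx _ s (eps / 2) Hs) as [l [Hl Hlt]]; [lra|].
    destruct (usum_approx _ t (eps / 2) Ht) as [m [Hm Hmt]]; [lra|].
    exists (map (pair true) l ++ map (pair false) m); split.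
    + apply NoDup_app; try (apply Injective_map_NoDup; auto;
        intros x y E; now injection E).
      intros [b x] H1 H2; apply in_map_iff in H1; apply in_map_iff in H2.
      destruct H1 as [? [E1 _]], H2 as [? [E2 _]]; congruence.
    + rewrite lsum_app, !lsum_map; lra.
Qed.

Lemma usum_prod {I J : Type} (decI : has_eq_dec I) (decJ : has_eq_dec J)
  (f : I -> R) (g : J -> R) (s t : R) :
  (forall i, 0 <= f i) -> (forall j, 0 <= g j) ->
  usum f s -> usum g t -> usum (fun p => f (fst p) * g (snd p)) (s * t).
Proof.
  intros Hf0 Hg0 Hf Hg.
  assert (Hs : 0 <= s) by (apply (usum_ge f s nil Hf); constructor).
  assert (Ht : 0 <= t) by (apply (usum_ge g t nil Hg); constructor).
  apply usum_intro.
  - intros l Hl.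
    set (l1 := nodup decI (map fst l)); set (l2 := nodup decJ (map snd l)).
    apply Rle_trans with (lsum (fun p => f (fst p) * g (snd p)) (list_prod l1 l2)).
    + apply lsum_incl; auto.
      * intros p; now apply Rmult_le_pos.
      * intros [i j] Hp; apply in_prod; apply nodup_In.
        -- change i with (fst (i, j)); now apply in_map.
        -- change j with (snd (i, j)); now apply in_map.
    + rewrite lsum_prod; apply Rmult_le_compat; try now apply lsum_nonneg.
      * apply usum_ge; auto; apply NoDup_nodup.
      * apply usum_ge; auto; apply NoDup_nodup.
  - intros eps He.
    (* With both finite sums within [d] of their suprema, their product misses [s * t] by at most
       [d * (s + t)]; the [1] keeps the denominator positive. *)
    set (d := Rmin 1 (eps / (s + t + 1))).
    assert (Hd : 0 < d) by (apply Rmin_pos; [lra|apply Rdiv_lt_0_compat; lra]).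
    assert (Hd' : d * (s + t + 1) <= eps).
    { apply Rle_trans with (eps / (s + t + 1) * (s + t + 1)).
      - apply Rmult_le_compat_r; [lra|apply Rmin_r].
      - right; field; lra. }
    destruct (usum_approx f s d Hf Hd) as [l [Hl Hlt]].
    destruct (usum_approx g t d Hg Hd) as [m [Hm Hmt]].
    exists (list_prod l m); split; [now apply NoDup_list_prod|].
    rewrite lsum_prod.
    assert (0 <= lsum f l) by now apply lsum_nonneg.
    assert (0 <= lsum g m) by now apply lsum_nonneg.
    assert (lsum f l <= s) by now apply usum_ge.
    assert (lsum g m <= t) by now apply usum_ge.
    nra.
Qed.

(** Groups a finite double sum by the second index. [lj] may be larger than the set of indices that
    occur; the extra fibres are empty. *)
Lemma lsum_fibers {I J : Type} (decJ : has_eq_dec J) (g : I * J -> R) (l : list (I * J))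
  (lj : list J) :
  NoDup l -> NoDup lj -> (forall p, In p l -> In (snd p) lj) ->
  exists m : J -> list I, (forall j, NoDup (m j)) /\
    lsum g l = lsum (fun j => lsum (fun i => g (i, j)) (m j)) lj.
Proof.
  intros Hl Hlj Hin.
  exists (fun j => map fst (filter (fun p => if decJ (snd p) j then true else false) l)).
  split.
  - intros j; clear Hin; induction Hl as [|[a b] l Ha Hl IH]; simpl; [constructor|].
    destruct (decJ b j) as [->|]; auto; simpl; constructor; auto.
    intros H; apply in_map_iff in H; destruct H as [[a' b'] [E H]]; simpl in E; subst a'.
    apply filter_In in H; destruct H as [H1 H2]; simpl in H2.
    destruct (decJ b' j); [subst; contradiction|discriminate].
  - clear Hl; induction l as [|[a b] l IH].
    + simpl; clear; induction lj; simpl; lra.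
    + assert (Hb : In b lj) by (apply (Hin (a, b)); now left).
      simpl lsum at 1; rewrite IH by (intros p Hp; apply Hin; now right).
      clear - Hb Hlj; induction Hlj as [|c lj Hc Hlj IH]; simpl in *; [contradiction|].
      destruct (decJ b c) as [->|Hne]; simpl.
      * assert (E : forall c' : J, In c' lj -> c <> c') by (intros c' H ->; contradiction).
        clear IH Hb Hc Hlj.
        match goal with |- _ + (?A + ?B) = _ + _ + ?C => assert (EE : B = C) end.
        { induction lj as [|c' lj IH]; simpl; auto.
          destruct (decJ c c') as [H|]; [exfalso; apply (E c'); [now left|auto]|].
          rewrite IH; auto; intros; apply E; now right. }
        rewrite EE; ring.
      * destruct Hb as [->|Hb]; [contradiction|].
        rewrite <- IH; auto; ring.
Qed.

(** Every row of a finite part of [g] stays below the common row sum, which a finite piece of the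
    same row of [f] reaches up to a share of [eps]. Pieces of different rows are disjoint, so
    together they form one admissible list for [f]. *)
Lemma usum_rows_le {I J : Type} (decJ : has_eq_dec J) (f g : I * J -> R) (s : R) :
  (forall p, 0 <= f p) ->
  (forall j, exists r, usum (fun i => f (i, j)) r /\ usum (fun i => g (i, j)) r) ->
  usum f s -> forall l, NoDup l -> lsum g l <= s.
Proof.
  intros Hf0 Hrows Hf l Hl.
  set (lj := nodup decJ (map snd l)).
  assert (Hlj : NoDup lj) by apply NoDup_nodup.
  destruct (lsum_fibers decJ g l lj Hl Hlj) as [m [Hm E]].
  { intros p Hp; apply nodup_In; now apply in_map. }
  rewrite E; apply le_epsilon; intros eps He.
  assert (H : forall lj, NoDup lj -> forall eps, 0 < eps -> exists l', NoDup l' /\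
    (forall p, In p l' -> In (snd p) lj) /\
    lsum (fun j => lsum (fun i => g (i, j)) (m j)) lj <= lsum f l' + eps).
  { clear - Hrows Hm; intros lj Hlj.
    induction Hlj as [|j lj Hj Hlj IH]; intros eps He; simpl.
    - exists nil; simpl; repeat split; [constructor|tauto|lra].
    - destruct (IH (eps / 2)) as [l' [H1 [H2 H3]]]; [lra|].
      destruct (Hrows j) as [r [Hr1 Hr2]].
      destruct (usum_approx _ r (eps / 2) Hr1) as [k [Hk Hk2]]; [lra|].
      assert (lsum (fun i => g (i, j)) (m j) <= r) by now apply usum_ge.
      exists (map (fun i => (i, j)) k ++ l'); repeat split.
      + apply NoDup_app; auto.
        * apply Injective_map_NoDup; auto; intros x y E; now injection E.
        * intros [a b] Hin Hin2; apply in_map_iff in Hin; destruct Hin as [? [E _]].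
          injection E; intros; subst; now apply H2 in Hin2.
      + intros p Hp; apply in_app_or in Hp; destruct Hp as [Hp|Hp].
        * apply in_map_iff in Hp; destruct Hp as [? [<- _]]; now left.
        * right; now apply H2.
      + rewrite lsum_app, lsum_map; lra. }
  destruct (H lj Hlj eps He) as [l' [H1 [_ H3]]].
  assert (lsum f l' <= s) by now apply usum_ge.
  lra.
Qed.

Lemma usum_rows {I J : Type} (decJ : has_eq_dec J) (f g : I * J -> R) (s t : R) :
  (forall p, 0 <= f p) -> (forall p, 0 <= g p) ->
  (forall j, exists r, usum (fun i => f (i, j)) r /\ usum (fun i => g (i, j)) r) ->
  usum f s -> usum g t -> s = t.
Proof.
  intros Hf0 Hg0 Hrows Hf Hg; apply Rle_antisym.
  - destruct Hf as [_ Hf]; apply Hf; intros y [l [Hl ->]].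
    apply (usum_rows_le decJ g f t); auto.
    intros j; destruct (Hrows j) as [r [? ?]]; now exists r.
  - destruct Hg as [_ Hg]; apply Hg; intros y [l [Hl ->]].
    now apply (usum_rows_le decJ f g s).
Qed.

Lemma lsum_seq (f : nat -> R) (n : nat) : lsum f (seq 0 (S n)) = sum_n f n.
Proof.
  induction n as [|n IH].
  - simpl; rewrite sum_O; ring.
  - rewrite seq_S, lsum_app, IH, sum_Sn; simpl; unfold plus; simpl; ring.
Qed.

Lemma usum_series (f : nat -> R) (s : R) :
  (forall n, 0 <= f n) -> is_series f s -> usum f s.
Proof.
  intros Hf H.
  assert (Hlim : is_lim_seq (sum_n f) s) by exact H.
  apply usum_intro.
  - intros l Hl.
    set (n := list_max l).
    apply Rle_trans with (lsum f (seq 0 (S n))).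
    + apply lsum_incl; auto; intros i Hi; apply in_seq.
      assert (i <= n)%nat; [|lia].
      generalize (proj1 (list_max_le l n) (le_n _)); intros HF.
      rewrite Forall_forall in HF; auto.
    + rewrite lsum_seq.
      apply (is_lim_seq_incr_compare (sum_n f)); auto.
      intros k; rewrite sum_Sn; unfold plus; simpl; specialize (Hf (S k)); lra.
  - intros eps He.
    apply is_lim_seq_spec in Hlim; destruct (Hlim (mkposreal eps He)) as [N HN].
    exists (seq 0 (S N)); split; [apply seq_NoDup|].
    rewrite lsum_seq; specialize (HN N (le_n _)); simpl in HN.
    apply Rabs_def2 in HN; lra.
Qed.

(** * Hyperbolic sums over the integers *)

Definition Z_of_code (p : bool * nat) : Z :=
  let (b, n) := p in if b then Z.of_nat n else (-1 - Z.of_nat n)%Z.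

Definition code_of_Z (z : Z) : bool * nat :=
  if Z_le_dec 0 z then (true, Z.to_nat z) else (false, Z.to_nat (-1 - z)).

Lemma code_of_Z_of_code (p : bool * nat) : code_of_Z (Z_of_code p) = p.
Proof.
  destruct p as [[|] n]; unfold code_of_Z, Z_of_code.
  - destruct (Z_le_dec 0 (Z.of_nat n)); [f_equal; lia|lia].
  - destruct (Z_le_dec 0 (-1 - Z.of_nat n)); [lia|f_equal; lia].
Qed.

Lemma Z_of_code_of_Z (z : Z) : Z_of_code (code_of_Z z) = z.
Proof. unfold code_of_Z, Z_of_code; destruct (Z_le_dec 0 z); lia. Qed.

Lemma usum_Z (f : Z -> R) (s t : R) :
  (forall z, 0 <= f z) ->
  is_series (fun n => f (Z.of_nat n)) s ->
  is_series (fun n => f (-1 - Z.of_nat n)%Z) t ->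
  usum f (s + t).
Proof.
  intros Hf Hs Ht.
  apply usum_ext with (fun z => (fun p => f (Z_of_code p)) (code_of_Z z)).
  { intros z; simpl; now rewrite Z_of_code_of_Z. }
  apply (usum_bij (fun p => f (Z_of_code p)) code_of_Z Z_of_code).
  - apply Z_of_code_of_Z.
  - apply code_of_Z_of_code.
  - apply usum_bool; [intros; apply Hf| |]; apply usum_series; auto; intros; apply Hf.
Qed.

Lemma is_series_telescope (u : nat -> R) (l : R) :
  is_lim_seq u l -> is_series (fun n => u (S n) - u n) (l - u O).
Proof.
  intros H.
  change (is_lim_seq (sum_n (fun n => u (S n) - u n)) (l - u O)).
  apply is_lim_seq_ext with (fun n => u (S n) - u O).
  - intros n; induction n as [|n IH]; [now rewrite sum_O|].
    rewrite sum_Sn, <- IH; unfold plus; simpl; ring.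
  - apply (is_lim_seq_minus' (fun n => u (S n)) (fun _ => u O)).
    + now apply (is_lim_seq_incr_1 u).
    + apply is_lim_seq_const.
Qed.

Lemma Rminus_opp_opp (x y : R) : - x - - y = y - x.
Proof. ring. Qed.

(** [b] rises from [-1] to [1], so its unit differences total [2]; a difference over [d + 1] steps
    is a sum of [d + 1] shifted unit differences. *)
Lemma usum_telescope (b : Z -> R) (d : nat) :
  (forall z, b z <= b (z + 1)%Z) ->
  is_lim_seq (fun n => b (Z.of_nat n)) 1 ->
  is_lim_seq (fun n => b (- Z.of_nat n)%Z) (-1) ->
  usum (fun z => b (z + Z.of_nat (S d))%Z - b z) (2 * INR (S d)).
Proof.
  intros Hb H1 H2.
  assert (Hmono : forall (n : nat) z, b z <= b (z + Z.of_nat n)%Z).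
  { induction n as [|n IH]; intros z; [right; f_equal; lia|].
    apply Rle_trans with (1 := IH z).
    replace (z + Z.of_nat (S n))%Z with (z + Z.of_nat n + 1)%Z by lia; auto. }
  assert (Hone : usum (fun z => b (z + 1)%Z - b z) 2).
  { replace 2 with ((1 - b 0%Z) + (b 0%Z + 1)) by ring.
    apply usum_Z.
    - intros z; specialize (Hb z); lra.
    - apply is_series_ext with (fun n => b (Z.of_nat (S n)) - b (Z.of_nat n)).
      + intros n; do 2 f_equal; lia.
      + apply (is_series_telescope (fun n => b (Z.of_nat n)) 1 H1).
    - replace (b 0%Z + 1) with (1 - - b 0%Z) by ring.
      apply is_series_ext with (fun n => - b (- Z.of_nat (S n))%Z - - b (- Z.of_nat n)%Z).
      + intros n.
        replace (-1 - Z.of_nat n + 1)%Z with (- Z.of_nat n)%Z by lia.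
        replace (-1 - Z.of_nat n)%Z with (- Z.of_nat (S n))%Z by lia; apply Rminus_opp_opp.
      + apply (is_series_telescope (fun n => - b (- Z.of_nat n)%Z) 1).
        replace 1 with (- -1) by ring.
        now apply (is_lim_seq_opp _ (-1)). }
  induction d as [|d IH].
  - (replace (2 * INR 1) with 2 by (simpl; ring); exact Hone).
  - replace (2 * INR (S (S d))) with (2 + 2 * INR (S d)) by (rewrite (S_INR (S d)); ring).
    apply usum_ext with (fun z => (b (z + Z.of_nat (S d) + 1)%Z - b (z + Z.of_nat (S d))%Z)
                                  + (b (z + Z.of_nat (S d))%Z - b z)).
    { intros z; replace (z + Z.of_nat (S (S d)))%Z with (z + Z.of_nat (S d) + 1)%Z by lia; ring. }
    apply usum_plus; auto.
    + exact Z.eq_dec.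
    + intros z; specialize (Hb (z + Z.of_nat (S d))%Z); lra.
    + intros z; specialize (Hmono (S d) z); lra.
    + apply (usum_bij (fun z => b (z + 1)%Z - b z) (fun z => z + Z.of_nat (S d))%Z
               (fun z => z - Z.of_nat (S d))%Z); auto; intros; lia.
Qed.

(** * Hyperbolic secants and telescoping rows *)

Definition sech (y : R) : R := / cosh y.

Lemma cosh_pos (y : R) : 0 < cosh y.
Proof. unfold cosh; generalize (exp_pos y) (exp_pos (- y)); lra. Qed.

Lemma cosh_opp (y : R) : cosh (- y) = cosh y.
Proof. unfold cosh; rewrite Ropp_involutive; lra. Qed.

Lemma sinh_pos (y : R) : 0 < y -> 0 < sinh y.
Proof. intros H; unfold sinh; assert (exp (- y) < exp y) by (apply exp_increasing; lra); lra. Qed.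

Lemma sech_pos (y : R) : 0 < sech y.
Proof. apply Rinv_0_lt_compat, cosh_pos. Qed.

Lemma sech_opp (y : R) : sech (- y) = sech y.
Proof. unfold sech; now rewrite cosh_opp. Qed.

Lemma sech_0 : sech 0 = 1.
Proof. unfold sech; rewrite cosh_0; lra. Qed.

Lemma cosh_plus_cosh (p q : R) : cosh (p + q) + cosh (p - q) = 2 * (cosh p * cosh q).
Proof.
  unfold cosh; replace (- (p + q)) with (- p + - q) by ring.
  replace (- (p - q)) with (- p + q) by ring; unfold Rminus; rewrite !exp_plus; field.
Qed.

Lemma sinh_minus (p q : R) : sinh (p - q) = sinh p * cosh q - cosh p * sinh q.
Proof.
  unfold cosh, sinh; replace (- (p - q)) with (- p + q) by ring.
  unfold Rminus; rewrite !exp_plus; field.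
Qed.

Lemma tanh_bounds_pos (y : R) : 1 - 2 * exp (- (2 * y)) <= tanh y <= 1.
Proof.
  unfold tanh, sinh, cosh.
  assert (H := exp_pos y); assert (H' := exp_pos (- y)).
  assert (E : exp (- (2 * y)) = exp (- y) * exp (- y)) by (rewrite <- exp_plus; f_equal; ring).
  assert (E1 : exp y * exp (- y) = 1) by (rewrite <- exp_plus, Rplus_opp_r; apply exp_0).
  replace ((exp y - exp (- y)) / 2 / ((exp y + exp (- y)) / 2)) with
    (1 - 2 * (exp (- y) / (exp y + exp (- y)))) by (field; lra).
  assert (0 <= exp (- y) / (exp y + exp (- y)) <= exp (- y) * exp (- y)); [|lra].
  split.
  - apply Rlt_le, Rdiv_lt_0_compat; lra.
  - apply Rle_div_l; [lra|]. nra.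
Qed.

Lemma tanh_opp (y : R) : tanh (- y) = - tanh y.
Proof.
  unfold tanh; rewrite cosh_opp.
  replace (sinh (- y)) with (- sinh y); [field; generalize (cosh_pos y); lra|].
  unfold sinh; rewrite Ropp_involutive; field.
Qed.

Lemma tanh_minus (p q : R) : tanh p - tanh q = sinh (p - q) / (cosh p * cosh q).
Proof.
  rewrite sinh_minus; unfold tanh; generalize (cosh_pos p) (cosh_pos q); intros; field; lra.
Qed.

Lemma is_lim_seq_exp_opp (c e : R) : 0 < c -> is_lim_seq (fun n => exp (- (c * INR n + e))) 0.
Proof.
  intros Hc.
  apply is_lim_seq_ext with (fun n => exp (- e) * exp (- c) ^ n).
  - intros n; replace (- (c * INR n + e)) with (- e + - c * INR n) by ring.
    rewrite exp_plus; f_equal.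
    induction n as [|n IH]; [simpl; rewrite Rmult_0_r, exp_0; auto|].
    rewrite S_INR; simpl; rewrite IH, <- exp_plus; f_equal; ring.
  - replace (Finite 0) with (Rbar_mult (exp (- e)) 0) by (simpl; f_equal; ring).
    apply is_lim_seq_scal_l, is_lim_seq_geom.
    rewrite Rabs_pos_eq by (apply Rlt_le, exp_pos).
    rewrite <- exp_0; apply exp_increasing; lra.
Qed.

Lemma is_lim_seq_tanh (c e : R) : 0 < c -> is_lim_seq (fun n => tanh (c * INR n + e)) 1.
Proof.
  intros Hc.
  apply is_lim_seq_le_le with (fun n => 1 - 2 * exp (- (2 * c * INR n + 2 * e))) (fun _ => 1).
  - intros n; replace (2 * c * INR n + 2 * e) with (2 * (c * INR n + e)) by ring.
    apply tanh_bounds_pos.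
  - replace (Finite 1) with (Finite (1 - 2 * 0)) by (f_equal; ring).
    apply is_lim_seq_minus'; [apply is_lim_seq_const|].
    apply (is_lim_seq_scal_l _ 2 0), is_lim_seq_exp_opp; lra.
  - apply is_lim_seq_const.
Qed.

(* [1 / (cosh p + cosh q)], whose sums along [p] telescope as differences of [tanh]. *)
Definition cker (p q : R) : R := / (cosh p + cosh q).

Lemma cker_pos (p q : R) : 0 < cker p q.
Proof. apply Rinv_0_lt_compat; generalize (cosh_pos p) (cosh_pos q); lra. Qed.

(** The difference of the two [tanh] is [sinh q] over the product of the two [cosh], and twice that
    product is [cosh p + cosh q]. *)
Lemma cker_tanh (p q : R) : q <> 0 ->
  cker p q = / (2 * sinh q) * (tanh ((p + q) / 2) - tanh ((p - q) / 2)).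
Proof.
  intros Hq; rewrite tanh_minus; unfold cker.
  replace ((p + q) / 2 - (p - q) / 2) with q by field.
  assert (E := cosh_plus_cosh ((p + q) / 2) ((p - q) / 2)).
  replace ((p + q) / 2 + (p - q) / 2) with p in E by field.
  replace ((p + q) / 2 - (p - q) / 2) with q in E by field.
  assert (H1 := cosh_pos ((p + q) / 2)); assert (H2 := cosh_pos ((p - q) / 2)).
  rewrite E.
  assert (sinh q <> 0).
  { destruct (Rdichotomy _ _ Hq) as [H|H].
    - assert (0 < sinh (- q)) by (apply sinh_pos; lra).
      replace (sinh (- q)) with (- sinh q) in H0; [lra|].
      unfold sinh; rewrite Ropp_involutive; field.
    - generalize (sinh_pos q H); lra. }
  field; repeat split; lra.
Qed.

Lemma cker_opp_r (p q : R) : cker p (- q) = cker p q.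
Proof. unfold cker; now rewrite cosh_opp. Qed.

Lemma cker_sym (p q : R) : cker p q = cker q p.
Proof. unfold cker; now rewrite Rplus_comm. Qed.

Lemma sech_mult (p q : R) : sech p * sech q = 2 * cker (p + q) (p - q).
Proof.
  unfold sech, cker; rewrite cosh_plus_cosh; generalize (cosh_pos p) (cosh_pos q); intros.
  field; lra.
Qed.

(** As [q] is the odd multiple [2 j + 1] of [x], the two arguments of [tanh] lie [2 j + 1] steps of
    length [x] apart, and the sum telescopes. The result does not contain [e]: this is what makes
    rows of either parity equal. *)
Lemma usum_cker (x e : R) (j : nat) : 0 < x ->
  usum (fun i : Z => cker (x * (2 * IZR i + e)) (x * (2 * INR j + 1)))
    (/ (2 * sinh (x * (2 * INR j + 1))) * (2 * INR (S (2 * j)))).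
Proof.
  intros Hx; set (q := x * (2 * INR j + 1)).
  assert (Hq : 0 < q) by (unfold q; generalize (pos_INR j); intros; nra).
  set (b := fun i : Z => tanh (x * IZR i + (x * e - q) / 2)).
  apply usum_ext with (fun i => / (2 * sinh q) * (b (i + Z.of_nat (S (2 * j)))%Z - b i)).
  - intros i; rewrite cker_tanh by lra; f_equal; unfold b.
    f_equal; f_equal; [|field].
    rewrite plus_IZR, <- INR_IZR_INZ, S_INR, mult_INR; unfold q; simpl; field.
  - apply usum_scal.
    + apply Rinv_0_lt_compat; generalize (sinh_pos q Hq); lra.
    + apply usum_telescope.
      * intros z; unfold b; rewrite plus_IZR; apply Rminus_le_0; rewrite tanh_minus.
        apply Rlt_le, Rdiv_lt_0_compat.
        -- apply sinh_pos; lra.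
        -- apply Rmult_lt_0_compat; apply cosh_pos.
      * apply is_lim_seq_ext with (fun n => tanh (x * INR n + (x * e - q) / 2)).
        -- intros n; unfold b; now rewrite <- INR_IZR_INZ.
        -- now apply is_lim_seq_tanh.
      * apply is_lim_seq_ext with (fun n => - tanh (x * INR n + (q - x * e) / 2)).
        -- intros n; unfold b; rewrite opp_IZR, <- INR_IZR_INZ, <- tanh_opp; f_equal; field.
        -- apply (is_lim_seq_opp _ 1); now apply is_lim_seq_tanh.
Qed.

(** [usum_cker] with [e = 0] and [e = 1]. A negative [j] is reflected to [- j - 1], which only
    changes the sign of [2 j + 1]. *)
Lemma usum_cker_rows (x : R) (j : Z) : 0 < x -> exists r,
  usum (fun i : Z => cker (x * (2 * IZR i)) (x * (2 * IZR j + 1))) r /\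
  usum (fun i : Z => cker (x * (2 * IZR i + 1)) (x * (2 * IZR j + 1))) r.
Proof.
  intros Hx.
  assert (Hpos : forall n : nat, exists r, forall s, s = x * (2 * INR n + 1) ->
    usum (fun i : Z => cker (x * (2 * IZR i)) s) r /\
    usum (fun i : Z => cker (x * (2 * IZR i + 1)) s) r).
  { intros n; exists (/ (2 * sinh (x * (2 * INR n + 1))) * (2 * INR (S (2 * n)))).
    intros s ->; split; [|now apply usum_cker].
    apply usum_ext with (2 := usum_cker x 0 n Hx); intros i; now rewrite Rplus_0_r. }
  destruct (Z_le_dec 0 j) as [H|H].
  - destruct (Hpos (Z.to_nat j)) as [r Hr]; exists r; apply Hr.
    rewrite INR_IZR_INZ, Z2Nat.id; auto.
  - destruct (Hpos (Z.to_nat (- j - 1))) as [r Hr]; exists r.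
    destruct (Hr (- (x * (2 * IZR j + 1)))) as [H1 H2].
    + rewrite INR_IZR_INZ, Z2Nat.id by lia.
      rewrite minus_IZR, opp_IZR; ring.
    + split; [eapply usum_ext with (2 := H1)|eapply usum_ext with (2 := H2)];
        intros i; apply cker_opp_r.
Qed.

Lemma usum_ex {I : Type} (f : I -> R) (B : R) :
  (forall l, NoDup l -> lsum f l <= B) -> exists s, usum f s.
Proof.
  intros H.
  destruct (completeness (fun y => exists l, NoDup l /\ y = lsum f l)) as [s Hs].
  - exists B; intros y [l [Hl ->]]; auto.
  - exists 0, nil; split; [constructor|reflexivity].
  - now exists s.
Qed.

(** Recovers the sum of one copy from that of two copies. It exists because a single copy is a part
    of the doubled family and hence bounded. *)
Lemma usum_snd_bool {I : Type} (f : I -> R) (s : R) :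
  (forall i, 0 <= f i) -> usum (fun p : bool * I => f (snd p)) s -> usum f (s / 2).
Proof.
  intros Hf H.
  destruct (usum_ex f s) as [r Hr].
  { intros l Hl; rewrite <- (lsum_map (fun p : bool * I => f (snd p)) (pair true)).
    apply usum_ge; auto; apply Injective_map_NoDup; auto; intros x y E; now injection E. }
  assert (E : s = r + r).
  { apply usum_unique with (1 := H).
    apply (usum_bool (fun p : bool * I => f (snd p))); auto. }
  replace (s / 2) with r; auto; rewrite E; field.
Qed.

(** Dominated by [sech y <= 2 * exp (- y)], which holds for every real [y]. *)
Lemma ex_series_sech (x e : R) : 0 < x -> ex_series (fun n => sech (x * (INR n + e))).
Proof.
  intros Hx.
  apply (@ex_series_le R_AbsRing R_CompleteNormedModule) with
    (fun n => 2 * exp (- (x * e)) * exp (- x) ^ n).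
  - intros n; change (Rabs (sech (x * (INR n + e))) <= 2 * exp (- (x * e)) * exp (- x) ^ n).
    rewrite Rabs_pos_eq by (apply Rlt_le, sech_pos).
    assert (E : exp (- (x * e)) * exp (- x) ^ n = exp (- (x * (INR n + e)))).
    { replace (- (x * (INR n + e))) with (- (x * e) + - x * INR n) by ring.
      rewrite exp_plus; f_equal; induction n as [|n IH].
      - simpl; now rewrite Rmult_0_r, exp_0.
      - rewrite S_INR; simpl; rewrite IH, <- exp_plus; f_equal; ring. }
    rewrite Rmult_assoc, E; unfold sech, cosh.
    set (y := x * (INR n + e)).
    assert (H1 := exp_pos y); assert (H2 := exp_pos (- y)).
    assert (E1 : exp y * exp (- y) = 1) by (rewrite <- exp_plus, Rplus_opp_r; apply exp_0).
    replace (/ ((exp y + exp (- y)) / 2)) with (2 / (exp y + exp (- y))) by (field; lra).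
    apply Rle_div_l; nra.
  - apply (ex_series_scal_l (2 * exp (- (x * e))) (fun n => exp (- x) ^ n)), ex_series_geom.
    rewrite Rabs_pos_eq by (apply Rlt_le, exp_pos).
    rewrite <- exp_0; apply exp_increasing; lra.
Qed.

(* [sum_{m in Z} sech (x m)] and [sum_{m in Z} sech (x (m + 1/2))]: with
   [q = exp (- x)] these are [theta_3 (q) ^ 2] and [theta_2 (q) ^ 2]. *)
Definition theta3_sq (x : R) : R := 1 + 2 * Series (fun n => sech (x * (INR n + 1))).
Definition theta2_sq (x : R) : R := 2 * Series (fun n => sech (x * (INR n + / 2))).

Lemma usum_theta3_sq (x : R) : 0 < x -> usum (fun z => sech (x * IZR z)) (theta3_sq x).
Proof.
  intros Hx.
  set (s := Series (fun n => sech (x * (INR n + 1)))).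
  assert (Hs : is_series (fun n => sech (x * (INR n + 1))) s)
    by now apply Series_correct, ex_series_sech.
  replace (theta3_sq x) with ((s + 1) + s) by (unfold theta3_sq; fold s; ring).
  apply usum_Z.
  - intros z; apply Rlt_le, sech_pos.
  - apply is_series_decr_1 with (a := fun n => sech (x * IZR (Z.of_nat n))).
    match goal with |- is_series _ ?v => replace v with s end.
    + apply is_series_ext with (2 := Hs); intros n; rewrite <- INR_IZR_INZ, S_INR; auto.
    + unfold plus, opp; simpl; rewrite Rmult_0_r, sech_0; ring.
  - apply is_series_ext with (2 := Hs); intros n.
    rewrite minus_IZR, <- INR_IZR_INZ, <- sech_opp; f_equal; ring.
Qed.

Lemma usum_theta2_sq (x : R) : 0 < x -> usum (fun z => sech (x * (IZR z + / 2))) (theta2_sq x).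
Proof.
  intros Hx.
  set (s := Series (fun n => sech (x * (INR n + / 2)))).
  assert (Hs : is_series (fun n => sech (x * (INR n + / 2))) s)
    by now apply Series_correct, ex_series_sech.
  replace (theta2_sq x) with (s + s) by (unfold theta2_sq; fold s; ring).
  apply usum_Z.
  - intros z; apply Rlt_le, sech_pos.
  - apply is_series_ext with (2 := Hs); intros n; now rewrite <- INR_IZR_INZ.
  - apply is_series_ext with (2 := Hs); intros n.
    rewrite minus_IZR, <- INR_IZR_INZ, <- sech_opp; f_equal; field.
Qed.

(** Splits the integers by parity: [x (2 i + 1) = 2 x (i + 1/2)]. *)
Lemma theta3_sq_double (x : R) : 0 < x -> theta3_sq x = theta3_sq (2 * x) + theta2_sq (2 * x).
Proof.
  intros Hx.
  apply usum_unique with (fun p : bool * Z =>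
    sech (x * IZR (if fst p then 2 * snd p else 2 * snd p + 1))).
  - apply (usum_bij (fun z => sech (x * IZR z))
      (fun p : bool * Z => if fst p then 2 * snd p else 2 * snd p + 1)%Z
      (fun z => if Z.eq_dec (z mod 2) 0 then (true, z / 2) else (false, z / 2))%Z).
    + intros [[|] z]; simpl fst; simpl snd;
        destruct Z.eq_dec as [H|H];
        try (exfalso; Z.to_euclidean_division_equations; lia);
        apply (f_equal (pair _)); Z.to_euclidean_division_equations; lia.
    + intros z; destruct Z.eq_dec as [H|H]; cbn [fst snd]; Z.to_euclidean_division_equations; lia.
    + now apply usum_theta3_sq.
  - apply usum_bool; cbn [fst snd].
    + intros i; apply Rlt_le, sech_pos.
    + apply usum_ext with (2 := usum_theta3_sq (2 * x) ltac:(lra)); intros i.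
      rewrite mult_IZR; f_equal; ring.
    + apply usum_ext with (2 := usum_theta2_sq (2 * x) ltac:(lra)); intros i.
      rewrite plus_IZR, mult_IZR; f_equal; field.
Qed.

(** By [sech_mult] both sides are lattice sums of [cker]. On the left the multiples [n + m + 1] and
    [n - m] of [x] have opposite parity, which covers the lattice of [F] twice; on the right both
    multiples are odd, which gives half the lattice of [G], the other half being its mirror image.
    [F] and [G] have the same row sums. *)
Lemma theta2_sq_double (x : R) : 0 < x ->
  theta2_sq x * theta2_sq x = 4 * (theta3_sq (2 * x) * theta2_sq (2 * x)).
Proof.
  intros Hx.
  set (F := fun p : Z * Z => cker (x * (2 * IZR (fst p))) (x * (2 * IZR (snd p) + 1))).
  set (G := fun p : Z * Z => cker (x * (2 * IZR (fst p) + 1)) (x * (2 * IZR (snd p) + 1))).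
  assert (HF0 : forall p, 0 <= F p) by (intros; apply Rlt_le, cker_pos).
  assert (HG0 : forall p, 0 <= G p) by (intros; apply Rlt_le, cker_pos).
  assert (HF : usum F (theta2_sq x * theta2_sq x / 2 / 2)).
  { apply usum_snd_bool; auto.
    replace (theta2_sq x * theta2_sq x / 2) with (/ 2 * (theta2_sq x * theta2_sq x)) by field.
    apply usum_ext with (fun p => / 2 * (2 * F (snd p))); [intros; field|].
    apply usum_scal; [lra|].
    assert (H := usum_prod Z.eq_dec Z.eq_dec _ _ _ _
      (fun z => Rlt_le _ _ (sech_pos (x * (IZR z + / 2))))
      (fun z => Rlt_le _ _ (sech_pos (x * (IZR z + / 2)))) (usum_theta2_sq x Hx) (usum_theta2_sq
        x Hx)).
    (* [true] stands for [n + m + 1 = 2 i] and [false] for [n + m + 1 = 2 j + 1]; the symmetry of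
       [cker] brings both cases to [F (i, j)]. *)
    apply (usum_bij _
      (fun p : bool * (Z * Z) => let (b, ij) := p in let (i, j) := ij in
         if b then (i + j, i - j - 1) else (i + j, j - i))%Z
      (fun p : Z * Z => let (n, m) := p in
         if Z.eq_dec ((n - m) mod 2) 0 then (false, ((n - m) / 2, (n + m) / 2))
         else (true, ((n + m + 1) / 2, (n - m - 1) / 2)))%Z) in H.
    - apply usum_ext with (2 := H); intros [[|] [i j]]; unfold F; simpl fst; simpl snd;
        rewrite sech_mult; repeat rewrite ?plus_IZR, ?minus_IZR.
      + f_equal; f_equal; field.
      + f_equal; rewrite cker_sym; f_equal; field.
    - intros [[|] [i j]]; destruct Z.eq_dec as [E|E];
        try (exfalso; Z.to_euclidean_division_equations; lia);
        apply (f_equal (pair _)), f_equal2; Z.to_euclidean_division_equations; lia.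
    - intros [n m]; destruct Z.eq_dec as [E|E]; apply f_equal2;
        Z.to_euclidean_division_equations; lia. }
  assert (HG : usum G (theta3_sq (2 * x) * theta2_sq (2 * x))).
  { assert (H := usum_prod Z.eq_dec Z.eq_dec _ _ _ _
      (fun z => Rlt_le _ _ (sech_pos (2 * x * IZR z)))
      (fun z => Rlt_le _ _ (sech_pos (2 * x * (IZR z + / 2))))
      (usum_theta3_sq (2 * x) ltac:(lra)) (usum_theta2_sq (2 * x) ltac:(lra))).
    apply (usum_scal _ (/ 2)) in H; [|lra].
    set (s := theta3_sq (2 * x) * theta2_sq (2 * x)) in *.
    (* For [true] the two indices of [G] have an odd sum. For [false] the second odd multiple of [x]
       changes sign, which leads to an even sum and leaves [cker] unchanged. *)
    set (g := fun p : bool * (Z * Z) => let (b, jk) := p in let (j, k) := jk in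
         if b then (j + k, j - k - 1)%Z else (j + k, k - j)%Z).
    set (h := fun p : Z * Z => let (p, q) := p in
         if Z.eq_dec ((p + q) mod 2) 0 then (false, ((p - q) / 2, (p + q) / 2))%Z
         else (true, ((p + q + 1) / 2, (p - q - 1) / 2))%Z).
    assert (Hhg : forall p, h (g p) = p).
    { intros [[|] [j k]]; unfold g, h; destruct Z.eq_dec as [E|E];
        try (exfalso; Z.to_euclidean_division_equations; lia);
        apply (f_equal (pair _)), f_equal2; Z.to_euclidean_division_equations; lia. }
    assert (Hgh : forall p, g (h p) = p).
    { intros [p q]; unfold h; destruct Z.eq_dec as [E|E]; unfold g; apply f_equal2;
        Z.to_euclidean_division_equations; lia. }
    apply usum_ext with (fun p => (fun p => G (g p)) (h p)).
    { intros p; now rewrite Hgh. }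
    apply (usum_bij (fun p => G (g p)) h g); auto.
    replace s with (/ 2 * s + / 2 * s) by field.
    apply usum_bool; auto; apply usum_ext with (2 := H); intros [j k]; unfold G, g;
      simpl fst; simpl snd; rewrite sech_mult; repeat rewrite ?plus_IZR, ?minus_IZR;
      rewrite <- Rmult_assoc, Rinv_l, Rmult_1_l by lra.
    - f_equal; field.
    - rewrite <- cker_opp_r; f_equal; field. }
  assert (E := usum_rows Z.eq_dec F G _ _ HF0 HG0 (fun j => usum_cker_rows x j Hx) HF HG).
  lra.
Qed.

(** * Asymptotics and the arithmetic-geometric mean *)

Lemma cosh_le (p q : R) : 0 <= p <= q -> cosh p <= cosh q.
Proof.
  intros [H0 [H| ->]]; [|lra].
  destruct (MVT_gen cosh p q sinh) as [c [Hc E]].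
  - intros y _; apply is_derive_Reals, derivable_pt_lim_cosh.
  - intros y _; apply derivable_continuous_pt, derivable_pt_cosh.
  - rewrite Rmin_left, Rmax_right in Hc by lra.
    assert (0 <= sinh c).
    { destruct (Req_dec c 0) as [->|]; [rewrite sinh_0; lra|apply Rlt_le, sinh_pos; lra]. }
    nra.
Qed.

Lemma sech_le (p q : R) : 0 <= p <= q -> sech q <= sech p.
Proof. intros H; apply Rinv_le_contravar; [apply cosh_pos|now apply cosh_le]. Qed.

(** The Gudermannian function minus [PI / 2]: the antiderivative of [sech] that vanishes at
    infinity. *)
Definition gd (t : R) : R := - 2 * atan (exp (- t)).

Lemma is_derive_gd (t : R) : is_derive gd t (sech t).
Proof.
  unfold gd, sech, cosh; auto_derive; auto.
  assert (H := exp_pos t); assert (H' := exp_pos (- t)).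
  assert (E1 : exp t * exp (- t) = 1) by (rewrite <- exp_plus, Rplus_opp_r; apply exp_0).
  replace (exp t) with (/ exp (- t)) by (rewrite exp_Ropp, Rinv_inv; auto).
  field; nra.
Qed.

Lemma gd_incr_bounds (p q : R) : 0 <= p < q ->
  (q - p) * sech q <= gd q - gd p <= (q - p) * sech p.
Proof.
  intros Hpq.
  destruct (MVT_gen gd p q sech) as [c [Hc E]].
  - intros y _; apply is_derive_gd.
  - intros y _; apply derivable_continuous_pt.
    exists (sech y); apply is_derive_Reals, is_derive_gd.
  - rewrite Rmin_left, Rmax_right in Hc by lra.
    rewrite E; split.
    + rewrite Rmult_comm; apply Rmult_le_compat_r; [lra|apply sech_le; lra].
    + rewrite Rmult_comm; apply Rmult_le_compat_l; [lra|apply sech_le; lra].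
Qed.

Lemma is_series_gd (y : R) : 0 < y ->
  is_series (fun n => gd (y * (INR n + 1)) - gd (y * (INR n + 0))) (PI / 2).
Proof.
  intros Hy.
  assert (H := is_series_telescope (fun n => gd (y * INR n)) 0).
  replace (PI / 2) with (0 - gd (y * INR 0)).
  - apply is_series_ext with (fun n => gd (y * INR (S n)) - gd (y * INR n)).
    + intros n; rewrite S_INR, Rplus_0_r; auto.
    + apply H; unfold gd.
      replace (Finite 0) with (Finite (-2 * 0)) by (f_equal; ring).
      apply (is_lim_seq_scal_l _ (-2) 0).
      rewrite <- atan_0; apply is_lim_seq_continuous.
      * apply derivable_continuous_pt, derivable_pt_atan.
      * apply is_lim_seq_ext with (fun n => exp (- (y * INR n + 0))).
        -- intros n; now rewrite Rplus_0_r.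
        -- now apply is_lim_seq_exp_opp.
  - unfold gd; simpl; rewrite Rmult_0_r, Ropp_0, exp_0, atan_1; field.
Qed.

Lemma sech_series_shift_0 (y : R) : 0 < y ->
  Series (fun n => sech (y * (INR n + 0))) = 1 + Series (fun n => sech (y * (INR n + 1))).
Proof.
  intros Hy; rewrite Series_incr_1 by now apply ex_series_sech.
  f_equal.
  - simpl; rewrite Rplus_0_r, Rmult_0_r; apply sech_0.
  - apply Series_ext; intros n; rewrite S_INR; f_equal; ring.
Qed.

Lemma sech_series_mono (y d e : R) : 0 < y -> 0 <= d <= e ->
  Series (fun n => sech (y * (INR n + e))) <= Series (fun n => sech (y * (INR n + d))).
Proof.
  intros Hy Hd; apply Series_le; [|now apply ex_series_sech].
  intros n; split; [apply Rlt_le, sech_pos|].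
  apply sech_le; generalize (pos_INR n); intros; nra.
Qed.

(** Riemann sums of the decreasing function [sech] with mesh [y]: right end points give a lower and
    left end points an upper sum for the integral [PI / 2], and the two differ by
    [y * sech 0 = y]. *)
Lemma sech_series_bounds (y : R) : 0 < y ->
  PI / 2 - y <= y * Series (fun n => sech (y * (INR n + 1))) <= PI / 2.
Proof.
  intros Hy.
  assert (Hgd := is_series_gd y Hy).
  rewrite <- (is_series_unique _ _ Hgd).
  assert (B : forall n, y * sech (y * (INR n + 1)) <=
    gd (y * (INR n + 1)) - gd (y * (INR n + 0)) <= y * sech (y * (INR n + 0))).
  { intros n; assert (Hn := pos_INR n).
    assert (H := gd_incr_bounds (y * (INR n + 0)) (y * (INR n + 1)) ltac:(nra)).
    now replace (y * (INR n + 1) - y * (INR n + 0)) with y in H by ring. }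
  assert (E : y * Series (fun n => sech (y * (INR n + 0))) =
    y + y * Series (fun n => sech (y * (INR n + 1)))).
  { rewrite sech_series_shift_0 by auto; ring. }
  rewrite <- !Series_scal_l in *.
  assert (Hp : forall n, 0 <= y * sech (y * (INR n + 1))).
  { intros n; generalize (sech_pos (y * (INR n + 1))); nra. }
  split.
  - assert (Series (fun n => gd (y * (INR n + 1)) - gd (y * (INR n + 0))) <=
            Series (fun n => y * sech (y * (INR n + 0)))); [|lra].
    apply Series_le; [intros n; specialize (B n); specialize (Hp n); lra|].
    now apply (ex_series_scal_l y (fun n => sech (y * (INR n + 0)))), ex_series_sech.
  - apply Series_le; [intros n; specialize (B n); specialize (Hp n); lra|].
    now exists (PI / 2).
Qed.

Lemma theta3_sq_bounds (y : R) : 0 < y -> PI - y <= y * theta3_sq y <= PI + y.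
Proof. intros Hy; generalize (sech_series_bounds y Hy); unfold theta3_sq; lra. Qed.

Lemma sech_series_pos (y d : R) : 0 < y -> 0 < Series (fun n => sech (y * (INR n + d))).
Proof.
  intros Hy.
  rewrite Series_incr_1 by now apply ex_series_sech.
  apply Rplus_lt_le_0_compat; [apply sech_pos|].
  rewrite <- (Rmult_0_l (Series (fun _ => 0))), <- Series_scal_l.
  apply Series_le.
  - intros n; rewrite Rmult_0_l; split; [lra|apply Rlt_le, sech_pos].
  - apply (ex_series_incr_1 (fun n => sech (y * (INR n + d)))).
    now apply ex_series_sech.
Qed.

Lemma theta3_sq_gt_1 (y : R) : 0 < y -> 1 < theta3_sq y.
Proof. intros Hy; generalize (sech_series_pos y 1 Hy); unfold theta3_sq; lra. Qed.

Lemma theta2_sq_pos (y : R) : 0 < y -> 0 < theta2_sq y.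
Proof. intros Hy; generalize (sech_series_pos y (/ 2) Hy); unfold theta2_sq; lra. Qed.

Lemma theta2_sq_bounds (y : R) : 0 < y -> PI - 2 * y <= y * theta2_sq y <= PI + 2 * y.
Proof.
  intros Hy; generalize (sech_series_bounds y Hy); unfold theta2_sq.
  assert (H1 := sech_series_mono y (/ 2) 1 Hy ltac:(lra)).
  assert (H2 := sech_series_mono y 0 (/ 2) Hy ltac:(lra)).
  rewrite sech_series_shift_0 in H2 by auto.
  intros; nra.
Qed.

Lemma theta3_sq_le (y : R) : 0 < y -> theta3_sq y <= 1 + PI / y.
Proof.
  intros Hy; generalize (sech_series_bounds y Hy); unfold theta3_sq; intros H.
  assert (Series (fun n => sech (y * (INR n + 1))) <= PI / 2 / y).
  { apply Rle_div_r; lra. }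
  unfold Rdiv in *; lra.
Qed.

(** [theta3_sq_double] at [y / 2] gives [theta2_sq y = theta3_sq (y / 2) - theta3_sq y], where the
    subtracted term exceeds [1]. *)
Lemma theta2_sq_le (y : R) : 0 < y -> theta2_sq y <= 2 * PI / y.
Proof.
  intros Hy.
  assert (E := theta3_sq_double (y / 2) ltac:(lra)).
  replace (2 * (y / 2)) with y in E by field.
  assert (H := theta3_sq_le (y / 2) ltac:(lra)); assert (H1 := theta3_sq_gt_1 y Hy).
  replace (2 * PI / y) with (PI / (y / 2)) by (field; lra); lra.
Qed.

(* [theta_4 (q) ^ 2] for [q = exp (- x)]. *)
Definition theta4_sq (x : R) : R := theta3_sq (2 * x) - theta2_sq (2 * x).

Lemma theta4_sq_square (x : R) : 0 < x ->
  theta4_sq x * theta4_sq x = theta3_sq x * theta3_sq x - theta2_sq x * theta2_sq x.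
Proof. intros Hx; rewrite theta2_sq_double, (theta3_sq_double x) by auto; unfold theta4_sq;
  ring. Qed.

(** The geometric mean of the step; the arithmetic mean is [theta3_sq_double] combined with the
    definition of [theta4_sq]. *)
Lemma theta4_sq_double (x : R) : 0 < x ->
  theta4_sq (2 * x) * theta4_sq (2 * x) = theta3_sq x * theta4_sq x.
Proof. intros Hx; rewrite theta4_sq_square, (theta3_sq_double x) by lra; unfold theta4_sq;
  ring. Qed.

Lemma pow2_unbounded (x : R) : 0 < x -> forall M, exists n, M <= 2 ^ n * x.
Proof.
  intros Hx M; destruct (Pow_x_infinity 2 ltac:(rewrite Rabs_pos_eq; lra) (M / x)) as [N HN].
  exists N; specialize (HN N (le_n _)).
  rewrite Rabs_pos_eq in HN by (apply pow_le; lra).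
  apply Rge_le in HN; apply Rle_div_l in HN; lra.
Qed.

Lemma two_pow_pos (n : nat) : 0 < 2 ^ n.
Proof. apply pow_lt; lra. Qed.

(** Descent from large arguments: for [x >= 2 PI] the explicit bounds suffice, and [theta3_sq x *
    theta4_sq x = theta4_sq (2 x) ^ 2] carries the sign from [2 x] back to [x]. *)
Lemma theta4_sq_pos (x : R) : 0 < x -> 0 < theta4_sq x.
Proof.
  intros Hx.
  destruct (pow2_unbounded x Hx (2 * PI)) as [n Hn].
  revert x Hx Hn; induction n as [|n IH]; intros x Hx Hn.
  - simpl in Hn; unfold theta4_sq.
    assert (H1 := theta3_sq_gt_1 (2 * x) ltac:(lra));
      assert (H2 := theta2_sq_le (2 * x) ltac:(lra)).
    assert (2 * PI / (2 * x) <= 1) by (apply Rle_div_l; lra); lra.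
  - assert (H := IH (2 * x) ltac:(lra)).
    assert (H0 : 0 < theta4_sq (2 * x)) by (apply H; simpl in Hn; nra).
    assert (E := theta4_sq_double x Hx); assert (H1 := theta3_sq_gt_1 x Hx); nra.
Qed.

(** * Gauss's integral and Landen's transformation *)

Definition agm_form (a b t : R) : R := a ^ 2 * cos t ^ 2 + b ^ 2 * sin t ^ 2.

Definition agm_int (a b : R) : R := RInt (fun t => / sqrt (agm_form a b t)) 0 (PI / 2).

Lemma agm_form_bounds (m M a b t : R) : 0 <= m -> m <= a <= M -> m <= b <= M ->
  m ^ 2 <= agm_form a b t <= M ^ 2.
Proof.
  intros Hm Ha Hb; unfold agm_form; assert (H := sin2_cos2 t); unfold Rsqr in H.
  assert (Hc : cos t ^ 2 = 1 - sin t ^ 2) by nra; rewrite Hc.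
  assert (Hs : 0 <= sin t ^ 2 <= 1) by nra.
  assert (m ^ 2 <= a ^ 2 <= M ^ 2) by nra.
  assert (m ^ 2 <= b ^ 2 <= M ^ 2) by nra.
  nra.
Qed.

Lemma agm_form_pos (a b t : R) : 0 < a -> 0 < b -> 0 < agm_form a b t.
Proof.
  intros Ha Hb; set (m := Rmin a b); set (M := Rmax a b).
  assert (0 < m) by now apply Rmin_pos.
  assert (H1 := agm_form_bounds m M a b t ltac:(lra)
    (conj (Rmin_l _ _) (Rmax_l _ _)) (conj (Rmin_r _ _) (Rmax_r _ _))); nra.
Qed.

Lemma continuous_agm (a b t : R) : 0 < a -> 0 < b ->
  continuous (fun t => / sqrt (agm_form a b t)) t.
Proof.
  intros Ha Hb; apply (ex_derive_continuous (V := R_NormedModule)).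
  assert (H := agm_form_pos a b t Ha Hb); unfold agm_form in *; auto_derive.
  simpl in H; split; [|split; [|auto]]; simpl.
  - lra.
  - apply Rgt_not_eq, sqrt_lt_R0; simpl in *; lra.
Qed.

Lemma ex_RInt_agm (a b u v : R) : 0 < a -> 0 < b ->
  ex_RInt (fun t => / sqrt (agm_form a b t)) u v.
Proof. intros Ha Hb; apply (ex_RInt_continuous (V := R_CompleteNormedModule)); intros;
  now apply continuous_agm. Qed.

Lemma agm_int_bounds (m M a b : R) : 0 < m -> m <= a <= M -> m <= b <= M ->
  PI / 2 / M <= agm_int a b <= PI / 2 / m.
Proof.
  intros Hm Ha Hb.
  assert (HP := PI_RGT_0).
  assert (B : forall t, / M <= / sqrt (agm_form a b t) <= / m).
  { intros t; assert (H := agm_form_bounds m M a b t ltac:(lra) Ha Hb).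
    assert (m <= sqrt (agm_form a b t) <= M).
    { split.
      - rewrite <- (sqrt_pow2 m) by lra; apply sqrt_le_1_alt; lra.
      - rewrite <- (sqrt_pow2 M) by lra; apply sqrt_le_1_alt; lra. }
    split; apply Rinv_le_contravar; lra. }
  split.
  - replace (PI / 2 / M) with (RInt (fun _ => / M) 0 (PI / 2)).
    + apply RInt_le; [lra|apply ex_RInt_const|apply ex_RInt_agm; lra|intros; apply B].
    + rewrite RInt_const; unfold scal; simpl; unfold mult; simpl; field; lra.
  - replace (PI / 2 / m) with (RInt (fun _ => / m) 0 (PI / 2)).
    + apply RInt_le; [lra|apply ex_RInt_agm; lra|apply ex_RInt_const|intros; apply B].
    + rewrite RInt_const; unfold scal; simpl; unfold mult; simpl; field; lra.
Qed.

Lemma agm_int_scal (l a b : R) : 0 < l -> 0 < a -> 0 < b ->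
  agm_int (l * a) (l * b) = agm_int a b / l.
Proof.
  intros Hl Ha Hb; unfold agm_int, Rdiv; rewrite (Rmult_comm _ (/ l)).
  change (RInt (fun t => / sqrt (agm_form (l * a) (l * b) t)) 0 (PI / 2) =
    scal (/ l) (RInt (fun t => / sqrt (agm_form a b t)) 0 (PI / 2))).
  rewrite <- (RInt_scal (V := R_CompleteNormedModule)) by now apply ex_RInt_agm.
  apply RInt_ext; intros t _; unfold scal; simpl; unfold mult; simpl.
  assert (H := agm_form_pos a b t Ha Hb).
  replace (agm_form (l * a) (l * b) t) with (l ^ 2 * agm_form a b t) by (unfold agm_form; ring).
  rewrite sqrt_mult_alt, sqrt_pow2 by nra.
  assert (0 < sqrt (agm_form a b t)) by now apply sqrt_lt_R0.
  field; lra.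
Qed.

(** Landen's angle [t + s] with [tan s = (b / a) tan t], where [t - s] is expressed by the
    subtraction formula for [tan]. In this form it is smooth across [t = PI / 2], where [tan] is
    not. *)
Definition landen (a b t : R) : R :=
  2 * t - atan ((a - b) * (sin t * cos t) / (a * cos t ^ 2 + b * sin t ^ 2)).

Lemma landen_den_pos (a b t : R) : 0 < a -> 0 < b -> 0 < a * cos t ^ 2 + b * sin t ^ 2.
Proof.
  intros Ha Hb; assert (H := agm_form_pos (sqrt a) (sqrt b) t (sqrt_lt_R0 _ Ha) (sqrt_lt_R0 _ Hb)).
  unfold agm_form in H; rewrite !pow2_sqrt in H; lra.
Qed.

Lemma is_derive_landen (a b t : R) : 0 < a -> 0 < b ->
  is_derive (landen a b) t (1 + a * b / agm_form a b t).
Proof.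
  intros Ha Hb.
  assert (H := landen_den_pos a b t Ha Hb); assert (H' := agm_form_pos a b t Ha Hb).
  assert (Hc : cos t ^ 2 = 1 - sin t ^ 2) by (generalize (sin2_cos2 t); unfold Rsqr; nra).
  set (u := (a - b) * (sin t * cos t) / (a * cos t ^ 2 + b * sin t ^ 2)).
  assert (E : 1 + u ^ 2 = agm_form a b t / (a * cos t ^ 2 + b * sin t ^ 2) ^ 2).
  { unfold u, agm_form.
    replace (1 + ((a - b) * (sin t * cos t) / (a * cos t ^ 2 + b * sin t ^ 2)) ^ 2) with
      (((a * cos t ^ 2 + b * sin t ^ 2) ^ 2 + (a - b) ^ 2 * sin t ^ 2 * cos t ^ 2)
       / (a * cos t ^ 2 + b * sin t ^ 2) ^ 2) by (field; lra).
    f_equal; rewrite Hc; ring. }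
  unfold landen; auto_derive; [simpl in *; lra|].
  match goal with |- context [/ (1 + ?X)] => replace (1 + X) with (1 + u ^ 2) by (unfold u, Rdiv;
    simpl; ring) end.
  rewrite E; set (D := agm_form a b t) in *.
  set (S := sin t) in *; set (C := cos t) in *.
  replace (1 + a * b / D) with (2 - (D - a * b) / D) by (field; lra).
  replace (D - a * b) with
    ((a - b) * (C ^ 2 - S ^ 2) * (a * C ^ 2 + b * S ^ 2) + 2 * (a - b) ^ 2 * (C ^ 2 * S ^ 2)).
  - field; simpl in H; lra.
  - unfold D, agm_form; fold C S; rewrite Hc; ring.
Qed.

(** With [D = a cos^2 + b sin^2] and [Q = agm_form a b t], the new form at Landen's angle is
    [((a + b) / 2 * D) ^ 2 / Q] and the derivative of the angle is [(a + b) * D / Q]; [D] cancels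
    and [2 / sqrt Q] remains. *)
Lemma agm_form_landen (a b t : R) : 0 < a -> 0 < b ->
  / sqrt (agm_form ((a + b) / 2) (sqrt (a * b)) (landen a b t)) * (1 + a * b / agm_form a b t)
  = 2 * / sqrt (agm_form a b t).
Proof.
  intros Ha Hb.
  assert (H := landen_den_pos a b t Ha Hb); assert (H' := agm_form_pos a b t Ha Hb).
  assert (Hc : cos t ^ 2 = 1 - sin t ^ 2) by (generalize (sin2_cos2 t); unfold Rsqr; nra).
  set (D := a * cos t ^ 2 + b * sin t ^ 2) in *; set (Q := agm_form a b t) in *.
  set (u := (a - b) * (sin t * cos t) / D).
  assert (E : 1 + u ^ 2 = Q / D ^ 2).
  { unfold u, Q, agm_form.
    replace (1 + ((a - b) * (sin t * cos t) / D) ^ 2) with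
      ((D ^ 2 + (a - b) ^ 2 * sin t ^ 2 * cos t ^ 2) / D ^ 2) by (field; lra).
    f_equal; unfold D; rewrite Hc; ring. }
  assert (Hcos : cos (landen a b t) ^ 2 = (a * cos t ^ 2 - b * sin t ^ 2) ^ 2 / Q).
  { unfold landen; fold D u; rewrite cos_minus, cos_atan, sin_atan, cos_2a, sin_2a.
    assert (Hw : 0 < 1 + u ^ 2) by nra.
    replace (1 + Rsqr u) with (1 + u ^ 2) by (unfold Rsqr; ring).
    assert (Hs := sqrt_lt_R0 _ Hw).
    replace (((cos t * cos t - sin t * sin t) * (1 / sqrt (1 + u ^ 2)) +
      2 * sin t * cos t * (u / sqrt (1 + u ^ 2))) ^ 2) with
      ((cos t ^ 2 - sin t ^ 2 + 2 * sin t * cos t * u) ^ 2 / (sqrt (1 + u ^ 2)) ^ 2)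
      by (field; lra).
    rewrite pow2_sqrt by lra; rewrite E.
    replace (cos t ^ 2 - sin t ^ 2 + 2 * sin t * cos t * u) with
      ((a * cos t ^ 2 - b * sin t ^ 2) / D); [field; lra|].
    unfold u; apply Rmult_eq_reg_r with D; [|lra].
    replace ((cos t ^ 2 - sin t ^ 2 + 2 * sin t * cos t * ((a - b) * (sin t * cos t) / D)) * D)
      with ((cos t ^ 2 - sin t ^ 2) * D + 2 * (a - b) * (sin t ^ 2 * cos t ^ 2)) by (field; lra).
    unfold Rdiv; rewrite Rmult_assoc, Rinv_l by lra; unfold D; rewrite Hc; ring. }
  assert (F : agm_form ((a + b) / 2) (sqrt (a * b)) (landen a b t) = ((a + b) / 2 * D) ^ 2 / Q).
  { unfold agm_form at 1; rewrite pow2_sqrt by nra.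
    replace (sin (landen a b t) ^ 2) with (1 - cos (landen a b t) ^ 2)
      by (generalize (sin2_cos2 (landen a b t)); unfold Rsqr; nra).
    rewrite Hcos; apply Rmult_eq_reg_r with Q; [|lra].
    replace (((a + b) / 2 * D) ^ 2 / Q * Q) with (((a + b) / 2 * D) ^ 2) by (field; lra).
    replace ((((a + b) / 2) ^ 2 * ((a * cos t ^ 2 - b * sin t ^ 2) ^ 2 / Q) +
      a * b * (1 - (a * cos t ^ 2 - b * sin t ^ 2) ^ 2 / Q)) * Q) with
      ((((a + b) / 2) ^ 2 - a * b) * (a * cos t ^ 2 - b * sin t ^ 2) ^ 2 + a * b * Q)
      by (field; lra).
    unfold D, Q, agm_form; rewrite Hc; field. }
  assert (G : 1 + a * b / Q = (a + b) * D / Q).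
  { apply Rmult_eq_reg_r with Q; [|lra].
    replace ((1 + a * b / Q) * Q) with (Q + a * b) by (field; lra).
    replace ((a + b) * D / Q * Q) with ((a + b) * D) by (field; lra).
    unfold D, Q, agm_form; rewrite Hc; ring. }
  rewrite F, G, sqrt_div_alt, sqrt_pow2 by nra.
  rewrite <- (sqrt_sqrt Q) at 2 by lra.
  assert (0 < sqrt Q) by now apply sqrt_lt_R0.
  field; repeat split; nra.
Qed.

(** As [t] runs over [[0, PI / 2]], Landen's angle runs over [[0, PI]]. The new integrand is
    symmetric about [PI / 2], so this doubled range absorbs the factor [2] of [agm_form_landen]. *)
Lemma agm_int_step (a b : R) : 0 < a -> 0 < b ->
  agm_int ((a + b) / 2) (sqrt (a * b)) = agm_int a b.
Proof.
  intros Ha Hb.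
  assert (HP := PI_RGT_0).
  assert (Ha1 : 0 < (a + b) / 2) by lra.
  assert (Hb1 : 0 < sqrt (a * b)) by (apply sqrt_lt_R0; nra).
  set (f1 := fun t => / sqrt (agm_form ((a + b) / 2) (sqrt (a * b)) t)).
  assert (E : RInt f1 0 PI = 2 * agm_int a b).
  { assert (H := RInt_comp (V := R_CompleteNormedModule) f1 (landen a b)
      (fun t => 1 + a * b / agm_form a b t) 0 (PI / 2)).
    replace (landen a b 0) with 0 in H.
    2:{ unfold landen; rewrite sin_0; unfold Rdiv.
        rewrite Rmult_0_l, !Rmult_0_r, Rmult_0_l, atan_0; ring. }
    replace (landen a b (PI / 2)) with PI in H.
    2:{ unfold landen; rewrite cos_PI2; unfold Rdiv.
        rewrite !Rmult_0_r, Rmult_0_l, atan_0; field. }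
    rewrite <- H.
    - change (RInt (fun y => (1 + a * b / agm_form a b y) * f1 (landen a b y)) 0 (PI / 2) =
        scal 2 (agm_int a b)).
      unfold agm_int; rewrite <- (RInt_scal (V := R_CompleteNormedModule)) by now apply ex_RInt_agm.
      apply RInt_ext; intros t _; rewrite Rmult_comm; now apply agm_form_landen.
    - intros; now apply continuous_agm.
    - intros t _; split; [now apply is_derive_landen|].
      apply (ex_derive_continuous (V := R_NormedModule)).
      assert (H' := agm_form_pos a b t Ha Hb); unfold agm_form in *; auto_derive.
      simpl in *; lra. }
  assert (F : RInt f1 (PI / 2) PI = RInt f1 0 (PI / 2)).
  { assert (H := RInt_comp_lin (V := R_CompleteNormedModule) f1 (-1) PI 0 (PI / 2)).
    replace (-1 * 0 + PI) with PI in H by ring.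
    replace (-1 * (PI / 2) + PI) with (PI / 2) in H by field.
    rewrite <- (opp_RInt_swap (V := R_CompleteNormedModule)) by now apply ex_RInt_agm.
    rewrite <- H by now apply ex_RInt_agm.
    rewrite <- (RInt_opp (V := R_CompleteNormedModule)).
    - apply RInt_ext; intros t _; unfold opp, scal; simpl; unfold mult; simpl.
      replace (f1 (-1 * t + PI)) with (f1 t); [ring|].
      unfold f1, agm_form; replace (-1 * t + PI) with (PI - t) by ring.
      rewrite cos_minus, sin_minus, cos_PI, sin_PI; do 2 f_equal; ring.
    - apply (ex_RInt_comp_lin (V := R_NormedModule) f1 (-1) PI); now apply ex_RInt_agm. }
  assert (C := RInt_Chasles (V := R_CompleteNormedModule) f1 0 (PI / 2) PI
    (ex_RInt_agm _ _ _ _ Ha1 Hb1) (ex_RInt_agm _ _ _ _ Ha1 Hb1)).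
  change (RInt f1 0 (PI / 2) + RInt f1 (PI / 2) PI = RInt f1 0 PI) in C.
  unfold agm_int at 1; fold f1; lra.
Qed.

Lemma eq_of_relative_error (T P : R) :
  (forall d, 0 < d < 1 -> T * (1 - d) <= P <= T * (1 + d)) -> T = P.
Proof.
  intros H; apply Rminus_diag_uniq, Rabs_eq_0, Rle_antisym; [|apply Rabs_pos].
  apply le_epsilon; intros eps He; rewrite Rplus_0_l.
  set (d := Rmin (/ 2) (eps / (Rabs T + 1))).
  assert (HT := Rabs_pos T).
  assert (Hd : 0 < d) by (apply Rmin_pos; [lra|apply Rdiv_lt_0_compat; lra]).
  assert (Hd1 : d <= / 2) by apply Rmin_l.
  assert (Hd' : d * (Rabs T + 1) <= eps).
  { apply Rle_trans with (eps / (Rabs T + 1) * (Rabs T + 1)).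
    - apply Rmult_le_compat_r; [lra|apply Rmin_r].
    - right; field; lra. }
  specialize (H d ltac:(lra)); assert (H1 := Rle_abs T); assert (H2 := Rle_abs (- T)).
  rewrite Rabs_Ropp in H2; apply Rabs_le; split; nra.
Qed.

Lemma agm_int_theta3_sq_theta4_sq (x : R) : 0 < x -> agm_int (theta3_sq x) (theta4_sq x) = PI / 2.
Proof.
  intros Hx; assert (HP := PI_RGT_0).
  assert (Hn : forall n : nat, agm_int (theta3_sq x) (theta4_sq x) =
    agm_int (theta3_sq (2 ^ n * x)) (theta4_sq (2 ^ n * x))).
  { intros n; induction n as [|n IH]; [simpl; now rewrite Rmult_1_l|].
    rewrite IH; set (y := 2 ^ n * x).
    assert (Hy : 0 < y) by (apply Rmult_lt_0_compat; [apply two_pow_pos|lra]).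
    replace (2 ^ S n * x) with (2 * y) by (unfold y; simpl; ring).
    assert (H1 := theta3_sq_gt_1 y Hy); assert (H2 := theta4_sq_pos y Hy).
    rewrite <- agm_int_step by lra.
    f_equal.
    - rewrite (theta3_sq_double y) by auto; unfold theta4_sq; field.
    - rewrite <- theta4_sq_double by auto; apply sqrt_square.
      apply Rlt_le, theta4_sq_pos; lra. }
  apply eq_of_relative_error; intros d Hd.
  (* This [n] gives [PI / y <= d], and the bounds below then place [theta3_sq y] and [theta4_sq y]
     in [[1 - d, 1 + d]]. *)
  destruct (pow2_unbounded x Hx (PI / d)) as [n Hy]; rewrite (Hn n).
  set (y := 2 ^ n * x) in *.
  assert (Hy0 : 0 < y) by (apply Rmult_lt_0_compat; [apply two_pow_pos|lra]).
  assert (Hyd : PI / y <= d).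
  { apply Rle_div_l; [lra|]; apply (proj1 (Rle_div_l _ _ _ (proj1 Hd))) in Hy; lra. }
  assert (H1 := theta3_sq_gt_1 y Hy0); assert (H2 := theta3_sq_le y Hy0).
  assert (H3 := theta3_sq_gt_1 (2 * y) ltac:(lra)); assert (H4 := theta3_sq_le (2 * y) ltac:(lra)).
  assert (H5 := theta2_sq_pos (2 * y) ltac:(lra)); assert (H6 := theta2_sq_le (2 * y) ltac:(lra)).
  replace (PI / (2 * y)) with (PI / y / 2) in H4 by (field; lra).
  replace (2 * PI / (2 * y)) with (PI / y) in H6 by (field; lra).
  destruct (agm_int_bounds (1 - d) (1 + d) (theta3_sq y) (theta4_sq y)) as [B1 B2];
    unfold theta4_sq; try lra.
  fold (theta4_sq y); split.
  - apply Rle_div_r; lra.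
  - apply (proj1 (Rle_div_l _ _ (1 + d) ltac:(lra))) in B1; lra.
Qed.

Lemma agm_int_theta3_sq_theta2_sq (x : R) : 0 < x -> agm_int (theta3_sq x) (theta2_sq x) = x / 2.
Proof.
  intros Hx; assert (HP := PI_RGT_0).
  assert (Hn : forall n : nat, agm_int (theta3_sq x) (theta2_sq x) =
    2 ^ n * agm_int (theta3_sq (x / 2 ^ n)) (theta2_sq (x / 2 ^ n))).
  { intros n; induction n as [|n IH]; [simpl; now rewrite Rmult_1_l, Rdiv_1_r|].
    rewrite IH; clear IH; assert (Hp := two_pow_pos n); set (y := x / 2 ^ n / 2).
    assert (Hy : 0 < y) by (unfold y; repeat apply Rdiv_lt_0_compat; lra).
    replace (x / 2 ^ n) with (2 * y) by (unfold y; field; lra).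
    replace (x / 2 ^ S n) with y by (unfold y; simpl; field; lra).
    assert (H1 := theta3_sq_gt_1 (2 * y) ltac:(lra));
      assert (H2 := theta2_sq_pos (2 * y) ltac:(lra)).
    assert (H3 := theta3_sq_gt_1 y Hy); assert (H4 := theta2_sq_pos y Hy).
    rewrite <- agm_int_step by lra.
    rewrite <- theta3_sq_double by auto.
    (* The step taken from the pair at [2 y] yields half of the pair at [y]. Scaling by [1/2]
       doubles the integral, which accounts for [2 ^ n]. *)
    replace (sqrt (theta3_sq (2 * y) * theta2_sq (2 * y))) with (/ 2 * theta2_sq y).
    - replace (theta3_sq y / 2) with (/ 2 * theta3_sq y) by field.
      rewrite agm_int_scal by lra; simpl; field.
    - symmetry; replace (theta3_sq (2 * y) * theta2_sq (2 * y))
      with ((/ 2 * theta2_sq y) * (/ 2 * theta2_sq y)).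
      + apply sqrt_square; lra.
      + replace (theta3_sq (2 * y) * theta2_sq (2 * y)) with (/ 4 * (theta2_sq y * theta2_sq y));
        [field|].
        rewrite theta2_sq_double by auto; field. }
  apply eq_of_relative_error; intros d Hd.
  (* [n] is chosen so that [2 y <= PI * d]: both theta values then deviate from [PI / y] by a
     relative error of at most [d]. *)
  destruct (pow2_unbounded (PI / 2 * d / x)) with (M := 1) as [n Hy].
  { apply Rdiv_lt_0_compat; nra. }
  rewrite (Hn n); assert (Hp := two_pow_pos n).
  set (y := x / 2 ^ n) in *.
  assert (Hy0 : 0 < y) by (unfold y; apply Rdiv_lt_0_compat; lra).
  assert (Ex : x = 2 ^ n * y) by (unfold y; field; lra).
  assert (Hyd : 2 * y <= PI * d).
  { unfold y; apply Rmult_le_reg_r with (2 ^ n / (2 * x)).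
    - apply Rdiv_lt_0_compat; lra.
    - replace (2 * (x / 2 ^ n) * (2 ^ n / (2 * x))) with 1 by (field; lra).
      replace (PI * d * (2 ^ n / (2 * x))) with (2 ^ n * (PI / 2 * d / x)) by (field; lra); lra. }
  assert (H1 := theta3_sq_bounds y Hy0); assert (H2 := theta2_sq_bounds y Hy0).
  set (m := PI / y * (1 - d)); set (M := PI / y * (1 + d)).
  assert (Hpy : 0 < PI / y) by (apply Rdiv_lt_0_compat; lra).
  assert (Bd : forall s, PI - 2 * y <= y * s <= PI + 2 * y -> m <= s <= M).
  { intros s Hs; unfold m, M; split; apply Rmult_le_reg_l with y; auto.
    - replace (y * (PI / y * (1 - d))) with (PI * (1 - d)) by (field; lra); lra.
    - replace (y * (PI / y * (1 + d))) with (PI * (1 + d)) by (field; lra); lra. }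
  assert (Hm : 0 < m) by (unfold m; nra).
  destruct (agm_int_bounds m M (theta3_sq y) (theta2_sq y)) as [B1 B2]; auto.
  { apply Bd; lra. }
  assert (HM : 0 < M) by (unfold M; nra).
  apply (proj1 (Rle_div_l _ _ _ HM)) in B1; apply (proj2 (Rle_div_r _ _ _ Hm)) in B2.
  set (T := agm_int (theta3_sq y) (theta2_sq y)) in *.
  rewrite Ex; unfold m, M in *.
  assert (C1 : T * (1 - d) <= y / 2).
  { apply Rmult_le_reg_r with (PI / y); auto.
    replace (y / 2 * (PI / y)) with (PI / 2) by (field; lra); lra. }
  assert (C2 : y / 2 <= T * (1 + d)).
  { apply Rmult_le_reg_r with (PI / y); auto.
    replace (y / 2 * (PI / y)) with (PI / 2) by (field; lra); lra. }
  split; nra.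
Qed.

(** * The modulus with a given ratio of periods *)

Lemma ellK_agm (k k' : R) : 0 < k < 1 -> 0 < k' -> k ^ 2 + k' ^ 2 = 1 -> ellK k = agm_int 1 k'.
Proof.
  intros Hk Hk' E; apply RInt_ext; intros t _; do 2 f_equal; unfold agm_form.
  replace (k' ^ 2) with (1 - k ^ 2) by lra.
  replace (cos t ^ 2) with (1 - sin t ^ 2); [ring|].
  generalize (sin2_cos2 t); unfold Rsqr; nra.
Qed.

Lemma ellK_incr (k l : R) : 0 < k -> k < l -> l < 1 -> ellK k < ellK l.
Proof.
  intros Hk Hkl Hl; assert (HP := PI_RGT_0).
  assert (Hsin : forall t, 0 <= sin t ^ 2 <= 1).
  { intros t; generalize (sin2_cos2 t); unfold Rsqr; nra. }
  assert (Hpos : forall m t, 0 < m < 1 -> 0 < 1 - m ^ 2 * sin t ^ 2).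
  { intros m t Hm; specialize (Hsin t); assert (m ^ 2 < 1) by nra; nra. }
  assert (Hcont : forall m t, 0 < m < 1 ->
    continuous (fun t => / sqrt (1 - m ^ 2 * sin t ^ 2)) t).
  { intros m t Hm; apply (ex_derive_continuous (V := R_NormedModule)).
    specialize (Hpos m t Hm); auto_derive; simpl in *; repeat split; try lra.
    apply Rgt_not_eq, sqrt_lt_R0; lra. }
  apply RInt_lt; try lra.
  - intros t _; apply Hcont; lra.
  - intros t _; apply Hcont; lra.
  - intros t Ht.
    assert (H1 := Hpos l t ltac:(lra)); assert (H2 := Hpos k t ltac:(lra)).
    assert (0 < sin t) by (apply sin_gt_0; lra).
    apply Rinv_lt_contravar.
    + apply Rmult_lt_0_compat; now apply sqrt_lt_R0.
    + apply sqrt_lt_1; try lra.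
      assert (k ^ 2 < l ^ 2) by nra; assert (0 < sin t ^ 2) by nra; nra.
Qed.

Lemma comp_modulus_bounds (k : R) : 0 < k < 1 -> 0 < comp_modulus k < 1.
Proof.
  intros Hk; unfold comp_modulus; split; [apply sqrt_lt_R0; nra|].
  rewrite <- sqrt_1 at 2; apply sqrt_lt_1; nra.
Qed.

Lemma comp_modulus_decr (k l : R) : 0 < k -> k < l -> l < 1 -> comp_modulus l < comp_modulus k.
Proof. intros; unfold comp_modulus; apply sqrt_lt_1; nra. Qed.

Lemma ellK_gt_0 (k : R) : 0 < k < 1 -> 0 < ellK k.
Proof.
  intros Hk; assert (HP := PI_RGT_0).
  destruct (comp_modulus_bounds k Hk) as [H1 H2].
  rewrite (ellK_agm k (comp_modulus k)); auto.
  - destruct (agm_int_bounds (comp_modulus k) 1 1 (comp_modulus k)) as [H _]; lra.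
  - unfold comp_modulus; rewrite pow2_sqrt; nra.
Qed.

(** As [k] grows, [K] increases and [K'] decreases, so their ratio is strictly monotone. *)
Lemma modulus_unique (k l : R) : 0 < k < 1 -> 0 < l < 1 ->
  ellK (comp_modulus k) / ellK k = ellK (comp_modulus l) / ellK l -> k = l.
Proof.
  assert (H : forall k l, 0 < k < 1 -> 0 < l < 1 -> k < l ->
    ellK (comp_modulus k) / ellK k <> ellK (comp_modulus l) / ellK l).
  { intros a b Ha Hb Hab E.
    assert (Ha' := comp_modulus_bounds a Ha); assert (Hb' := comp_modulus_bounds b Hb).
    assert (H1 := ellK_incr a b ltac:(lra) Hab ltac:(lra)).
    assert (H2 := ellK_incr _ _ (proj1 Hb') (comp_modulus_decr a b ltac:(lra) Hab ltac:(lra))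
      (proj2 Ha')).
    assert (Ka := ellK_gt_0 a Ha); assert (Kb := ellK_gt_0 b Hb).
    assert (Kb' := ellK_gt_0 _ Hb').
    apply (f_equal (fun r => r * (ellK a * ellK b))) in E.
    replace (ellK (comp_modulus a) / ellK a * (ellK a * ellK b)) with
      (ellK (comp_modulus a) * ellK b) in E by (field; lra).
    replace (ellK (comp_modulus b) / ellK b * (ellK a * ellK b)) with
      (ellK (comp_modulus b) * ellK a) in E by (field; lra).
    nra. }
  intros Hk Hl E; destruct (Rtotal_order k l) as [C|[C|C]]; auto.
  - exfalso; now apply (H k l).
  - exfalso; now apply (H l k).
Qed.

Theorem ellK_theta (alpha k : R) : 0 < alpha -> 0 < k < 1 ->
  ellK (comp_modulus k) / ellK k = alpha -> ellK k = PI / 2 * theta3_sq (PI * alpha).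
Proof.
  intros Ha Hk E; assert (HP := PI_RGT_0); set (x := PI * alpha).
  assert (Hx : 0 < x) by (unfold x; nra).
  assert (HA := theta3_sq_gt_1 x Hx); assert (HB := theta4_sq_pos x Hx);
    assert (HC := theta2_sq_pos x Hx).
  assert (HS := theta4_sq_square x Hx).
  (* [theta4_sq_square] is Jacobi's identity between the fourth powers of the theta functions; it
     makes [l] and [l'] complementary. *)
  set (l := theta2_sq x / theta3_sq x); set (l' := theta4_sq x / theta3_sq x).
  assert (Hl0 : 0 < l) by (apply Rdiv_lt_0_compat; lra).
  assert (Hl0' : 0 < l') by (apply Rdiv_lt_0_compat; lra).
  assert (Hsq : l ^ 2 + l' ^ 2 = 1).
  { unfold l, l'.
    replace ((theta2_sq x / theta3_sq x) ^ 2 + (theta4_sq x / theta3_sq x) ^ 2)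
      with ((theta2_sq x * theta2_sq x + theta4_sq x * theta4_sq x) / (theta3_sq x * theta3_sq x))
      by (field; lra).
    rewrite HS; field; lra. }
  assert (Hl : 0 < l < 1) by nra.
  assert (Hl' : 0 < l' < 1) by nra.
  assert (Ec : comp_modulus l = l').
  { unfold comp_modulus; replace (1 - l ^ 2) with (l' ^ 2) by lra; apply sqrt_pow2; lra. }
  assert (K1 : ellK l = PI / 2 * theta3_sq x).
  { rewrite (ellK_agm l l'), <- (agm_int_theta3_sq_theta4_sq x) by auto.
    replace (theta3_sq x) with (theta3_sq x * 1) at 1 by ring;
      replace (theta4_sq x) with (theta3_sq x * l') by (unfold l'; field; lra).
    rewrite agm_int_scal by lra; field; lra. }
  assert (K2 : ellK l' = x / 2 * theta3_sq x).
  { rewrite (ellK_agm l' l), <- (agm_int_theta3_sq_theta2_sq x) by (auto; lra).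
    replace (theta3_sq x) with (theta3_sq x * 1) at 1 by ring;
      replace (theta2_sq x) with (theta3_sq x * l) by (unfold l; field; lra).
    rewrite agm_int_scal by lra; field; lra. }
  rewrite <- K1; f_equal; apply modulus_unique; auto.
  rewrite E, Ec, K1, K2; unfold x; field; split; [fold x|]; lra.
Qed.

(** * Integrals with a bounded discontinuity at an end point *)

(** The bound is asked for inside only, because the value of the integrand at an end point may be
    uncontrolled. *)
Lemma abs_RInt_le_open (f : R -> R) (a b M : R) : a <= b -> ex_RInt f a b ->
  (forall t, a < t < b -> Rabs (f t) <= M) -> Rabs (RInt f a b) <= M * (b - a).
Proof.
  intros Hab Hf HM.
  assert (C : forall m, RInt (fun _ => m) a b = m * (b - a)).
  { intros m; rewrite RInt_const; unfold scal; simpl; unfold mult; simpl; ring. }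
  apply Rabs_le; split.
  - replace (- (M * (b - a))) with (- M * (b - a)) by ring; rewrite <- C.
    apply RInt_le; auto; [apply ex_RInt_const|].
    intros t Ht; generalize (HM t Ht) (Rle_abs (- f t)); rewrite Rabs_Ropp; lra.
  - rewrite <- C; apply RInt_le; auto; [apply ex_RInt_const|].
    intros t Ht; generalize (HM t Ht) (Rle_abs (f t)); lra.
Qed.

(* Truncating [f] at [c] close to [b] changes every Riemann sum by at most a
   Riemann sum of a step function of small integral, so Cauchy's criterion applies. *)
Lemma ex_RInt_bounded_closed (f : R -> R) (a b M : R) : a < b ->
  (forall x, a <= x < b -> continuous f x) ->
  (forall x, a <= x <= b -> Rabs (f x) <= M) -> ex_RInt f a b.
Proof.
  intros Hab Hf HM.
  assert (HM0 : 0 <= M) by (generalize (HM a ltac:(lra)) (Rabs_pos (f a)); lra).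
  apply (proj1 (filterlim_locally_cauchy (U := R_CompleteNormedModule)
    (F := Riemann_fine a b) (fun ptd => scal (sign (b - a)) (Riemann_sum f ptd)))).
  intros eps.
  set (e := eps / 8).
  assert (He : 0 < e) by (unfold e; generalize (cond_pos eps); lra).
  set (c := Rmax a (b - e / (M + 1))).
  assert (Hc : a <= c < b).
  { unfold c; split; [apply Rmax_l|].
    apply Rmax_lub_lt; auto.
    assert (0 < e / (M + 1)) by (apply Rdiv_lt_0_compat; lra); lra. }
  assert (Hsmall : M * (b - c) <= e).
  { assert (b - c <= e / (M + 1)) by (generalize (Rmax_r a (b - e / (M + 1))); fold c; lra).
    apply Rle_trans with (M * (e / (M + 1))); [now apply Rmult_le_compat_l|].
    apply Rmult_le_reg_r with (M + 1); [lra|].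
    replace (M * (e / (M + 1)) * (M + 1)) with (M * e) by (field; lra); nra. }
  set (g := fun x => if Rle_dec x c then f x else 0).
  set (h := fun x => if Rle_dec x c then 0 else M).
  assert (Hg : ex_RInt g a b).
  { apply ex_RInt_Chasles with c.
    - apply ex_RInt_ext with f.
      + intros x; rewrite Rmin_left, Rmax_right by lra; unfold g; intros.
        destruct (Rle_dec x c); [auto|lra].
      + apply (ex_RInt_continuous (V := R_CompleteNormedModule)); intros x.
        rewrite Rmin_left, Rmax_right by lra; intros; apply Hf; lra.
    - apply ex_RInt_ext with (fun _ => 0); [|apply ex_RInt_const].
      intros x; rewrite Rmin_left, Rmax_right by lra; unfold g; intros.
      destruct (Rle_dec x c); [lra|auto]. }
  assert (Hh : is_RInt h a b (M * (b - c))).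
  { replace (M * (b - c)) with ((c - a) * 0 + (b - c) * M) by ring.
    apply (is_RInt_Chasles (V := R_NormedModule) h a c b ((c - a) * 0) ((b - c) * M)).
    - apply (is_RInt_ext (V := R_NormedModule) (fun _ => 0));
      [|apply (is_RInt_const (V := R_NormedModule))].
      intros x; rewrite Rmin_left, Rmax_right by lra; unfold h; intros.
      destruct (Rle_dec x c); [auto|lra].
    - apply (is_RInt_ext (V := R_NormedModule) (fun _ => M));
      [|apply (is_RInt_const (V := R_NormedModule))].
      intros x; rewrite Rmin_left, Rmax_right by lra; unfold h; intros.
      destruct (Rle_dec x c); [lra|auto]. }
  destruct Hg as [lg Hg].
  unfold is_RInt in Hg, Hh.
  apply (fun H => proj1 (filterlim_locally (U := R_NormedModule) (F := Riemann_fine a b) _ _) H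
    (mkposreal e He)) in Hg.
  apply (fun H => proj1 (filterlim_locally (U := R_NormedModule) (F := Riemann_fine a b) _ _) H
    (mkposreal e He)) in Hh.
  assert (Hs : sign (b - a) = 1) by (apply sign_eq_1; lra).
  rewrite Hs in *.
  set (D := fun ptd : SF_seq => pointed_subdiv ptd /\
    SF_h ptd = Rmin a b /\ seq.last (SF_h ptd) (SF_lx ptd) = Rmax a b).
  assert (HD : Riemann_fine a b D) by (exists (mkposreal 1 Rlt_0_1); auto).
  set (P := fun ptd => (ball lg (mkposreal e He) (scal 1 (Riemann_sum g ptd)) /\
    ball (M * (b - c)) (mkposreal e He) (scal 1 (Riemann_sum h ptd))) /\ D ptd).
  exists P; split.
  { apply filter_and; [apply filter_and|]; [exact Hg|exact Hh|exact HD]. }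
  assert (B : forall p, P p -> Rabs (Riemann_sum f p - lg) < 3 * e).
  { intros p [[H1 H2] [H3 [H4 H5]]].
    rewrite Rmin_left in H4 by lra; rewrite Rmax_right in H5 by lra.
    change (Rabs (1 * Riemann_sum g p - lg) < e) in H1.
    change (Rabs (1 * Riemann_sum h p - M * (b - c)) < e) in H2.
    assert (H6 : Rabs (Riemann_sum f p - Riemann_sum g p) <= Riemann_sum h p).
    { assert (E := Riemann_sum_minus f g p).
      change (Riemann_sum (fun x => f x - g x) p = Riemann_sum f p - Riemann_sum g p) in E.
      rewrite <- E; apply (Riemann_sum_norm (V := R_NormedModule) (fun x => f x - g x) h p H3).
      rewrite H5, H4; intros t Ht; change (Rabs (f t - g t) <= h t); unfold g, h.
      destruct (Rle_dec t c); [rewrite Rminus_diag; rewrite Rabs_R0; lra|].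
      rewrite Rminus_0_r; now apply HM. }
    rewrite Rmult_1_l in H1, H2.
    apply Rabs_def2 in H1; apply Rabs_def2 in H2.
    apply Rabs_le_between in H6; apply Rabs_def1; lra. }
  intros u v Hu Hv.
  change (Rabs (1 * Riemann_sum f v - 1 * Riemann_sum f u) < eps).
  assert (H1 := B u Hu); assert (H2 := B v Hv).
  apply Rabs_def2 in H1; apply Rabs_def2 in H2.
  unfold e in *; apply Rabs_def1; lra.
Qed.

Lemma continuous_bounded (f : R -> R) (a b : R) : a <= b ->
  (forall x, a <= x <= b -> continuous f x) ->
  exists M, 0 <= M /\ forall x, a <= x <= b -> Rabs (f x) <= M.
Proof.
  intros Hab Hf.
  destruct (continuity_ab_maj (fun x => Rabs (f x)) a b Hab) as [m [Hm _]].
  - intros c Hc; apply continuity_pt_filterlim, (continuous_comp f Rabs).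
    + now apply Hf.
    + apply continuous_Rabs.
  - exists (Rabs (f m)); split; [apply Rabs_pos|auto].
Qed.

(** Continuity bounds [f] on [[a, c]] and [M] bounds it beyond; the value at [b] is replaced by [0],
    which leaves the integral unchanged. *)
Lemma ex_RInt_bounded (f : R -> R) (a b c M : R) : a <= c < b ->
  (forall x, a <= x < b -> continuous f x) ->
  (forall x, c <= x < b -> Rabs (f x) <= M) -> ex_RInt f a b.
Proof.
  intros Hc Hf HM.
  destruct (continuous_bounded f a c) as [M' [HM'0 HM']]; [lra|intros; apply Hf; lra|].
  apply ex_RInt_ext with (fun x => if Rlt_dec x b then f x else 0).
  { intros x; rewrite Rmin_left, Rmax_right by lra; intros.
    destruct (Rlt_dec x b); [auto|lra]. }
  apply ex_RInt_bounded_closed with (Rmax M M'); [lra| |].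
  - intros x Hx; apply (continuous_ext_loc _ f); [|now apply Hf].
    exists (mkposreal (b - x) ltac:(lra)); intros y Hy.
    change (Rabs (y - x) < b - x) in Hy; apply Rabs_def2 in Hy.
    destruct (Rlt_dec y b); [auto|lra].
  - intros x Hx; destruct (Rlt_dec x b) as [Hxb|Hxb].
    + destruct (Rle_dec x c).
      * apply Rle_trans with M'; [apply HM'; lra|apply Rmax_r].
      * apply Rle_trans with M; [apply HM; lra|apply Rmax_l].
    + rewrite Rabs_R0; apply Rle_trans with M'; [auto|apply Rmax_r].
Qed.

Lemma continuity_2d_pt_snd (f : R -> R -> R) (t x : R) :
  continuity_2d_pt f t x -> continuous (f t) x.
Proof.
  intros H; apply filterlim_locally; intros eps.
  destruct (H eps) as [d Hd]; exists d; intros y Hy.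
  apply (Hd t y); auto; rewrite Rminus_diag, Rabs_R0; apply cond_pos.
Qed.

(** Dominated convergence by hand: on [[c', b)] the integrands differ by at most [2 * M] over a
    negligible length, and on the compact rectangle up to [c'] uniform continuity applies. The
    half-open range is dictated by the singularity of [log (1 + e^(i th))] at [th = PI]. *)
Lemma RInt_param_lim (f : R -> R -> R) (tl tr t0 a b c M : R) : a <= c < b -> tl <= t0 <= tr ->
  (forall t x, tl <= t <= tr -> a <= x < b -> continuity_2d_pt f t x) ->
  (forall t x, tl <= t <= tr -> c <= x < b -> Rabs (f t x) <= M) ->
  forall eps, 0 < eps -> exists d, 0 < d /\ forall t, tl <= t <= tr -> Rabs (t - t0) < d ->
    Rabs (RInt (f t) a b - RInt (f t0) a b) < eps.
Proof.
  intros Hc Ht0 Hf HM eps He.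
  assert (HM0 : 0 <= M) by (generalize (HM t0 c ltac:(lra) ltac:(lra)) (Rabs_pos (f t0 c)); lra).
  assert (Hcont : forall t x, tl <= t <= tr -> a <= x < b -> continuous (f t) x).
  { intros; apply continuity_2d_pt_snd, Hf; auto. }
  set (c' := Rmax c (b - eps / (8 * (M + 1)))).
  assert (Hc' : c <= c' < b).
  { unfold c'; split; [apply Rmax_l|].
    apply Rmax_lub_lt; [lra|].
    assert (0 < eps / (8 * (M + 1))) by (apply Rdiv_lt_0_compat; lra); lra. }
  assert (Hsmall : 2 * M * (b - c') <= eps / 4).
  { assert (b - c' <= eps / (8 * (M + 1)))
      by (generalize (Rmax_r c (b - eps / (8 * (M + 1)))); fold c'; lra).
    apply Rle_trans with (2 * M * (eps / (8 * (M + 1)))); [apply Rmult_le_compat_l; lra|].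
    apply Rmult_le_reg_r with (8 * (M + 1)); [lra|].
    replace (2 * M * (eps / (8 * (M + 1))) * (8 * (M + 1))) with (2 * M * eps) by (field; lra);
      nra. }
  set (e := eps / (4 * (c' - a + 1))).
  assert (He' : 0 < e) by (apply Rdiv_lt_0_compat; lra).
  assert (Hee : e * (c' - a) <= eps / 4).
  { apply Rmult_le_reg_r with (4 * (c' - a + 1)); [lra|].
    unfold e; replace (eps / (4 * (c' - a + 1)) * (c' - a) * (4 * (c' - a + 1)))
      with (eps * (c' - a)) by (field; lra); nra. }
  destruct (uniform_continuity_2d f tl tr a c') with (eps := mkposreal e He') as [d Hd].
  { intros t x Ht Hx; apply Hf; lra. }
  exists d; split; [apply cond_pos|]; intros t Ht Htd.
  set (k := fun x => f t x - f t0 x).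
  assert (Hex : forall t, tl <= t <= tr -> ex_RInt (f t) a b).
  { intros s Hs; apply ex_RInt_bounded with c M; auto. }
  assert (E : RInt (f t) a b - RInt (f t0) a b = RInt k a b).
  { symmetry; apply (RInt_minus (V := R_CompleteNormedModule)); auto. }
  assert (Hk : forall x, a <= x < b -> continuous k x).
  { intros x Hx; apply (continuous_minus (V := R_NormedModule)); auto. }
  assert (Hk2 : forall x, c' <= x < b -> Rabs (k x) <= 2 * M).
  { intros x Hx; unfold k.
    generalize (HM t x Ht ltac:(lra)) (HM t0 x Ht0 ltac:(lra)); intros B1 B2.
    apply Rabs_le_between in B1; apply Rabs_le_between in B2; apply Rabs_le; lra. }
  assert (H1 : ex_RInt k a c').
  { apply (ex_RInt_continuous (V := R_CompleteNormedModule)); intros x.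
    rewrite Rmin_left, Rmax_right by lra; intros; apply Hk; lra. }
  assert (H2 : ex_RInt k c' b).
  { apply ex_RInt_bounded with c' (2 * M); [lra| |auto]; intros; apply Hk; lra. }
  assert (C := RInt_Chasles (V := R_CompleteNormedModule) k a c' b H1 H2).
  change (RInt k a c' + RInt k c' b = RInt k a b) in C.
  assert (B1 : Rabs (RInt k a c') <= e * (c' - a)).
  { apply abs_RInt_le_open; [lra|auto|].
    intros x Hx; apply Rlt_le, (Hd t0 x t x); try lra.
    rewrite Rminus_diag, Rabs_R0; apply cond_pos. }
  assert (B2 : Rabs (RInt k c' b) <= 2 * M * (b - c')).
  { apply abs_RInt_le_open; [lra|auto|]; intros; apply Hk2; lra. }
  rewrite E, <- C.
  apply Rabs_le_between in B1; apply Rabs_le_between in B2; apply Rabs_def1; lra.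
Qed.

(** * The Poisson kernel and the residues *)

(* The Bose factor: [dr / r = bose v dv] for [r = 1 - exp (- v)]. *)
Definition bose (v : R) : R := / (exp v - 1).

Lemma expm1_pos (v : R) : 0 < v -> 0 < exp v - 1.
Proof. intros H; generalize (exp_increasing 0 v H); rewrite exp_0; lra. Qed.

Lemma bose_pos (v : R) : 0 < v -> 0 < bose v.
Proof. intros H; now apply Rinv_0_lt_compat, expm1_pos. Qed.

Lemma is_series_bose (y : R) : 0 < y -> is_series (fun m => exp (- (y * (INR m + 1)))) (bose y).
Proof.
  intros Hy.
  assert (Hq : 0 < exp (- y) < 1).
  { split; [apply exp_pos|]; rewrite <- exp_0; apply exp_increasing; lra. }
  replace (bose y) with (exp (- y) * / (1 - exp (- y))).
  - apply is_series_ext with (fun m => exp (- y) * exp (- y) ^ m).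
    + intros m; replace (- (y * (INR m + 1))) with (- y + - y * INR m) by ring.
      rewrite exp_plus; f_equal.
      induction m as [|m IH]; [simpl; now rewrite Rmult_0_r, exp_0|].
      rewrite S_INR; simpl; rewrite IH, <- exp_plus; f_equal; ring.
    + apply (is_series_scal_l (exp (- y)) (fun m => exp (- y) ^ m)).
      apply is_series_geom; rewrite Rabs_pos_eq; lra.
  - unfold bose; assert (H := expm1_pos y Hy).
    replace (exp y) with (/ exp (- y)) in * by (rewrite exp_Ropp, Rinv_inv; auto).
    field; lra.
Qed.

(** Each Bose factor is a geometric series in [m]. For fixed [m] the sum over [j <= N] is again
    geometric, with ratio [- exp (- 2 x (m + 1))], and the complete sum over [j] would be half a
    [sech]. *)
Lemma bose_partial_sum (x : R) (N : nat) : 0 < x ->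
  is_series (fun m => / 2 * sech (x * (INR m + 1)) * (1 - (- exp (- (2 * x * (INR m + 1)))) ^ (S
    N)))
    (sum_n (fun j => (-1) ^ j * bose ((2 * INR j + 1) * x)) N).
Proof.
  intros Hx.
  assert (Hone : forall N : nat, is_series
    (fun m => / 2 * sech (x * (INR m + 1)) * (- exp (- (2 * x * (INR m + 1)))) ^ N *
      (1 + exp (- (2 * x * (INR m + 1))))) ((-1) ^ N * bose ((2 * INR N + 1) * x))).
  { intros M.
    apply is_series_ext with (fun m => (-1) ^ M * exp (- ((2 * INR M + 1) * x * (INR m + 1)))).
    - intros m; set (y := x * (INR m + 1)).
      replace (2 * x * (INR m + 1)) with (2 * y) by (unfold y; ring).
      replace (- ((2 * INR M + 1) * x * (INR m + 1))) with (- y + - (2 * y) * INR M)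
        by (unfold y; ring).
      rewrite exp_plus.
      replace (exp (- (2 * y) * INR M)) with (exp (- (2 * y)) ^ M).
      2:{ induction M as [|M IH]; [simpl; now rewrite Rmult_0_r, exp_0|].
          rewrite S_INR; simpl; rewrite IH, <- exp_plus; f_equal; ring. }
      replace (- exp (- (2 * y))) with (-1 * exp (- (2 * y))) by ring.
      rewrite Rpow_mult_distr.
      replace (exp (- y)) with (/ 2 * sech y * (1 + exp (- (2 * y)))).
      { real_eq; ring. }
      unfold sech, cosh.
      replace (exp (- (2 * y))) with (exp (- y) * exp (- y)) by (rewrite <- exp_plus; f_equal;
        ring).
      assert (H := exp_pos (- y)).
      replace (exp y) with (/ exp (- y)) by (rewrite exp_Ropp, Rinv_inv; auto).
      field; nra.
    - apply (is_series_scal_l ((-1) ^ M) (fun m => exp (- ((2 * INR M + 1) * x * (INR m + 1))))).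
      apply is_series_bose; apply Rmult_lt_0_compat; auto; generalize (pos_INR M); lra. }
  induction N as [|N IH].
  - rewrite sum_O; apply is_series_ext with (2 := Hone O); intros m; simpl.
    real_eq; ring.
  - rewrite sum_Sn.
    assert (H := is_series_plus (V := R_NormedModule) _ _ _ _ IH (Hone (S N))).
    apply is_series_ext with (2 := H); intros m; unfold plus; simpl.
    real_eq; ring.
Qed.

(** The remainder in [bose_partial_sum] carries a factor of size at most [exp (- 2 x N)], uniformly
    in [m], so half the series of [sech] is left. This is a Lambert series for [theta3_sq]. *)
Lemma is_series_bose_alt (x : R) : 0 < x ->
  is_series (fun j => (-1) ^ j * bose ((2 * INR j + 1) * x)) ((theta3_sq x - 1) / 4).
Proof.
  intros Hx.
  set (w := fun m => sech (x * (INR m + 1))).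
  assert (Hw : ex_series w) by now apply ex_series_sech.
  set (s := Series w).
  assert (Hs : is_series w s) by now apply Series_correct.
  replace ((theta3_sq x - 1) / 4) with (/ 2 * s) by (unfold theta3_sq; fold w s; field).
  change (is_lim_seq (sum_n (fun j => (-1) ^ j * bose ((2 * INR j + 1) * x))) (/ 2 * s)).
  assert (B : forall N, Rabs (sum_n (fun j => (-1) ^ j * bose ((2 * INR j + 1) * x)) N - / 2 * s)
    <= / 2 * s * exp (- (2 * x * INR N + 0))).
  { intros N; assert (H := bose_partial_sum x N Hx).
    apply (is_series_minus (V := R_NormedModule) _ (fun m => / 2 * w m) _ (/ 2 * s)) in H.
    2:{ apply (is_series_scal_l (/ 2) w); auto. }
    set (S0 := sum_n (fun j => (-1) ^ j * bose ((2 * INR j + 1) * x)) N) in *.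
    change (is_series (fun m => / 2 * sech (x * (INR m + 1)) *
      (1 - (- exp (- (2 * x * (INR m + 1)))) ^ (S N)) - / 2 * w m) (S0 - / 2 * s)) in H.
    assert (Hp : 0 <= exp (- (2 * x * INR N + 0))) by apply Rlt_le, exp_pos.
    assert (Bm : forall m, Rabs (/ 2 * sech (x * (INR m + 1)) *
      (1 - (- exp (- (2 * x * (INR m + 1)))) ^ (S N)) - / 2 * w m) <=
      / 2 * exp (- (2 * x * INR N + 0)) * w m).
    { intros m; fold (w m).
      replace (/ 2 * w m * (1 - (- exp (- (2 * x * (INR m + 1)))) ^ (S N)) - / 2 * w m) with
        (- (/ 2 * w m * (- exp (- (2 * x * (INR m + 1)))) ^ (S N))) by ring.
      assert (Hwm : 0 < w m) by apply sech_pos.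
      rewrite Rabs_Ropp, !Rabs_mult, (Rabs_pos_eq (/ 2)), (Rabs_pos_eq (w m)) by lra.
      rewrite <- RPow_abs, Rabs_Ropp, Rabs_pos_eq by (apply Rlt_le, exp_pos).
      replace (/ 2 * exp (- (2 * x * INR N + 0)) * w m) with
        (/ 2 * w m * exp (- (2 * x * INR N + 0))) by ring.
      apply Rmult_le_compat_l; [lra|].
      assert (Hm := pos_INR m).
      assert (H1 : exp (- (2 * x * (INR m + 1))) <= exp (- (2 * x))).
      { destruct (Req_dec (INR m) 0) as [->|]; [right; f_equal; ring|].
        apply Rlt_le, exp_increasing; nra. }
      apply Rle_trans with (exp (- (2 * x)) ^ S N).
      - apply pow_incr; split; [apply Rlt_le, exp_pos|auto].
      - replace (exp (- (2 * x * INR N + 0))) with (exp (- (2 * x)) ^ N).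
        + simpl; rewrite <- (Rmult_1_l (exp (- (2 * x)) ^ N)) at 2.
          apply Rmult_le_compat_r; [apply pow_le, Rlt_le, exp_pos|].
          rewrite <- exp_0; apply Rlt_le, exp_increasing; lra.
        + clear; induction N as [|N IH]; [simpl; rewrite <- exp_0; f_equal; ring|].
          rewrite S_INR; simpl; rewrite IH, <- exp_plus; f_equal; ring. }
    rewrite <- (is_series_unique _ _ H).
    apply Rle_trans with (Series (fun m => / 2 * exp (- (2 * x * INR N + 0)) * w m)).
    - apply Rle_trans with (2 := Series_le _ _ (fun m => conj (Rabs_pos _) (Bm m))
        (ex_series_scal_l (/ 2 * exp (- (2 * x * INR N + 0))) w Hw)).
      apply Series_Rabs.
      apply (@ex_series_le R_AbsRing R_CompleteNormedModule) with
        (fun m => / 2 * exp (- (2 * x * INR N + 0)) * w m).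
      + intros m; eapply Rle_trans; [|apply Bm].
        change (Rabs (Rabs (/ 2 * sech (x * (INR m + 1)) *
          (1 - (- exp (- (2 * x * (INR m + 1)))) ^ (S N)) - / 2 * w m)) <=
          Rabs (/ 2 * sech (x * (INR m + 1)) *
          (1 - (- exp (- (2 * x * (INR m + 1)))) ^ (S N)) - / 2 * w m)).
        rewrite Rabs_Rabsolu; lra.
      + apply (ex_series_scal_l (/ 2 * exp (- (2 * x * INR N + 0))) w Hw).
    - rewrite Series_scal_l; fold s; right; ring. }
  apply is_lim_seq_ext with (fun N => / 2 * s +
    (sum_n (fun j => (-1) ^ j * bose ((2 * INR j + 1) * x)) N - / 2 * s)).
  { intros n; ring. }
  replace (Finite (/ 2 * s)) with (Finite (/ 2 * s + 0)) by (f_equal; ring).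
  apply is_lim_seq_plus'; [apply is_lim_seq_const|].
  apply is_lim_seq_abs_0.
  apply is_lim_seq_le_le with (fun _ => 0) (fun N => / 2 * s * exp (- (2 * x * INR N + 0))).
  - intros N; split; [apply Rabs_pos|apply B].
  - apply is_lim_seq_const.
  - replace (Finite 0) with (Finite (/ 2 * s * 0)) by (f_equal; ring).
    apply (is_lim_seq_scal_l _ (/ 2 * s) 0), is_lim_seq_exp_opp; lra.
Qed.

(* [Im (sec (u + i d))] for [u = kap v] and [s = sinh d]; as [s] tends to [0+] it
   concentrates at the zeros of [cos (kap v)]. *)
Definition poisson (kap s v : R) : R := sin (kap * v) * s / (cos (kap * v) ^ 2 + s ^ 2).

(** An antiderivative of the kernel that stays within [PI / 2 / kap] for every [s]; this later
    controls the tail uniformly. *)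
Definition poisson_prim (kap s v : R) : R := - atan (cos (kap * v) / s) / kap.

Lemma poisson_den_pos (kap s v : R) : 0 < s -> 0 < cos (kap * v) ^ 2 + s ^ 2.
Proof. intros H; nra. Qed.

Lemma is_derive_poisson_prim (kap s v : R) : 0 < kap -> 0 < s ->
  is_derive (poisson_prim kap s) v (poisson kap s v).
Proof.
  intros Hk Hs; assert (H := poisson_den_pos kap s v Hs); unfold poisson_prim, poisson;
    auto_derive; [lra|].
  field; repeat split; try lra; simpl in *; lra.
Qed.

Lemma continuous_poisson (kap s v : R) : 0 < s -> continuous (poisson kap s) v.
Proof.
  intros Hs; apply (ex_derive_continuous (V := R_NormedModule)).
  assert (H := poisson_den_pos kap s v Hs); unfold poisson; auto_derive; simpl in *; lra.
Qed.

Lemma is_RInt_poisson (kap s a b : R) : 0 < kap -> 0 < s ->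
  is_RInt (poisson kap s) a b (poisson_prim kap s b - poisson_prim kap s a).
Proof.
  intros Hk Hs; apply (is_RInt_derive (V := R_CompleteNormedModule)); intros x _.
  - now apply is_derive_poisson_prim.
  - now apply continuous_poisson.
Qed.

Lemma ex_RInt_cont (f : R -> R) (a b : R) : a <= b ->
  (forall x, a <= x <= b -> continuous f x) -> ex_RInt f a b.
Proof.
  intros Hab H; apply (ex_RInt_continuous (V := R_CompleteNormedModule)).
  now rewrite Rmin_left, Rmax_right by lra.
Qed.

Lemma poisson_prim_bound (kap s v : R) : 0 < kap -> Rabs (poisson_prim kap s v) <= PI / 2 / kap.
Proof.
  intros Hk; unfold poisson_prim, Rdiv at 1; rewrite Rabs_mult, Rabs_Ropp.
  rewrite (Rabs_pos_eq (/ kap)) by (apply Rlt_le, Rinv_0_lt_compat; lra).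
  apply Rmult_le_compat_r; [apply Rlt_le, Rinv_0_lt_compat; lra|].
  generalize (atan_bound (cos (kap * v) / s)); intros; apply Rabs_le; lra.
Qed.

Lemma atan_ge (y : R) : 0 < y -> PI / 2 - / y <= atan y <= PI / 2.
Proof.
  intros Hy; generalize (atan_bound y); intros; split; [|lra].
  assert (E := atan_inv y Hy).
  assert (Hiy : 0 < / y) by now apply Rinv_0_lt_compat.
  assert (atan (/ y) <= / y); [|lra].
  destruct (MVT_gen atan 0 (/ y) (fun z => / (1 + z ^ 2))) as [c [Hc Ec]].
  - intros z _; apply is_derive_Reals, derivable_pt_lim_atan.
  - intros z _; apply derivable_continuous_pt, derivable_pt_atan.
  - rewrite atan_0, !Rminus_0_r in Ec; rewrite Ec.
    assert (/ (1 + c ^ 2) <= 1).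
    { rewrite <- Rinv_1; apply Rinv_le_contravar; nra. }
    nra.
Qed.

Section Window.
Variable kap : R.
Hypothesis Hk : 0 < kap.
(** The first positive zero of [cos (kap * v)]. The positive zeros are [(2 j + 1) c], and the window
    from [2 c j] to [2 c (j + 1)] contains exactly one of them, at its centre. *)
Let c := PI / 2 / kap.

Lemma window_c_pos : 0 < c.
Proof. unfold c; assert (H := PI_RGT_0); apply Rdiv_lt_0_compat; lra. Qed.

(** The antiderivative jumps by nearly [PI / kap] across [c], and [atan y >= PI / 2 - / y] shows
    that the defect is of order [s]. The start [u] is variable because the first window must keep
    away from the pole of [bose] at [0]. *)
Lemma poisson_window_mass (u s : R) : 0 <= u < c -> 0 < s ->
  PI / kap - s * ((1 + / cos (kap * u)) / kap) <= RInt (poisson kap s) u (2 * c) <= PI / kap.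
Proof.
  intros Hu Hs; assert (HP := PI_RGT_0).
  rewrite (is_RInt_unique _ _ _ _ (is_RInt_poisson kap s u (2 * c) Hk Hs)).
  unfold poisson_prim; replace (kap * (2 * c)) with PI by (unfold c; field; lra); rewrite cos_PI.
  assert (Hcos : 0 < cos (kap * u)).
  { apply cos_gt_0; [nra|].
    apply Rmult_lt_reg_r with (/ kap); [now apply Rinv_0_lt_compat|].
    replace (kap * u * / kap) with u by (field; lra); apply Hu. }
  assert (H1 := atan_ge (cos (kap * u) / s) ltac:(now apply Rdiv_lt_0_compat)).
  assert (H2 := atan_ge (1 / s) ltac:(apply Rdiv_lt_0_compat; lra)).
  replace (-1 / s) with (- (1 / s)) by (field; lra).
  rewrite atan_opp.
  replace (/ (cos (kap * u) / s)) with (s * / cos (kap * u)) in H1 by (field; lra).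
  replace (/ (1 / s)) with s in H2 by (field; lra).
  replace (- - atan (1 / s) / kap - - atan (cos (kap * u) / s) / kap) with
    ((atan (1 / s) + atan (cos (kap * u) / s)) * / kap) by (field; lra).
  assert (Hik := Rinv_0_lt_compat kap Hk).
  split.
  - replace (PI / kap - s * ((1 + / cos (kap * u)) / kap)) with
      ((PI / 2 - s + (PI / 2 - s * / cos (kap * u))) * / kap) by (field; lra).
    apply Rmult_le_compat_r; lra.
  - apply Rmult_le_compat_r; lra.
Qed.

(** The kernel is an approximate identity at [c]: near [c] the variation of [phi] is below [eta],
    away from [c] the kernel is at most [s / m], and the mass is [PI / kap] up to order [s]. *)
Lemma poisson_window (phi : R -> R) (u : R) : 0 <= u < c ->
  (forall v, u <= v <= 2 * c -> continuous phi v) ->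
  forall eps, 0 < eps -> exists s0, 0 < s0 /\ forall s, 0 < s < s0 ->
    Rabs (RInt (fun v => poisson kap s v * phi v) u (2 * c) - PI / kap * phi c) < eps.
Proof.
  intros Hu Hphi eps He; assert (HP := PI_RGT_0).
  assert (Hik := Rinv_0_lt_compat kap Hk).
  assert (HPk : 0 < PI / kap) by (now apply Rdiv_lt_0_compat).
  set (eta := eps / (3 * (PI / kap))).
  assert (Heta : 0 < eta) by (apply Rdiv_lt_0_compat; lra).
  assert (Hc : continuous phi c) by (apply Hphi; lra).
  apply (proj1 (filterlim_locally phi (phi c))) with (eps := mkposreal eta Heta) in Hc.
  destruct Hc as [d0 Hd0].
  set (d := Rmin d0 (c / 2)).
  assert (Hd : 0 < d) by (apply Rmin_pos; [apply cond_pos|lra]).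
  assert (Hdc : d <= c / 2) by apply Rmin_r.
  assert (Hphid : forall v, Rabs (v - c) < d -> Rabs (phi v - phi c) < eta).
  { intros v Hv; apply Hd0; apply Rlt_le_trans with (1 := Hv), Rmin_l. }
  assert (Hpd : forall v, u <= v <= 2 * c -> continuous (fun v => phi v - phi c) v).
  { intros v Hv; apply (continuous_minus (V := R_NormedModule)); auto; apply continuous_const. }
  destruct (continuous_bounded (fun v => phi v - phi c) u (2 * c)) as [B [HB0 HB]]; [lra|auto|].
  set (m := sin (kap * d) ^ 2).
  assert (Ekc : kap * c = PI / 2) by (unfold c; field; lra).
  assert (Hm : 0 < m).
  { unfold m; assert (0 < sin (kap * d)); [|nra]; apply sin_gt_0; nra. }
  assert (Hcos : forall v, 0 <= v <= 2 * c -> d <= Rabs (v - c) -> m <= cos (kap * v) ^ 2).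
  { intros v Hv Hvd; unfold m.
    replace (cos (kap * v) ^ 2) with (sin (kap * Rabs (v - c)) ^ 2).
    - assert (H0 : 0 < sin (kap * d)) by (apply sin_gt_0; nra).
      assert (sin (kap * d) <= sin (kap * Rabs (v - c))); [|nra].
      assert (Rabs (v - c) <= c) by (apply Rabs_le; lra).
      apply sin_incr_1; nra.
    - replace (kap * v) with (PI / 2 - kap * (c - v)) by (rewrite <- Ekc; ring).
      rewrite cos_shift; unfold Rabs; destruct (Rcase_abs (v - c)).
      + f_equal; f_equal; ring.
      + replace (kap * (c - v)) with (- (kap * (v - c))) by ring; rewrite sin_neg; ring. }
  (* [s * q] will bound the part away from [c] and [s * r] the defect of mass; the part near [c]
     costs [eta * (PI / kap) = eps / 3]. *)
  set (q := B * (2 * c - u) / m).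
  set (r := Rabs (phi c) * ((1 + / cos (kap * u)) / kap)).
  assert (Hcu : 0 < cos (kap * u)) by (apply cos_gt_0; nra).
  assert (Hq : 0 <= q).
  { unfold q, Rdiv; repeat apply Rmult_le_pos; try lra; apply Rlt_le, Rinv_0_lt_compat; auto. }
  assert (Hr : 0 <= r).
  { unfold r; apply Rmult_le_pos; [apply Rabs_pos|].
    apply Rlt_le, Rdiv_lt_0_compat; auto.
    assert (0 < / cos (kap * u)) by (now apply Rinv_0_lt_compat); lra. }
  exists (eps / (3 * (q + r + 1))); split; [apply Rdiv_lt_0_compat; lra|].
  intros s [Hs Hs1].
  assert (Hsq : s * (q + r + 1) < eps / 3).
  { apply (Rmult_lt_compat_r (q + r + 1)) in Hs1; [|lra].
    replace (eps / (3 * (q + r + 1)) * (q + r + 1)) with (eps / 3) in Hs1 by (field; lra); auto. }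
  assert (HI := poisson_window_mass u s Hu Hs).
  assert (Hpk : forall v, 0 <= v <= 2 * c -> 0 <= poisson kap s v).
  { intros v Hv; unfold poisson; apply Rmult_le_pos.
    - apply Rmult_le_pos; [|lra]; apply sin_ge_0; nra.
    - apply Rlt_le, Rinv_0_lt_compat; now apply poisson_den_pos. }
  set (I := RInt (poisson kap s) u (2 * c)) in *.
  assert (HexI : ex_RInt (poisson kap s) u (2 * c)).
  { apply ex_RInt_cont; [lra|]; intros; now apply continuous_poisson. }
  set (h := fun v => poisson kap s v * (phi v - phi c)).
  assert (Hexh : ex_RInt h u (2 * c)).
  { apply ex_RInt_cont; [lra|]; intros v Hv; apply (continuous_mult (K := R_AbsRing)); auto.
    now apply continuous_poisson. }
  assert (E : RInt (fun v => poisson kap s v * phi v) u (2 * c) = RInt h u (2 * c) + phi c * I).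
  { unfold I; change (RInt (fun v => poisson kap s v * phi v) u (2 * c) =
      plus (RInt h u (2 * c)) (scal (phi c) (RInt (poisson kap s) u (2 * c)))).
    rewrite <- (RInt_scal (V := R_CompleteNormedModule)) by auto.
    rewrite <- (RInt_plus (V := R_CompleteNormedModule)); auto.
    - apply RInt_ext; intros v _; unfold h, plus, scal; simpl; unfold mult; simpl.
      real_eq; ring.
    - now apply (ex_RInt_scal (V := R_NormedModule)). }
  assert (Hh : Rabs (RInt h u (2 * c)) <= eta * (PI / kap) + s * q).
  { apply Rle_trans with (RInt (fun v => eta * poisson kap s v + s * (B / m)) u (2 * c)).
    - apply Rle_trans with (1 := abs_RInt_le h u (2 * c) ltac:(lra) Hexh).
      apply RInt_le; [lra| | |].
      + now apply (ex_RInt_norm h).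
      + apply (ex_RInt_plus (V := R_NormedModule)).
        * now apply (ex_RInt_scal (V := R_NormedModule)).
        * apply ex_RInt_const.
      + intros v Hv; unfold h; rewrite Rabs_mult, (Rabs_pos_eq (poisson kap s v)) by (apply Hpk;
        lra).
        assert (Hp := Hpk v ltac:(lra)).
        assert (HsBm : 0 <= s * (B / m)).
        { apply Rmult_le_pos; [lra|]; unfold Rdiv; apply Rmult_le_pos; [lra|].
          apply Rlt_le, Rinv_0_lt_compat; auto. }
        destruct (Rlt_le_dec (Rabs (v - c)) d) as [Hv1|Hv1].
        * assert (H1 := Hphid v Hv1); nra.
        * assert (H1 := HB v ltac:(lra)); assert (H2 := Hcos v ltac:(lra) Hv1).
          assert (H3 : poisson kap s v <= s / m).
          { unfold poisson; assert (Hsin := SIN_bound (kap * v)).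
            assert (0 <= sin (kap * v)) by (apply sin_ge_0; nra).
            apply Rle_trans with (s / (cos (kap * v) ^ 2 + s ^ 2)).
            - apply Rmult_le_compat_r; [apply Rlt_le, Rinv_0_lt_compat; nra|nra].
            - apply Rmult_le_compat_l; [lra|]; apply Rinv_le_contravar; nra. }
          assert (H4 := Rabs_pos (phi v - phi c)).
          apply Rle_trans with (s / m * B).
          -- now apply Rmult_le_compat.
          -- replace (s / m * B) with (s * (B / m)) by (field; lra); nra.
    - assert (E2 : RInt (fun v => eta * poisson kap s v + s * (B / m)) u (2 * c) = eta * I + s * q).
      { unfold I, q; change (RInt (fun v => plus (scal eta (poisson kap s v)) (s * (B / m))) u (2
        * c) =
          eta * RInt (poisson kap s) u (2 * c) + s * (B * (2 * c - u) / m)).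
        rewrite (RInt_plus (V := R_CompleteNormedModule)).
        - rewrite (RInt_scal (V := R_CompleteNormedModule)) by auto.
          rewrite RInt_const; unfold plus, scal; simpl; unfold mult; simpl; field; lra.
        - now apply (ex_RInt_scal (V := R_NormedModule)).
        - apply ex_RInt_const. }
      rewrite E2; assert (eta * I <= eta * (PI / kap)) by (apply Rmult_le_compat_l; lra); lra. }
  rewrite E.
  replace (RInt h u (2 * c) + phi c * I - PI / kap * phi c) with
    (RInt h u (2 * c) + phi c * (I - PI / kap)) by ring.
  assert (Hr2 : Rabs (phi c * (I - PI / kap)) <= s * r).
  { rewrite Rabs_mult; unfold r.
    replace (s * (Rabs (phi c) * ((1 + / cos (kap * u)) / kap))) with
      (Rabs (phi c) * (s * ((1 + / cos (kap * u)) / kap))) by ring.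
    apply Rmult_le_compat_l; [apply Rabs_pos|].
    rewrite Rabs_left1 by lra; lra. }
  assert (Ee : eta * (PI / kap) = eps / 3) by (unfold eta; field; lra).
  apply Rle_lt_trans with (1 := Rabs_triang _ _); nra.
Qed.

Lemma continuous_bose (v : R) : 0 < v -> continuous bose v.
Proof.
  intros Hv; apply (ex_derive_continuous (V := R_NormedModule)).
  assert (H := expm1_pos v Hv); unfold bose; auto_derive; lra.
Qed.

Lemma continuous_poisson_bose (s v : R) : 0 < s -> 0 < v ->
  continuous (fun v => poisson kap s v * bose v) v.
Proof.
  intros Hs Hv; apply (continuous_mult (K := R_AbsRing)).
  - now apply continuous_poisson.
  - now apply continuous_bose.
Qed.

Lemma poisson_shift (s v : R) (j : nat) : poisson kap s (v + 2 * c * INR j) =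
  (-1) ^ j * poisson kap s v.
Proof.
  induction j as [|j IH].
  - simpl; rewrite Rmult_0_r, Rplus_0_r; ring.
  - rewrite S_INR; replace (v + 2 * c * (INR j + 1)) with (v + 2 * c * INR j + 2 * c) by ring.
    assert (E : forall w, poisson kap s (w + 2 * c) = - poisson kap s w).
    { intros w; unfold poisson.
      replace (kap * (w + 2 * c)) with (kap * w + PI) by (unfold c; field; lra).
      rewrite neg_sin, neg_cos; unfold Rdiv.
      replace ((- cos (kap * w)) ^ 2) with (cos (kap * w) ^ 2) by ring; ring. }
    rewrite E, IH; simpl; ring.
Qed.

(** Only the first window is cut, at [v0]. Window [j] is translated back to [[0, 2 c]], where the
    kernel takes the sign [(-1)^j] and its peak meets [bose] at [(2 j + 1) c]. *)
Lemma poisson_bose_lim (v0 : R) (N : nat) : 0 < v0 < c -> forall eps, 0 < eps ->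
  exists s0, 0 < s0 /\ forall s, 0 < s < s0 ->
    Rabs (RInt (fun v => poisson kap s v * bose v) v0 (2 * c * (INR N + 1)) -
      PI / kap * sum_n (fun j => (-1) ^ j * bose ((2 * INR j + 1) * c)) N) < eps.
Proof.
  intros Hv0; induction N as [|N IH]; intros eps He.
  - destruct (poisson_window bose v0 ltac:(lra)) with (eps := eps) as [s0 [Hs0 H]]; auto.
    { intros v Hv; apply continuous_bose; lra. }
    exists s0; split; auto; intros s Hs; specialize (H s Hs).
    rewrite sum_O; simpl.
    replace (2 * c * (0 + 1)) with (2 * c) by ring.
    replace (1 * bose ((2 * 0 + 1) * c)) with (bose c); auto.
    rewrite Rmult_1_l; f_equal; ring.
  - destruct (IH (eps / 2)) as [s1 [Hs1 H1]]; [lra|].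
    set (sh := 2 * c * INR (S N)).
    assert (Hc := window_c_pos).
    assert (HN := pos_INR N).
    assert (Hsh : 0 < sh) by (unfold sh; rewrite S_INR; nra).
    destruct (poisson_window (fun v => bose (v + sh)) 0 ltac:(lra)) with (eps := eps / 2)
      as [s2 [Hs2 H2]]; [|lra|].
    { intros v Hv; apply (continuous_comp (fun v => v + sh) bose).
      - apply (continuous_plus (V := R_NormedModule)); [apply continuous_id|apply continuous_const].
      - apply continuous_bose; lra. }
    exists (Rmin s1 s2); split; [now apply Rmin_pos|]; intros s [Hs Hsm].
    specialize (H1 s (conj Hs (Rlt_le_trans _ _ _ Hsm (Rmin_l _ _)))).
    specialize (H2 s (conj Hs (Rlt_le_trans _ _ _ Hsm (Rmin_r _ _)))).
    rewrite sum_Sn; match goal with |- context [plus ?a ?b] => change (plus a b) with (a + b) end.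
    set (f := fun v => poisson kap s v * bose v) in *.
    assert (Hex : forall a b, 0 < a -> a <= b -> ex_RInt f a b).
    { intros a b Ha Hab; apply ex_RInt_cont; auto; intros; apply continuous_poisson_bose; lra. }
    replace (2 * c * (INR N + 1)) with sh in H1 by (unfold sh; rewrite S_INR; ring).
    replace (2 * c * (INR (S N) + 1)) with (2 * c + sh) by (unfold sh; ring).
    assert (Hv0sh : v0 <= sh) by (unfold sh; rewrite S_INR; nra).
    assert (C := RInt_Chasles (V := R_CompleteNormedModule) f v0 sh (2 * c + sh)
      (Hex v0 sh ltac:(lra) Hv0sh) (Hex sh (2 * c + sh) Hsh ltac:(lra))).
    change (RInt f v0 sh + RInt f sh (2 * c + sh) = RInt f v0 (2 * c + sh)) in C.
    assert (E : RInt f sh (2 * c + sh) =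
      (-1) ^ S N * RInt (fun v => poisson kap s v * bose (v + sh)) 0 (2 * c)).
    { assert (L := RInt_comp_lin (V := R_CompleteNormedModule) f 1 sh 0 (2 * c)).
      replace (1 * 0 + sh) with sh in L by ring.
      replace (1 * (2 * c) + sh) with (2 * c + sh) in L by ring.
      rewrite <- L by (apply Hex; lra).
      change (RInt (fun y => scal 1 (f (1 * y + sh))) 0 (2 * c) =
        scal ((-1) ^ S N) (RInt (fun v => poisson kap s v * bose (v + sh)) 0 (2 * c))).
      rewrite <- (RInt_scal (V := R_CompleteNormedModule)).
      - apply RInt_ext; intros v _; unfold f, scal; simpl; unfold mult; simpl.
        replace (1 * v + sh) with (v + sh) by ring.
        assert (Es := poisson_shift s v (S N)); fold sh in Es; rewrite Es; simpl.
        real_eq; ring.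
      - apply ex_RInt_cont; [lra|]; intros v Hv; apply (continuous_mult (K := R_AbsRing)).
        + now apply continuous_poisson.
        + apply (continuous_comp (fun v => v + sh) bose).
          * apply (continuous_plus (V := R_NormedModule));
            [apply continuous_id|apply continuous_const].
          * apply continuous_bose; lra. }
    rewrite <- C, E.
    replace (c + sh) with ((2 * INR (S N) + 1) * c) in H2 by (unfold sh; ring).
    set (T := (-1) ^ S N) in *.
    assert (HT : Rabs T = 1) by apply pow_1_abs.
    set (J := RInt (fun v => poisson kap s v * bose (v + sh)) 0 (2 * c)) in *.
    set (E0 := bose ((2 * INR (S N) + 1) * c)) in *.
    set (S0 := sum_n (fun j => (-1) ^ j * bose ((2 * INR j + 1) * c)) N) in *.
    match goal with |- Rabs ?X < _ =>
      replace X with ((RInt f v0 sh - PI / kap * S0) + T * (J - PI / kap * E0)) end.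
    + apply Rle_lt_trans with (1 := Rabs_triang _ _); rewrite Rabs_mult, HT; lra.
    + ring.
Qed.

(** Integration by parts: the antiderivative is bounded by [Q = PI / 2 / kap] and [bose] decreases,
    so everything is at most [Q (bose b + bose a) + Q (bose a - bose b)]. The bound does not contain
    [s]. *)
Lemma poisson_bose_tail (s a b : R) : 0 < s -> 0 < a -> a <= b ->
  Rabs (RInt (fun v => poisson kap s v * bose v) a b) <= PI / kap * bose a.
Proof.
  intros Hs Ha Hab.
  set (db := fun v => - exp v / (exp v - 1) ^ 2).
  assert (Hdb : forall v, a <= v -> is_derive bose v (db v)).
  { intros v Hv; assert (H := expm1_pos v ltac:(lra)); unfold bose, db; auto_derive; [lra|].
    field; lra. }
  assert (Hcdb : forall v, a <= v -> continuous db v).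
  { intros v Hv; apply (ex_derive_continuous (V := R_NormedModule)).
    assert (H := expm1_pos v ltac:(lra)); unfold db; auto_derive; simpl; nra. }
  assert (Hdb0 : forall v, a <= v -> db v <= 0).
  { intros v Hv; assert (H := expm1_pos v ltac:(lra)); unfold db, Rdiv.
    assert (0 < / (exp v - 1) ^ 2) by (apply Rinv_0_lt_compat; nra).
    generalize (exp_pos v); intros; nra. }
  set (g := fun v => poisson_prim kap s v * db v).
  assert (Hcg : forall v, a <= v -> continuous g v).
  { intros v Hv; apply (continuous_mult (K := R_AbsRing)); auto.
    apply (ex_derive_continuous (V := R_NormedModule)); exists (poisson kap s v).
    now apply is_derive_poisson_prim. }
  set (f := fun v => poisson kap s v * bose v).
  assert (Hcf : forall v, a <= v -> continuous f v) by (intros; apply continuous_poisson_bose; lra).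
  assert (Hexf : ex_RInt f a b) by (apply ex_RInt_cont; auto; intros; apply Hcf; lra).
  assert (Hexg : ex_RInt g a b) by (apply ex_RInt_cont; auto; intros; apply Hcg; lra).
  assert (E : RInt f a b + RInt g a b =
    poisson_prim kap s b * bose b - poisson_prim kap s a * bose a).
  { change (plus (RInt f a b) (RInt g a b) =
      minus (poisson_prim kap s b * bose b) (poisson_prim kap s a * bose a)).
    rewrite <- (RInt_plus (V := R_CompleteNormedModule)) by auto.
    apply is_RInt_unique.
    apply (is_RInt_derive (V := R_CompleteNormedModule) (fun v => poisson_prim kap s v * bose
      v)); intros v;
      rewrite Rmin_left, Rmax_right by lra; intros Hv.
    - apply (is_derive_mult (K := R_AbsRing) (poisson_prim kap s) bose v (poisson kap s v) (db v)).
      + now apply is_derive_poisson_prim.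
      + apply Hdb; lra.
      + intros; apply Rmult_comm.
    - apply (continuous_plus (V := R_NormedModule)); [apply Hcf|apply Hcg]; lra. }
  assert (HP := poisson_prim_bound kap s); set (Q := PI / 2 / kap) in *.
  assert (Hg : Rabs (RInt g a b) <= Q * (bose a - bose b)).
  { assert (Hd : is_RInt db a b (bose b - bose a)).
    { apply (is_RInt_derive (V := R_CompleteNormedModule)); intros v;
        rewrite Rmin_left, Rmax_right by lra; intros Hv; [apply Hdb|apply Hcdb]; lra. }
    assert (Hex : ex_RInt (fun v => - Q * db v) a b).
    { apply (ex_RInt_scal (V := R_NormedModule)); now exists (bose b - bose a). }
    apply Rle_trans with (RInt (fun v => - Q * db v) a b).
    - apply Rle_trans with (1 := abs_RInt_le g a b Hab Hexg).
      apply RInt_le; auto; [now apply (ex_RInt_norm g)|].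
      intros v Hv; unfold g; rewrite Rabs_mult.
      rewrite (Rabs_left1 (db v)) by (apply Hdb0; lra).
      assert (H1 := HP v Hk); assert (H2 := Hdb0 v ltac:(lra)); nra.
    - right; change (RInt (fun v => scal (- Q) (db v)) a b = Q * (bose a - bose b)).
      rewrite (RInt_scal (V := R_CompleteNormedModule)) by (now exists (bose b - bose a)).
      rewrite (is_RInt_unique _ _ _ _ Hd); unfold scal; simpl; unfold mult; simpl; ring. }
  assert (Hb := bose_pos b ltac:(lra)); assert (Ha' := bose_pos a Ha).
  replace (PI / kap) with (2 * Q) by (unfold Q; field; lra).
  assert (H1 := HP a Hk); assert (H2 := HP b Hk).
  apply Rabs_le_between in H1; apply Rabs_le_between in H2; apply Rabs_le_between in Hg.
  replace (RInt f a b) with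
    (poisson_prim kap s b * bose b - poisson_prim kap s a * bose a - RInt g a b) by lra.
  apply Rabs_le; split; nra.
Qed.

(** By the tail bound [A s] differs from the integral over the windows up to [N] by at most [e N],
    whatever [s] is. Letting [s] tend to [0] at fixed [N] gives [|X N - L| <= e N], and then [N] may
    tend to infinity. *)
Lemma poisson_bose_double_lim (v0 : R) (A : R -> R) (L : R) : 0 < v0 < c ->
  (forall s, 0 < s -> is_lim_seq
     (fun N => RInt (fun v => poisson kap s v * bose v) v0 (2 * c * (INR N + 1))) (A s)) ->
  (forall eps, 0 < eps -> exists s0, 0 < s0 /\ forall s, 0 < s < s0 -> Rabs (A s - L) < eps) ->
  L = PI / kap * ((theta3_sq c - 1) / 4).
Proof.
  intros Hv0 HA HL; assert (HP := PI_RGT_0); assert (Hc := window_c_pos).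
  assert (Hlim : is_lim_seq (fun N => PI / kap *
    sum_n (fun j => (-1) ^ j * bose ((2 * INR j + 1) * c)) N) (PI / kap * ((theta3_sq c - 1) / 4))).
  { apply (is_lim_seq_scal_l _ (PI / kap) ((theta3_sq c - 1) / 4)).
    exact (is_series_bose_alt c Hc). }
  set (X := fun N => PI / kap * sum_n (fun j => (-1) ^ j * bose ((2 * INR j + 1) * c)) N) in *.
  set (e := fun N => PI / kap * bose (2 * c * (INR N + 1))).
  assert (He : is_lim_seq e 0).
  { apply is_lim_seq_le_le with (fun _ => 0) (fun N => PI / kap * / (2 * c * (INR N + 1))).
    - intros N; assert (HN := pos_INR N); unfold e.
      assert (Hy : 0 < 2 * c * (INR N + 1)) by nra.
      assert (HPk : 0 < PI / kap) by (apply Rdiv_lt_0_compat; lra).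
      assert (Hb := bose_pos _ Hy); split; [nra|].
      apply Rmult_le_compat_l; [lra|].
      apply Rinv_le_contravar; auto.
      generalize (exp_ineq1_le (2 * c * (INR N + 1))); lra.
    - apply is_lim_seq_const.
    - replace (Finite 0) with (Rbar_mult (PI / kap) (Rbar_inv p_infty)) by (simpl; f_equal; ring).
      apply is_lim_seq_scal_l, is_lim_seq_inv; [|discriminate].
      apply is_lim_seq_ext with (fun N => (2 * c) * INR (S N)); [intros; now rewrite S_INR|].
      replace p_infty with (Rbar_mult (2 * c) p_infty).
      + apply is_lim_seq_scal_l, (is_lim_seq_incr_1 INR), is_lim_seq_INR.
      + simpl; destruct (Rle_dec 0 (2 * c)); [|lra].
        destruct (Rle_lt_or_eq_dec 0 (2 * c) r); [auto|lra]. }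
  assert (Hb : forall N, Rabs (X N - L) <= e N).
  { intros N; apply le_epsilon; intros eps Heps.
    destruct (HL (eps / 2)) as [s1 [Hs1 H1]]; [lra|].
    destruct (poisson_bose_lim v0 N Hv0 (eps / 2)) as [s2 [Hs2 H2]]; [lra|].
    set (s := Rmin s1 s2 / 2).
    assert (Hm : 0 < Rmin s1 s2) by now apply Rmin_pos.
    assert (Hsa := Rmin_l s1 s2); assert (Hsb := Rmin_r s1 s2).
    specialize (H1 s ltac:(unfold s; lra)); specialize (H2 s ltac:(unfold s; lra)).
    assert (Hs : 0 < s) by (unfold s; lra).
    fold (X N) in H2.
    set (F := fun N => RInt (fun v => poisson kap s v * bose v) v0 (2 * c * (INR N + 1))) in *.
    assert (HN := pos_INR N).
    assert (H3 : Rabs (A s - F N) <= e N).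
    { assert (Hl : is_lim_seq (fun k => Rabs (F (k + N)%nat - F N)) (Rabs (A s - F N))).
      { apply (is_lim_seq_abs _ (A s - F N)).
        apply is_lim_seq_minus'; [|apply is_lim_seq_const].
        apply (is_lim_seq_incr_n F N), HA; auto. }
      apply (is_lim_seq_le _ (fun _ => e N) _ (e N)) with (2 := Hl); [|apply is_lim_seq_const].
      intros k.
      set (a := 2 * c * (INR N + 1)); set (b := 2 * c * (INR (k + N) + 1)).
      assert (Hab : a <= b) by (unfold a, b; rewrite plus_INR; generalize (pos_INR k); intros; nra).
      assert (Hva : v0 <= a) by (unfold a; nra).
      assert (C := RInt_Chasles (V := R_CompleteNormedModule) (fun v => poisson kap s v * bose v)
        v0 a b).
      change (ex_RInt (fun v => poisson kap s v * bose v) v0 a ->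
        ex_RInt (fun v => poisson kap s v * bose v) a b ->
        F N + RInt (fun v => poisson kap s v * bose v) a b = F (k + N)%nat) in C.
      rewrite <- C.
      - rewrite Rplus_minus_l; apply poisson_bose_tail; lra.
      - apply ex_RInt_cont; auto; intros; apply continuous_poisson_bose; lra.
      - apply ex_RInt_cont; auto; intros; apply continuous_poisson_bose; lra. }
    fold (F N) in H2.
    apply Rabs_def2 in H1; apply Rabs_def2 in H2; apply Rabs_le_between in H3.
    apply Rabs_le; lra. }
  assert (HXL : is_lim_seq X L).
  { apply is_lim_seq_ext with (fun N => L + (X N - L)); [intros; ring|].
    replace (Finite L) with (Finite (L + 0)) by (f_equal; ring).
    apply is_lim_seq_plus'; [apply is_lim_seq_const|].
    apply is_lim_seq_abs_0.
    apply is_lim_seq_le_le with (fun _ => 0) e; auto; [|apply is_lim_seq_const].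
    intros N; split; [apply Rabs_pos|auto]. }
  apply is_lim_seq_unique in HXL; apply is_lim_seq_unique in Hlim.
  rewrite Hlim in HXL; now injection HXL.
Qed.

End Window.

(** * The secant of the logarithm in polar coordinates *)

(* [sec (A + i B) = (cos A cosh B + i sin A sinh B) / (cos A ^ 2 + sinh B ^ 2)]. *)
Definition sec_den (A B : R) : R := cos A ^ 2 + sinh B ^ 2.
Definition sec_re (A B : R) : R := cos A * cosh B / sec_den A B.
Definition sec_im (A B : R) : R := sin A * sinh B / sec_den A B.
(* Real and imaginary parts of the derivative of [sec] at [A + i B]. *)
Definition dsec_re (A B : R) : R :=
  sin A * cosh B * (cos A ^ 2 - sinh B ^ 2) / sec_den A B ^ 2.
Definition dsec_im (A B : R) : R :=
  cos A * sinh B * (2 - cos A ^ 2 + sinh B ^ 2) / sec_den A B ^ 2.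

Lemma cosh2 (y : R) : cosh y ^ 2 = 1 + sinh y ^ 2.
Proof.
  unfold cosh, sinh.
  assert (E : exp y * exp (- y) = 1) by (rewrite <- exp_plus, Rplus_opp_r; apply exp_0).
  replace 1 with (exp y * exp (- y)); field.
Qed.

Lemma is_derive_sinh (f : R -> R) (x df : R) :
  is_derive f x df -> is_derive (fun y => sinh (f y)) x (cosh (f x) * df).
Proof.
  intros H; rewrite Rmult_comm; apply (is_derive_comp (V := R_NormedModule) sinh f); auto.
  apply is_derive_Reals, derivable_pt_lim_sinh.
Qed.

Lemma is_derive_cosh (f : R -> R) (x df : R) :
  is_derive f x df -> is_derive (fun y => cosh (f y)) x (sinh (f x) * df).
Proof.
  intros H; rewrite Rmult_comm; apply (is_derive_comp (V := R_NormedModule) cosh f); auto.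
  apply is_derive_Reals, derivable_pt_lim_cosh.
Qed.

Lemma is_derive_sin_comp (f : R -> R) (x df : R) :
  is_derive f x df -> is_derive (fun y => sin (f y)) x (cos (f x) * df).
Proof.
  intros H; rewrite Rmult_comm; apply (is_derive_comp (V := R_NormedModule) sin f); auto.
  apply is_derive_Reals, derivable_pt_lim_sin.
Qed.

Lemma is_derive_cos_comp (f : R -> R) (x df : R) :
  is_derive f x df -> is_derive (fun y => cos (f y)) x (- sin (f x) * df).
Proof.
  intros H; rewrite Rmult_comm; apply (is_derive_comp (V := R_NormedModule) cos f); auto.
  apply is_derive_Reals, derivable_pt_lim_cos.
Qed.

(** Four separate factors let one rule serve [sec_re], with [d = cosh], and [sec_im], with
    [d = s = sinh]. *)
Lemma is_derive_mult_div (c d s : R -> R) (x dc dd ds : R) :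
  is_derive c x dc -> is_derive d x dd -> is_derive s x ds -> forall e de, is_derive e x de ->
  e x ^ 2 + s x ^ 2 <> 0 ->
  is_derive (fun y => c y * d y / (e y ^ 2 + s y ^ 2)) x
    ((dc * d x + c x * dd) / (e x ^ 2 + s x ^ 2) -
     c x * d x * (2 * e x * de + 2 * s x * ds) / (e x ^ 2 + s x ^ 2) ^ 2).
Proof.
  intros Hc Hd Hs e de He Hq; auto_derive.
  - repeat split; try (eexists; eassumption); simpl in *; lra.
  - assert (Ec : Derive (fun y : R => c y) x = dc) by now apply is_derive_unique.
    assert (Ed : Derive (fun y : R => d y) x = dd) by now apply is_derive_unique.
    assert (Es : Derive (fun y : R => s y) x = ds) by now apply is_derive_unique.
    assert (Ee : Derive (fun y : R => e y) x = de) by now apply is_derive_unique.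
    rewrite Ec, Ed, Es, Ee.
    field; simpl in *; lra.
Qed.

Lemma is_derive_sec_re (A B : R -> R) (x dA dB : R) :
  is_derive A x dA -> is_derive B x dB -> sec_den (A x) (B x) <> 0 ->
  is_derive (fun y => sec_re (A y) (B y)) x
    (dsec_re (A x) (B x) * dA - dsec_im (A x) (B x) * dB).
Proof.
  intros HA HB Hq; unfold sec_re, sec_den.
  evar_last.
  - apply (is_derive_mult_div (fun y => cos (A y)) (fun y => cosh (B y)) (fun y => sinh (B y))
      x _ _ _ (is_derive_cos_comp _ _ _ HA) (is_derive_cosh _ _ _ HB) (is_derive_sinh _ _ _ HB)
      (fun y => cos (A y)) _ (is_derive_cos_comp _ _ _ HA)); exact Hq.
  - unfold dsec_re, dsec_im, sec_den in *.
    set (q := cos (A x) ^ 2 + sinh (B x) ^ 2) in *.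
    assert (E := cosh2 (B x)).
    (* One factor is isolated as [cosh ^ 2], so that after rewriting it by [cosh2] both sides agree
       as rational expressions. *)
    match goal with |- ?l = ?r => replace l with
     ((((- sin (A x) * dA) * cosh (B x) + cos (A x) * (sinh (B x) * dB)) * q -
      (cos (A x) * cosh (B x) * (2 * cos (A x) * (- sin (A x) * dA)) +
       2 * cos (A x) * sinh (B x) * dB * cosh (B x) ^ 2)) / q ^ 2) by (field; auto) end.
    rewrite E; unfold q; field; fold q; auto.
Qed.

Lemma is_derive_sec_im (A B : R -> R) (x dA dB : R) :
  is_derive A x dA -> is_derive B x dB -> sec_den (A x) (B x) <> 0 ->
  is_derive (fun y => sec_im (A y) (B y)) x
    (dsec_im (A x) (B x) * dA + dsec_re (A x) (B x) * dB).
Proof.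
  intros HA HB Hq; unfold sec_im, sec_den.
  evar_last.
  - apply (is_derive_mult_div (fun y => sin (A y)) (fun y => sinh (B y)) (fun y => sinh (B y))
      x _ _ _ (is_derive_sin_comp _ _ _ HA) (is_derive_sinh _ _ _ HB) (is_derive_sinh _ _ _ HB)
      (fun y => cos (A y)) _ (is_derive_cos_comp _ _ _ HA)); exact Hq.
  - unfold dsec_re, dsec_im, sec_den in *.
    set (q := cos (A x) ^ 2 + sinh (B x) ^ 2) in *.
    assert (E : sin (A x) ^ 2 = 1 - cos (A x) ^ 2)
      by (generalize (sin2_cos2 (A x)); unfold Rsqr; nra).
    match goal with |- ?l = ?r => replace l with
     (((cos (A x) * dA * sinh (B x) + sin (A x) * (cosh (B x) * dB)) * q -
      (sin (A x) * sinh (B x) * (2 * sinh (B x) * (cosh (B x) * dB)) -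
       2 * sin (A x) ^ 2 * cos (A x) * sinh (B x) * dA)) / q ^ 2) by (field; auto) end.
    rewrite E; unfold q; field; fold q; auto.
Qed.

(** [sec_den] is the squared modulus of [cos (A + i B)], and the real part of the secant is at most
    its modulus. *)
Lemma sec_re_bound (A B m : R) : 0 < m -> m ^ 2 <= sec_den A B -> Rabs (sec_re A B) <= / m.
Proof.
  intros Hm H; assert (Hq : 0 < sec_den A B) by nra.
  assert (Hsq : sec_re A B ^ 2 <= / m ^ 2).
  { apply Rle_trans with (/ sec_den A B); [|apply Rinv_le_contravar; nra].
    unfold sec_re.
    replace ((cos A * cosh B / sec_den A B) ^ 2) with
      ((cos A ^ 2 * cosh B ^ 2) / sec_den A B * / sec_den A B) by (field; lra).
    rewrite <- (Rmult_1_l (/ sec_den A B)) at 2.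
    apply Rmult_le_compat_r; [apply Rlt_le, Rinv_0_lt_compat; auto|].
    apply Rle_div_l; auto; rewrite cosh2; unfold sec_den.
    assert (0 <= cos A ^ 2 <= 1) by (generalize (sin2_cos2 A); unfold Rsqr; nra).
    assert (0 <= sinh B ^ 2) by nra; nra. }
  rewrite <- (Rabs_pos_eq (/ m)) by (apply Rlt_le, Rinv_0_lt_compat; auto).
  apply Rsqr_le_abs_0; unfold Rsqr.
  replace (/ m * / m) with (/ m ^ 2) by (field; lra).
  replace (sec_re A B * sec_re A B) with (sec_re A B ^ 2) by ring; auto.
Qed.

(* [log_re + i log_im = log (1 + r e^{i th})], for the principal branch, where
   [1 + r cos th > 0]. *)
Definition log_den (r th : R) : R := 1 + 2 * r * cos th + r ^ 2.
Definition log_re (r th : R) : R := ln (log_den r th) / 2.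
Definition log_im (r th : R) : R := atan (r * sin th / (1 + r * cos th)).

Lemma log_den_eq (r th : R) : log_den r th = (1 + r * cos th) ^ 2 + (r * sin th) ^ 2.
Proof.
  unfold log_den; assert (E : sin th ^ 2 = 1 - cos th ^ 2)
    by (generalize (sin2_cos2 th); unfold Rsqr; nra).
  replace ((r * sin th) ^ 2) with (r ^ 2 * sin th ^ 2) by ring; rewrite E; ring.
Qed.

Lemma log_den_pos (r th : R) : 0 < 1 + r * cos th -> 0 < log_den r th.
Proof. intros H; rewrite log_den_eq; nra. Qed.

Lemma re_pos_lt_1 (r th : R) : -1 < r < 1 -> 0 < 1 + r * cos th.
Proof.
  intros H; assert (Hc := COS_bound th).
  assert (B : Rabs (r * cos th) < 1); [|apply Rabs_def2 in B; lra].
  rewrite Rabs_mult; assert (Rabs r < 1) by (apply Rabs_def1; lra).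
  assert (Rabs (cos th) <= 1) by (apply Rabs_le; lra).
  generalize (Rabs_pos r) (Rabs_pos (cos th)); intros; nra.
Qed.

(** On the closed upper half disc only the branch point [-1] of the logarithm is lost. *)
Lemma re_pos_lt_PI (r th : R) : 0 <= r <= 1 -> 0 <= th < PI -> 0 < 1 + r * cos th.
Proof.
  intros Hr Hth; assert (-1 < cos th); [|destruct (Rle_dec 0 (cos th)); nra].
  rewrite <- cos_PI; apply cos_decreasing_1; lra.
Qed.

Lemma log_im_nonneg (r th : R) : 0 <= r -> 0 <= th <= PI -> 0 < 1 + r * cos th ->
  0 <= log_im r th.
Proof.
  intros Hr Hth H; unfold log_im.
  assert (Hs : 0 <= sin th) by (apply sin_ge_0; lra).
  assert (0 <= r * sin th / (1 + r * cos th)).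
  { apply Rmult_le_pos; [nra|apply Rlt_le, Rinv_0_lt_compat; auto]. }
  destruct (Req_dec (r * sin th / (1 + r * cos th)) 0) as [->|Hne]; [rewrite atan_0; lra|].
  apply Rlt_le; rewrite <- atan_0; apply atan_increasing; lra.
Qed.

Section Radial.
Variables kap d : R.

(* Real and imaginary parts of [sec (kap log (1 + r e^{i th}) + i d)]. *)
Definition sec_log_re (r th : R) : R := sec_re (kap * log_re r th) (kap * log_im r th + d).
Definition sec_log_im (r th : R) : R := sec_im (kap * log_re r th) (kap * log_im r th + d).
Definition sec_log_den (r th : R) : R := sec_den (kap * log_re r th) (kap * log_im r th + d).
(** The chain rule with [e^(i th) / (1 + r e^(i th)) = (cos th + r + i sin th) / log_den r th]. *)
Definition sec_log_re_r (r th : R) : R :=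
  kap * (dsec_re (kap * log_re r th) (kap * log_im r th + d) * (cos th + r) -
         dsec_im (kap * log_re r th) (kap * log_im r th + d) * sin th) / log_den r th.

Lemma is_derive_log_re_r (r th : R) : 0 < 1 + r * cos th ->
  is_derive (fun r => kap * log_re r th) r (kap * ((cos th + r) / log_den r th)).
Proof.
  intros H; assert (Hd := log_den_pos r th H); unfold log_re, log_den in *.
  auto_derive; [simpl in *; lra|]; field; simpl in *; lra.
Qed.

Lemma is_derive_log_im_r (r th : R) : 0 < 1 + r * cos th ->
  is_derive (fun r => kap * log_im r th + d) r (kap * (sin th / log_den r th)).
Proof.
  intros H; assert (Hd := log_den_pos r th H); assert (E := log_den_eq r th).
  unfold log_im; auto_derive; [lra|].
  rewrite E in *; field; simpl in *; nra.
Qed.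

Lemma is_derive_log_re_th (r th : R) : 0 < 1 + r * cos th ->
  is_derive (fun th => kap * log_re r th) th (kap * (- (r * sin th) / log_den r th)).
Proof.
  intros H; assert (Hd := log_den_pos r th H); unfold log_re, log_den in *.
  auto_derive; [simpl in *; lra|]; field; simpl in *; lra.
Qed.

Lemma is_derive_log_im_th (r th : R) : 0 < 1 + r * cos th ->
  is_derive (fun th => kap * log_im r th + d) th (kap * (r * (cos th + r) / log_den r th)).
Proof.
  intros H; assert (Hd := log_den_pos r th H); assert (E := log_den_eq r th).
  unfold log_im; auto_derive; [lra|].
  replace (r * (cos th + r)) with (r * cos th * (1 + r * cos th) + r * sin th * (r * sin th)).
  - rewrite E in *; field; simpl in *; nra.
  - assert (Es : sin th ^ 2 = 1 - cos th ^ 2)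
      by (generalize (sin2_cos2 th); unfold Rsqr; nra).
    replace (r * sin th * (r * sin th)) with (r ^ 2 * sin th ^ 2) by ring; rewrite Es; ring.
Qed.

Lemma is_derive_sec_log_re (r th : R) : 0 < 1 + r * cos th -> sec_log_den r th <> 0 ->
  is_derive (fun r => sec_log_re r th) r (sec_log_re_r r th).
Proof.
  intros H Hq; evar_last.
  - apply (is_derive_sec_re (fun r => kap * log_re r th) (fun r => kap * log_im r th + d)
      r _ _ (is_derive_log_re_r r th H) (is_derive_log_im_r r th H) Hq).
  - unfold sec_log_re_r; field; generalize (log_den_pos r th H); lra.
Qed.

(* The Cauchy--Riemann equation [r (Re f)_r = (Im f)_th] in polar coordinates. *)
Lemma is_derive_sec_log_im (r th : R) : 0 < 1 + r * cos th -> sec_log_den r th <> 0 ->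
  is_derive (fun th => sec_log_im r th) th (r * sec_log_re_r r th).
Proof.
  intros H Hq; evar_last.
  - apply (is_derive_sec_im (fun th => kap * log_re r th) (fun th => kap * log_im r th + d)
      th _ _ (is_derive_log_re_th r th H) (is_derive_log_im_th r th H) Hq).
  - unfold sec_log_re_r; field; generalize (log_den_pos r th H); lra.
Qed.

End Radial.

(** * Joint continuity in radius and angle *)

Lemma continuity_2d_pt_div (f g : R -> R -> R) (x y : R) :
  continuity_2d_pt f x y -> continuity_2d_pt g x y -> g x y <> 0 ->
  continuity_2d_pt (fun u v => f u v / g u v) x y.
Proof.
  intros Hf Hg H; apply (continuity_2d_pt_mult f (fun u v => / g u v)); auto.
  now apply continuity_2d_pt_inv.
Qed.

Lemma continuity_2d_pt_sqr (f : R -> R -> R) (x y : R) :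
  continuity_2d_pt f x y -> continuity_2d_pt (fun u v => f u v ^ 2) x y.
Proof.
  intros Hf; apply continuity_2d_pt_ext with (fun u v => f u v * f u v).
  - intros; ring.
  - now apply continuity_2d_pt_mult.
Qed.

Lemma continuity_pt_derive (f : R -> R) (x l : R) : is_derive f x l -> continuity_pt f x.
Proof. intros H; apply derivable_continuous_pt; exists l; now apply is_derive_Reals. Qed.

Section Sec2d.
Variables (A B : R -> R -> R) (x y : R).
Hypothesis HA : continuity_2d_pt A x y.
Hypothesis HB : continuity_2d_pt B x y.

Let Hcos : continuity_2d_pt (fun u v => cos (A u v)) x y.
Proof. apply continuity_1d_2d_pt_comp; auto; apply continuity_cos. Qed.

Let Hsin : continuity_2d_pt (fun u v => sin (A u v)) x y.
Proof. apply continuity_1d_2d_pt_comp; auto; apply continuity_sin. Qed.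

Let Hcosh : continuity_2d_pt (fun u v => cosh (B u v)) x y.
Proof.
  apply continuity_1d_2d_pt_comp; auto; apply derivable_continuous_pt, derivable_pt_cosh.
Qed.

Let Hsinh : continuity_2d_pt (fun u v => sinh (B u v)) x y.
Proof.
  apply continuity_1d_2d_pt_comp; auto; apply derivable_continuous_pt, derivable_pt_sinh.
Qed.

Lemma continuity_2d_pt_sec_den : continuity_2d_pt (fun u v => sec_den (A u v) (B u v)) x y.
Proof. apply continuity_2d_pt_plus; now apply continuity_2d_pt_sqr. Qed.

Hypothesis Hq : sec_den (A x y) (B x y) <> 0.

Lemma continuity_2d_pt_sec_re : continuity_2d_pt (fun u v => sec_re (A u v) (B u v)) x y.
Proof.
  apply continuity_2d_pt_div; auto.
  - now apply continuity_2d_pt_mult.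
  - apply continuity_2d_pt_sec_den.
Qed.

Let Hden2 : continuity_2d_pt (fun u v => sec_den (A u v) (B u v) ^ 2) x y.
Proof. apply continuity_2d_pt_sqr, continuity_2d_pt_sec_den. Qed.

Lemma continuity_2d_pt_dsec_re : continuity_2d_pt (fun u v => dsec_re (A u v) (B u v)) x y.
Proof.
  apply continuity_2d_pt_div; auto; [|now apply pow_nonzero].
  apply continuity_2d_pt_mult; [now apply continuity_2d_pt_mult|].
  apply continuity_2d_pt_minus; now apply continuity_2d_pt_sqr.
Qed.

Lemma continuity_2d_pt_dsec_im : continuity_2d_pt (fun u v => dsec_im (A u v) (B u v)) x y.
Proof.
  apply continuity_2d_pt_div; auto; [|now apply pow_nonzero].
  apply continuity_2d_pt_mult; [now apply continuity_2d_pt_mult|].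
  apply continuity_2d_pt_plus; [|now apply continuity_2d_pt_sqr].
  apply continuity_2d_pt_minus; [apply continuity_2d_pt_const|now apply continuity_2d_pt_sqr].
Qed.

End Sec2d.

Lemma continuity_2d_pt_cos2 (r th : R) : continuity_2d_pt (fun u v => cos v) r th.
Proof. apply (continuity_1d_2d_pt_comp cos (fun _ v => v));
  [apply continuity_cos|apply continuity_2d_pt_id2]. Qed.

Lemma continuity_2d_pt_sin2 (r th : R) : continuity_2d_pt (fun u v => sin v) r th.
Proof. apply (continuity_1d_2d_pt_comp sin (fun _ v => v));
  [apply continuity_sin|apply continuity_2d_pt_id2]. Qed.

Lemma continuity_2d_pt_log_den (r th : R) : continuity_2d_pt log_den r th.
Proof.
  unfold log_den; apply continuity_2d_pt_plus.
  - apply continuity_2d_pt_plus; [apply continuity_2d_pt_const|].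
    apply continuity_2d_pt_mult; [|apply continuity_2d_pt_cos2].
    apply continuity_2d_pt_mult; [apply continuity_2d_pt_const|apply continuity_2d_pt_id1].
  - apply continuity_2d_pt_sqr, continuity_2d_pt_id1.
Qed.

Lemma continuity_2d_pt_scaled_log_re (kap r th : R) : 0 < 1 + r * cos th ->
  continuity_2d_pt (fun u v => kap * log_re u v) r th.
Proof.
  intros H; apply continuity_2d_pt_mult; [apply continuity_2d_pt_const|].
  apply continuity_2d_pt_div; [|apply continuity_2d_pt_const|lra].
  apply continuity_1d_2d_pt_comp; [|apply continuity_2d_pt_log_den].
  assert (Hd := log_den_pos r th H).
  apply (continuity_pt_derive _ _ (/ log_den r th)), is_derive_ln; auto.
Qed.

Lemma continuity_2d_pt_scaled_log_im (kap d r th : R) : 0 < 1 + r * cos th ->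
  continuity_2d_pt (fun u v => kap * log_im u v + d) r th.
Proof.
  intros H; apply continuity_2d_pt_plus; [|apply continuity_2d_pt_const].
  apply continuity_2d_pt_mult; [apply continuity_2d_pt_const|].
  apply continuity_1d_2d_pt_comp; [apply derivable_continuous_pt, derivable_pt_atan|].
  apply continuity_2d_pt_div; [| |lra].
  - apply continuity_2d_pt_mult; [apply continuity_2d_pt_id1|apply continuity_2d_pt_sin2].
  - apply continuity_2d_pt_plus; [apply continuity_2d_pt_const|].
    apply continuity_2d_pt_mult; [apply continuity_2d_pt_id1|apply continuity_2d_pt_cos2].
Qed.

Lemma continuity_2d_pt_sec_log_re (kap d r th : R) : 0 < 1 + r * cos th ->
  sec_log_den kap d r th <> 0 ->
  continuity_2d_pt (sec_log_re kap d) r th.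
Proof.
  intros H Hq; apply (continuity_2d_pt_sec_re (fun u v => kap * log_re u v)
    (fun u v => kap * log_im u v + d)); auto.
  - now apply continuity_2d_pt_scaled_log_re.
  - now apply continuity_2d_pt_scaled_log_im.
Qed.

Lemma continuity_2d_pt_sec_log_den (kap d r th : R) : 0 < 1 + r * cos th ->
  continuity_2d_pt (sec_log_den kap d) r th.
Proof.
  intros H; apply (continuity_2d_pt_sec_den (fun u v => kap * log_re u v)
    (fun u v => kap * log_im u v + d)); auto.
  - now apply continuity_2d_pt_scaled_log_re.
  - now apply continuity_2d_pt_scaled_log_im.
Qed.

Lemma continuity_2d_pt_sec_log_re_r (kap d r th : R) : 0 < 1 + r * cos th ->
  sec_log_den kap d r th <> 0 ->
  continuity_2d_pt (sec_log_re_r kap d) r th.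
Proof.
  intros H Hq; assert (HA := continuity_2d_pt_scaled_log_re kap r th H).
  assert (HB := continuity_2d_pt_scaled_log_im kap d r th H).
  apply continuity_2d_pt_div; [|apply continuity_2d_pt_log_den|generalize (log_den_pos r th H);
    lra].
  apply continuity_2d_pt_mult; [apply continuity_2d_pt_const|].
  apply continuity_2d_pt_minus; apply continuity_2d_pt_mult.
  - now apply (continuity_2d_pt_dsec_re (fun u v => kap * log_re u v) (fun u v => kap * log_im u
    v + d)).
  - apply continuity_2d_pt_plus; [apply continuity_2d_pt_cos2|apply continuity_2d_pt_id1].
  - now apply (continuity_2d_pt_dsec_im (fun u v => kap * log_re u v) (fun u v => kap * log_im u
    v + d)).
  - apply continuity_2d_pt_sin2.
Qed.

(** * Integrals over semicircles *)

Lemma sinh_le (x y : R) : x <= y -> sinh x <= sinh y.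
Proof.
  intros [H| ->]; [|lra]; unfold sinh.
  assert (exp x < exp y) by (apply exp_increasing; lra).
  assert (exp (- y) < exp (- x)) by (apply exp_increasing; lra); lra.
Qed.

(** In the upper half disc the argument of [1 + r e^(i th)] is nonnegative, so the shifted imaginary
    part is at least [d]. The bound does not degrade as [r] tends to [1]. *)
Lemma sec_log_den_ge_sinh (kap d r th : R) : 0 < kap -> 0 < d -> 0 <= r -> 0 <= th <= PI ->
  0 < 1 + r * cos th -> sinh d ^ 2 <= sec_log_den kap d r th.
Proof.
  intros Hk Hd Hr Hth H; assert (Hi := log_im_nonneg r th Hr Hth H).
  unfold sec_log_den, sec_den.
  assert (H1 := sinh_pos d Hd).
  assert (H2 : sinh d <= sinh (kap * log_im r th + d)) by (apply sinh_le; nra).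
  nra.
Qed.

Lemma sec_log_im_PI (kap d r : R) : 0 <= r < 1 ->
  sec_log_im kap d r PI = sec_im (kap * ln (1 - r)) d.
Proof.
  intros Hr; unfold sec_log_im, log_re, log_im, log_den; rewrite cos_PI, sin_PI.
  f_equal.
  - replace (1 + 2 * r * -1 + r ^ 2) with ((1 - r) * (1 - r)) by ring.
    rewrite ln_mult by lra; field.
  - unfold Rdiv; rewrite Rmult_0_r, Rmult_0_l, atan_0; ring.
Qed.

Lemma sec_log_im_0 (kap d r : R) : 0 <= r -> sec_log_im kap d r 0 = sec_im (kap * ln (1 + r)) d.
Proof.
  intros Hr; unfold sec_log_im, log_re, log_im, log_den; rewrite cos_0, sin_0.
  f_equal.
  - replace (1 + 2 * r * 1 + r ^ 2) with ((1 + r) * (1 + r)) by ring.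
    rewrite ln_mult by lra; field.
  - unfold Rdiv; rewrite Rmult_0_r, Rmult_0_l, atan_0; ring.
Qed.

(** Restricted to the upper semicircle, because on the lower one the shift could cancel the
    imaginary part of the logarithm. *)
Definition circ (kap d r : R) : R := RInt (sec_log_re kap d r) 0 PI.

(** After differentiation under the integral the integrand is the angular derivative of
    [sec_log_im / r]; its values at [th = PI] and [th = 0] remain. *)
Lemma is_derive_circ (kap d r : R) : 0 < kap -> 0 < d -> 0 < r < 1 ->
  is_derive (circ kap d) r ((sec_im (kap * ln (1 - r)) d - sec_im (kap * ln (1 + r)) d) / r).
Proof.
  intros Hk Hd Hr; assert (HP := PI_RGT_0).
  assert (Hsh := sinh_pos d Hd).
  assert (Hre : forall u v, 0 < u < 1 -> 0 < 1 + u * cos v) by (intros; apply re_pos_lt_1; lra).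
  assert (Hden : forall u v, 0 < u < 1 -> 0 <= v <= PI -> sec_log_den kap d u v <> 0).
  { intros u v Hu Hv; assert (H := sec_log_den_ge_sinh kap d u v Hk Hd ltac:(lra) Hv (Hre u v
    Hu)); nra. }
  assert (Hloc : locally r (fun u => 0 < u < 1)).
  { apply (locally_interval _ r 0 1); simpl; lra || auto. }
  assert (HD : is_derive (fun u => RInt (sec_log_re kap d u) 0 PI) r
    (RInt (fun t => Derive (fun u => sec_log_re kap d u t) r) 0 PI)).
  { apply (is_derive_RInt_param (sec_log_re kap d) 0 PI r).
    - apply (filter_imp (F := locally r)) with (2 := Hloc); intros u Hu t.
      rewrite Rmin_left, Rmax_right by lra; intros Ht.
      exists (sec_log_re_r kap d u t); apply is_derive_sec_log_re; auto.
    - intros t; rewrite Rmin_left, Rmax_right by lra; intros Ht.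
      apply continuity_2d_pt_ext_loc with (sec_log_re_r kap d).
      + assert (H1 := continuity_2d_pt_neq_0 _ _ _ (continuity_2d_pt_sec_log_den kap d r t (Hre r
        t Hr))
          (Hden r t Hr Ht)).
        assert (H2 : locally_2d (fun u v => 0 < u < 1) r t).
        { destruct Hloc as [e He]; exists e; intros u v Hu _; apply He; auto. }
        apply (locally_2d_impl _ _ _ _ (locally_2d_forall _ _ _
          (fun u v (H : sec_log_den kap d u v <> 0 /\ 0 < u < 1) =>
            eq_sym (is_derive_unique (fun z => sec_log_re kap d z v) u _
              (is_derive_sec_log_re kap d u v (Hre u v (proj2 H)) (proj1 H)))))).
        now apply locally_2d_and.
      + apply continuity_2d_pt_sec_log_re_r; auto.
    - apply (filter_imp (F := locally r)) with (2 := Hloc); intros u Hu.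
      apply ex_RInt_cont; [lra|]; intros t Ht.
      apply continuity_2d_pt_snd, continuity_2d_pt_sec_log_re; auto. }
  unfold circ; evar_last; [exact HD|].
  transitivity (RInt (sec_log_re_r kap d r) 0 PI).
  { apply RInt_ext; intros t; rewrite Rmin_left, Rmax_right by lra; intros Ht.
    apply is_derive_unique, is_derive_sec_log_re; auto; apply Hden; lra. }
  rewrite <- sec_log_im_PI, <- sec_log_im_0 by lra.
  replace ((sec_log_im kap d r PI - sec_log_im kap d r 0) / r)
    with (sec_log_im kap d r PI / r - sec_log_im kap d r 0 / r)
    by (field; lra).
  apply is_RInt_unique.
  apply (is_RInt_derive (V := R_CompleteNormedModule) (fun th => sec_log_im kap d r th / r)
    (sec_log_re_r kap d r));
    intros t; rewrite Rmin_left, Rmax_right by lra; intros Ht.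
  - apply (is_derive_ext (fun th => / r * sec_log_im kap d r th)).
    { intros; unfold Rdiv; apply Rmult_comm. }
    replace (sec_log_re_r kap d r t) with (/ r * (r * sec_log_re_r kap d r t)) by (field; lra).
    apply (is_derive_scal (sec_log_im kap d r)), is_derive_sec_log_im; auto.
  - apply continuity_2d_pt_snd, continuity_2d_pt_sec_log_re_r; auto.
Qed.

(** * The radial limit *)

Lemma continuity_2d_pt_freeze (f : R -> R -> R) (r d th : R) :
  continuity_2d_pt f r th -> continuity_2d_pt (fun _ v => f r v) d th.
Proof.
  intros H eps; destruct (H eps) as [e He]; exists e; intros u v _ Hv; apply He; auto.
  rewrite Rminus_diag, Rabs_R0; apply cond_pos.
Qed.

Lemma continuity_2d_pt_sec_log_re_shift (kap r d th : R) : 0 < 1 + r * cos th ->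
  sec_log_den kap d r th <> 0 ->
  continuity_2d_pt (fun d th => sec_log_re kap d r th) d th.
Proof.
  intros H Hq; apply (continuity_2d_pt_sec_re (fun u v => kap * log_re r v)
    (fun u v => kap * log_im r v + u)); auto.
  - apply (continuity_2d_pt_freeze (fun u v => kap * log_re u v)).
    now apply continuity_2d_pt_scaled_log_re.
  - apply continuity_2d_pt_plus; [|apply continuity_2d_pt_id1].
    apply continuity_2d_pt_ext with (fun u v => kap * log_im r v + 0); [intros; ring|].
    apply (continuity_2d_pt_freeze (fun u v => kap * log_im u v + 0)).
    now apply continuity_2d_pt_scaled_log_im.
Qed.

Lemma sinh_ge_id (d : R) : 0 <= d -> d <= sinh d.
Proof.
  intros [Hd| <-]; [|rewrite sinh_0; lra].
  destruct (MVT_gen sinh 0 d cosh) as [x [Hx E]].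
  - intros y _; apply is_derive_Reals, derivable_pt_lim_sinh.
  - intros y _; apply derivable_continuous_pt, derivable_pt_sinh.
  - rewrite sinh_0, !Rminus_0_r in E; rewrite E.
    assert (1 <= cosh x); [|nra].
    generalize (cosh2 x) (cosh_pos x); intros; nra.
Qed.

Lemma cos_sqr_ge_half (x : R) : Rabs x <= PI / 4 -> / 2 <= cos x ^ 2.
Proof.
  intros H; apply Rabs_le_between in H.
  assert (E := cos_2a_cos x); assert (0 <= cos (2 * x)) by (apply cos_ge_0; lra); nra.
Qed.

(** [(1 - r)^2 <= |1 + r e^(i th)|^2 <= (1 + r)^2 <= (1 - r)^(-2)]. *)
Lemma log_re_bound (r th : R) : 0 <= r < 1 -> Rabs (log_re r th) <= - ln (1 - r).
Proof.
  intros Hr; assert (Hc := COS_bound th).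
  assert (H1 : (1 - r) * (1 - r) <= log_den r th) by (unfold log_den; nra).
  assert (H2 : log_den r th <= / (1 - r) * / (1 - r)).
  { apply Rle_trans with ((1 + r) * (1 + r)); [unfold log_den; nra|].
    assert (1 + r <= / (1 - r)); [|apply Rmult_le_compat; lra].
    apply Rmult_le_reg_r with (1 - r); [lra|]; rewrite Rinv_l by lra; nra. }
  assert (Hi : 0 < / (1 - r)) by (apply Rinv_0_lt_compat; lra).
  assert (H0 : 0 < (1 - r) * (1 - r)) by (apply Rmult_lt_0_compat; lra).
  apply ln_le in H2; [|lra]; apply ln_le in H1; [|lra].
  rewrite ln_mult in H1 by lra; rewrite ln_mult, ln_Rinv in H2 by lra.
  unfold log_re; apply Rabs_le; lra.
Qed.

Section Main.
Variable kap : R.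
Hypothesis Hk : 0 < kap.
Let c := PI / 2 / kap.

Let Hc : 0 < c.
Proof. now apply window_c_pos. Qed.

Let Ekc : kap * c = PI / 2.
Proof. unfold c; field; lra. Qed.

(** With this radius [kap * |log_re| <= kap * c / 2 = PI / 4], so the secant has no pole even at
    shift [0]. *)
Lemma small_radius (r : R) : 0 <= r <= 1 - exp (- (c / 2)) -> r < 1 /\ - ln (1 - r) <= c / 2.
Proof.
  intros Hr; assert (He := exp_pos (- (c / 2))); split; [lra|].
  assert (- (c / 2) <= ln (1 - r)); [|lra].
  rewrite <- (ln_exp (- (c / 2))); apply ln_le; lra.
Qed.

Lemma sec_log_den_small_radius (d r th : R) : 0 <= r <= 1 - exp (- (c / 2)) ->
  / 2 <= sec_log_den kap d r th.
Proof.
  intros Hr; destruct (small_radius r Hr) as [H1 H2].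
  assert (H3 := log_re_bound r th ltac:(lra)).
  unfold sec_log_den, sec_den.
  assert (/ 2 <= cos (kap * log_re r th) ^ 2); [|nra].
  apply cos_sqr_ge_half; rewrite Rabs_mult, (Rabs_pos_eq kap) by lra; nra.
Qed.

Lemma sec_log_re_small_bound (d r th : R) : 0 <= r <= 1 - exp (- (c / 2)) ->
  Rabs (sec_log_re kap d r th) <= 2.
Proof.
  intros Hr; replace 2 with (/ / 2) by field; apply sec_re_bound; [lra|].
  assert (H := sec_log_den_small_radius d r th Hr); unfold sec_log_den in H; lra.
Qed.

Lemma circ_0 : circ kap 0 0 = PI.
Proof.
  unfold circ; transitivity (RInt (fun _ => 1) 0 PI).
  - apply RInt_ext; intros t _; unfold sec_log_re, log_re, log_im, log_den.
    replace (1 + 2 * 0 * cos t + 0 ^ 2) with 1 by ring.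
    unfold Rdiv; rewrite ln_1, !Rmult_0_l, atan_0, Rmult_0_r, Rplus_0_r.
    unfold sec_re, sec_den; rewrite cos_0, cosh_0, sinh_0.
    real_eq; field.
  - rewrite RInt_const; unfold scal; simpl; unfold mult; simpl; ring.
Qed.

Lemma circ_lim_0 (eps : R) : 0 < eps -> exists d, 0 < d /\
  forall r, 0 <= r <= 1 - exp (- (c / 2)) -> r < d -> Rabs (circ kap 0 r - PI) < eps.
Proof.
  intros He; assert (HP := PI_RGT_0).
  assert (H1 : exp (- (c / 2)) < 1) by (rewrite <- exp_0; apply exp_increasing; lra).
  destruct (RInt_param_lim (sec_log_re kap 0) 0 (1 - exp (- (c / 2))) 0 0 PI 0 2) with (eps := eps)
    as [d [Hd H]]; try lra.
  - intros t x Ht _; apply continuity_2d_pt_sec_log_re.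
    + apply re_pos_lt_1; generalize (exp_pos (- (c / 2))); lra.
    + assert (H := sec_log_den_small_radius 0 t x Ht); lra.
  - intros t x Ht _; now apply sec_log_re_small_bound.
  - exists d; split; auto; intros r Hr Hrd; rewrite <- circ_0; apply (H r Hr).
    rewrite Rminus_0_r, Rabs_pos_eq; lra.
Qed.

Lemma circ_shift_lim_small (r eps : R) : 0 <= r <= 1 - exp (- (c / 2)) -> 0 < eps ->
  exists e, 0 < e /\ forall d, 0 < d < e -> Rabs (circ kap d r - circ kap 0 r) < eps.
Proof.
  intros Hr He; assert (HP := PI_RGT_0); destruct (small_radius r Hr) as [Hr1 _].
  destruct (RInt_param_lim (fun d th => sec_log_re kap d r th) 0 1 0 0 PI 0 2) with (eps := eps)
    as [e [He' H]]; try lra.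
  - intros t x Ht _; apply continuity_2d_pt_sec_log_re_shift.
    + apply re_pos_lt_1; lra.
    + assert (H := sec_log_den_small_radius t r x Hr); lra.
  - intros t x _ _; now apply sec_log_re_small_bound.
  - exists (Rmin e 1); split; [apply Rmin_pos; lra|]; intros d [Hd1 Hd2].
    assert (H1 := Rmin_l e 1); assert (H2 := Rmin_r e 1).
    apply (H d); [lra|rewrite Rminus_0_r, Rabs_pos_eq; lra].
Qed.

Lemma log_im_1 (th : R) : 0 <= th < PI -> log_im 1 th = th / 2.
Proof.
  intros Hth; unfold log_im.
  assert (Hcos : 0 < cos (th / 2)) by (apply cos_gt_0; lra).
  replace (1 * sin th / (1 + 1 * cos th)) with (tan (th / 2)).
  - apply atan_tan; lra.
  - replace th with (2 * (th / 2)) at 2 3 by field.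
    rewrite sin_2a, cos_2a_cos; unfold tan; field; split; nra.
Qed.

Lemma log_re_1 (th : R) : 0 <= th < PI -> log_re 1 th = ln (2 * cos (th / 2)).
Proof.
  intros Hth; unfold log_re, log_den.
  assert (Hcos : 0 < cos (th / 2)) by (apply cos_gt_0; lra).
  replace (1 + 2 * 1 * cos th + 1 ^ 2) with ((2 * cos (th / 2)) * (2 * cos (th / 2))).
  - rewrite ln_mult by lra; field.
  - replace th with (2 * (th / 2)) at 3 by field; rewrite cos_2a_cos; ring.
Qed.

(** * The unit circle, with no pole on the positive radius *)

Section Pole_outside.
Hypothesis Hln2 : kap * ln 2 < PI / 2.

Let Hln2_pos : 0 < ln 2.
Proof. rewrite <- ln_1; apply ln_increasing; lra. Qed.

(** The imaginary part [kap * th / 2 + d] can vanish only at [th = 0]; there the logarithm is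
    [ln 2], and [kap * ln 2 < PI / 2] keeps the cosine positive. *)
Lemma sec_log_den_1_pos (d th : R) : 0 <= d -> 0 <= th < PI -> 0 < sec_log_den kap d 1 th.
Proof.
  intros Hd Hth; unfold sec_log_den, sec_den; rewrite log_im_1, log_re_1 by auto.
  destruct (Req_dec th 0) as [->|Hne].
  - replace (2 * cos (0 / 2)) with 2 by (unfold Rdiv; rewrite Rmult_0_l, cos_0; ring).
    assert (0 < cos (kap * ln 2)) by (apply cos_gt_0; nra); nra.
  - assert (0 < sinh (kap * (th / 2) + d)) by (apply sinh_pos; nra); nra.
Qed.

(** Only the end [th = PI] is critical. From [PI / 2] on, the imaginary part is at least
    [kap * PI / 4], so the secant stays bounded although the logarithm does not. *)
Lemma ex_RInt_sec_log_re_1 : ex_RInt (sec_log_re kap 0 1) 0 PI.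
Proof.
  assert (HP := PI_RGT_0); assert (Hs : 0 < sinh (kap * (PI / 4))) by (apply sinh_pos; nra).
  apply ex_RInt_bounded with (PI / 2) (/ sinh (kap * (PI / 4))); [lra| |].
  - intros x Hx; apply continuity_2d_pt_snd, continuity_2d_pt_sec_log_re.
    + apply re_pos_lt_PI; lra.
    + assert (H := sec_log_den_1_pos 0 x ltac:(lra) Hx); lra.
  - intros x Hx; apply sec_re_bound; auto; unfold sec_den; rewrite log_im_1 by lra.
    assert (sinh (kap * (PI / 4)) <= sinh (kap * (x / 2) + 0)) by (apply sinh_le; nra); nra.
Qed.

Lemma circ_shift_lim_1 (eps : R) : 0 < eps ->
  exists e, 0 < e /\ forall d, 0 < d < e -> Rabs (circ kap d 1 - circ kap 0 1) < eps.
Proof.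
  intros He; assert (HP := PI_RGT_0).
  assert (Hs : 0 < sinh (kap * (PI / 4))) by (apply sinh_pos; nra).
  destruct (RInt_param_lim (fun d th => sec_log_re kap d 1 th) 0 1 0 0 PI (PI / 2)
    (/ sinh (kap * (PI / 4)))) with (eps := eps) as [e [He' H]]; try lra.
  - intros t x Ht Hx; apply continuity_2d_pt_sec_log_re_shift.
    + apply re_pos_lt_PI; lra.
    + assert (H := sec_log_den_1_pos t x ltac:(lra) Hx); lra.
  - intros t x Ht Hx; apply sec_re_bound; auto; unfold sec_den; rewrite log_im_1 by lra.
    assert (sinh (kap * (PI / 4)) <= sinh (kap * (x / 2) + t)) by (apply sinh_le; nra); nra.
  - exists (Rmin e 1); split; [apply Rmin_pos; lra|]; intros d [Hd1 Hd2].
    assert (H1 := Rmin_l e 1); assert (H2 := Rmin_r e 1).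
    apply (H d); [lra|rewrite Rminus_0_r, Rabs_pos_eq; lra].
Qed.

(** For fixed [d > 0] the bound [/ sinh d] holds on the half disc, so the radius may pass the poles
    of the unshifted secant on its way to [1]. *)
Lemma circ_radius_lim_1 (d : R) (u : nat -> R) : 0 < d -> (forall n, / 2 <= u n <= 1) ->
  is_lim_seq u 1 -> is_lim_seq (fun n => circ kap d (u n)) (circ kap d 1).
Proof.
  intros Hd Hu Hlim; assert (HP := PI_RGT_0).
  assert (Hs := sinh_pos d Hd).
  assert (Hre : forall t x, / 2 <= t <= 1 -> 0 <= x < PI -> 0 < 1 + t * cos x)
    by (intros; apply re_pos_lt_PI; lra).
  assert (Hden : forall t x, / 2 <= t <= 1 -> 0 <= x < PI -> sinh d ^ 2 <= sec_log_den kap d t x)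
    by (intros t x Ht Hx; apply sec_log_den_ge_sinh; auto; lra).
  apply is_lim_seq_spec; intros eps.
  destruct (RInt_param_lim (sec_log_re kap d) (/ 2) 1 1 0 PI 0 (/ sinh d)) with (eps := pos eps)
    as [e [He' H]]; try lra.
  - intros t x Ht Hx; apply continuity_2d_pt_sec_log_re; auto.
    assert (H := Hden t x Ht Hx); nra.
  - intros t x Ht Hx; apply sec_re_bound; auto; apply (Hden t x); auto.
  - apply cond_pos.
  - apply is_lim_seq_spec in Hlim; destruct (Hlim (mkposreal e He')) as [N HN].
    exists N; intros n Hn; apply (H (u n) (Hu n)), HN; auto.
Qed.

Definition side (d r : R) : R := sec_im (kap * ln (1 + r)) d / r.

Lemma continuous_side (d r : R) : 0 < d -> 0 < r -> continuous (side d) r.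
Proof.
  intros Hd Hr; apply (ex_derive_continuous (V := R_NormedModule)).
  assert (Hs := sinh_pos d Hd).
  assert (Hq : 0 < cos (kap * ln (1 + r)) ^ 2 + sinh d ^ 2) by nra.
  unfold side, sec_im, sec_den; auto_derive; simpl in *; repeat split; lra.
Qed.

Lemma ex_RInt_side (d a b : R) : 0 < d -> 0 < a -> 0 < b -> ex_RInt (side d) a b.
Proof.
  intros Hd Ha Hb; apply (ex_RInt_continuous (V := R_CompleteNormedModule)); intros x Hx.
  apply continuous_side; auto; generalize (Rmin_pos a b Ha Hb); lra.
Qed.

(** Under [v = - ln (1 - x)] the factor [dx / x] turns into [bose v dv] and [sec_im] on the negative
    radius into minus the Poisson kernel with [s = sinh d]. The rest is the fundamental theorem for
    [circ]. *)
Lemma circ_diff (d e r : R) : 0 < d -> 0 < e -> e <= r -> r < 1 ->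
  RInt (fun v => poisson kap (sinh d) v * bose v) (- ln (1 - e)) (- ln (1 - r)) =
  circ kap d e - circ kap d r - RInt (side d) e r.
Proof.
  intros Hd He Her Hr; assert (Hs := sinh_pos d Hd).
  set (f := fun v => poisson kap (sinh d) v * bose v).
  assert (Hv : forall x, 0 < x < 1 -> 0 < - ln (1 - x)).
  { intros x Hx; assert (ln (1 - x) < ln 1) by (apply ln_increasing; lra); rewrite ln_1 in *; lra. }
  set (h := fun x => - sec_im (kap * ln (1 - x)) d / x).
  assert (E1 : is_RInt h e r (RInt f (- ln (1 - e)) (- ln (1 - r)))).
  { apply is_RInt_ext with (fun x => scal (/ (1 - x)) (f (- ln (1 - x)))).
    - intros x; rewrite Rmin_left, Rmax_right by lra; intros Hx.
      unfold h, f, poisson, bose, sec_im, sec_den, scal; simpl; unfold mult; simpl.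
      replace (kap * - ln (1 - x)) with (- (kap * ln (1 - x))) by ring.
      rewrite sin_neg, cos_neg, exp_Ropp, exp_ln by lra.
      assert (0 < cos (kap * ln (1 - x)) ^ 2 + sinh d ^ 2) by nra.
      real_eq.
      field; repeat split; simpl in *; lra.
    - apply (is_RInt_comp (V := R_CompleteNormedModule) f (fun x => - ln (1 - x)) (fun x => / (1
      - x)));
        intros x; rewrite Rmin_left, Rmax_right by lra; intros Hx.
      + apply continuous_poisson_bose; auto; apply Hv; lra.
      + split; [auto_derive; [lra|field; lra]|].
        apply (ex_derive_continuous (V := R_NormedModule)); auto_derive; lra. }
  assert (E2 : is_RInt (fun x => (sec_im (kap * ln (1 - x)) d - sec_im (kap * ln (1 + x)) d) / x)
    e r (circ kap d r - circ kap d e)).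
  { apply (is_RInt_derive (V := R_CompleteNormedModule)); intros x;
      rewrite Rmin_left, Rmax_right by lra; intros Hx.
    - apply is_derive_circ; lra.
    - apply (ex_derive_continuous (V := R_NormedModule)).
      assert (0 < cos (kap * ln (1 + x)) ^ 2 + sinh d ^ 2) by nra.
      assert (0 < cos (kap * ln (1 - x)) ^ 2 + sinh d ^ 2) by nra.
      unfold sec_im, sec_den; auto_derive; simpl in *; repeat split; try lra.
      change (1 + - x) with (1 - x); lra. }
  assert (E3 : is_RInt (side d) e r (RInt (side d) e r)).
  { apply (RInt_correct (V := R_CompleteNormedModule)), ex_RInt_side; lra. }
  (* The three integrands cancel pointwise, so the three integrals add up to [0]. *)
  assert (E4 := is_RInt_plus (V := R_NormedModule) _ _ _ _ _ _
    (is_RInt_plus (V := R_NormedModule) _ _ _ _ _ _ E1 E2) E3).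
  apply (is_RInt_ext (V := R_NormedModule) _ (fun _ => 0)) in E4.
  - assert (E5 := is_RInt_const (V := R_NormedModule) e r 0).
    assert (E6 := is_RInt_unique _ _ _ _ E4); rewrite (is_RInt_unique _ _ _ _ E5) in E6.
    unfold scal, plus in E6; simpl in E6; unfold mult in E6; simpl in E6; fold f; lra.
  - intros x; rewrite Rmin_left, Rmax_right by lra; intros Hx.
    unfold h, side, plus; simpl.
    real_eq; field; lra.
Qed.

(** For [t <= 1] the cosine of [kap * ln (1 + t)] is at least [cos (kap * ln 2) > 0], and the
    numerator supplies the factor [sinh d]: the positive radius contributes nothing in the limit of
    vanishing shift. *)
Lemma side_bound (d e : R) : 0 < d -> 0 < e < 1 ->
  Rabs (RInt (side d) e 1) <= sinh d * (/ cos (kap * ln 2) ^ 2 / e).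
Proof.
  intros Hd He; assert (Hs := sinh_pos d Hd).
  assert (Hcos : 0 < cos (kap * ln 2)) by (apply cos_gt_0; nra).
  set (M := sinh d * (/ cos (kap * ln 2) ^ 2 / e)).
  assert (HM : 0 < M).
  { unfold M; apply Rmult_lt_0_compat; auto; apply Rdiv_lt_0_compat; [|lra].
    apply Rinv_0_lt_compat; nra. }
  apply Rle_trans with (M * (1 - e)); [|nra].
  apply abs_RInt_le_open; [lra|apply ex_RInt_side; lra|].
  intros t Ht; unfold side, sec_im.
  assert (Hln : 0 < ln (1 + t)) by (rewrite <- ln_1; apply ln_increasing; lra).
  assert (Hln' : ln (1 + t) <= ln 2) by (apply ln_le; lra).
  assert (Hct : cos (kap * ln 2) <= cos (kap * ln (1 + t))).
  { destruct (Req_dec (ln (1 + t)) (ln 2)) as [->|Hne]; [lra|].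
    apply Rlt_le, cos_decreasing_1; nra. }
  assert (Hden : cos (kap * ln 2) ^ 2 <= sec_den (kap * ln (1 + t)) d) by (unfold sec_den; nra).
  unfold Rdiv; rewrite !Rabs_mult, !Rabs_inv, (Rabs_pos_eq (sinh d)), (Rabs_pos_eq t),
    (Rabs_pos_eq (sec_den _ _)) by nra.
  assert (Hsin : Rabs (sin (kap * ln (1 + t))) <= 1) by (apply Rabs_le;
    generalize (SIN_bound (kap * ln (1 + t))); lra).
  unfold M; rewrite Rmult_assoc.
  apply Rle_trans with (1 * sinh d * (/ sec_den (kap * ln (1 + t)) d * / t)).
  - apply Rmult_le_compat_r.
    + apply Rlt_le, Rmult_lt_0_compat; apply Rinv_0_lt_compat; nra.
    + apply Rmult_le_compat_r; lra.
  - rewrite Rmult_1_l; apply Rmult_le_compat_l; [lra|].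
    apply Rmult_le_compat.
    + apply Rlt_le, Rinv_0_lt_compat; nra.
    + apply Rlt_le, Rinv_0_lt_compat; lra.
    + apply Rinv_le_contravar; nra.
    + apply Rinv_le_contravar; lra.
Qed.

(** In terms of [s = sinh d]: for fixed [s] the window integrals tend to [A s] as the radius tends
    to [1], and [A s] tends to the left side as [s] tends to [0]. This is the situation of
    [poisson_bose_double_lim]. *)
Lemma circ_small_radius_value (e : R) : 0 < e <= 1 - exp (- (c / 2)) ->
  circ kap 0 e - circ kap 0 1 = PI / kap * ((theta3_sq c - 1) / 4).
Proof.
  intros He; destruct (small_radius e ltac:(lra)) as [He1 Hv].
  assert (Hv0 : 0 < - ln (1 - e)).
  { assert (ln (1 - e) < ln 1) by (apply ln_increasing; lra); rewrite ln_1 in *; lra. }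
  set (A := fun s => circ kap (arcsinh s) e - circ kap (arcsinh s) 1 -
    RInt (side (arcsinh s)) e 1).
  assert (Hash : forall s, 0 < s -> 0 < arcsinh s).
  { intros s Hs; apply Rnot_le_lt; intros H.
    apply sinh_le in H; rewrite sinh_arcsinh, sinh_0 in H; lra. }
  apply (poisson_bose_double_lim kap Hk (- ln (1 - e)) A); fold c; [lra| |].
  - intros s Hs; set (d := arcsinh s) in *.
    assert (Hd : 0 < d) by now apply Hash.
    (* Radii with [- ln (1 - r) = 2 c (N + 1)], the ends of the windows. *)
    set (rad := fun N : nat => 1 - exp (- (2 * c * INR N + 2 * c))).
    assert (Hexp : forall N, 0 < exp (- (2 * c * INR N + 2 * c)) < exp (- (c / 2))).
    { intros N; split; [apply exp_pos|]; apply exp_increasing; generalize (pos_INR N); intros;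
      nra. }
    assert (Hlim : is_lim_seq rad 1).
    { replace (Finite 1) with (Finite (1 - 0)) by (f_equal; ring).
      apply is_lim_seq_minus'; [apply is_lim_seq_const|]; apply is_lim_seq_exp_opp; lra. }
    assert (Hrad : forall N, e <= rad N < 1) by (intros N; specialize (Hexp N); unfold rad; lra).
    apply is_lim_seq_ext with (fun N => circ kap d e - circ kap d (rad N) - RInt (side d) e (rad
      N)).
    + intros N; destruct (Hrad N); rewrite <- circ_diff by lra.
      unfold d; rewrite sinh_arcsinh; f_equal.
      unfold rad; replace (1 - (1 - exp (- (2 * c * INR N + 2 * c)))) with
        (exp (- (2 * c * INR N + 2 * c))) by ring.
      rewrite ln_exp; ring.
    + apply is_lim_seq_minus'.
      * apply is_lim_seq_minus'; [apply is_lim_seq_const|].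
        apply circ_radius_lim_1; auto; intros N; specialize (Hexp N); unfold rad.
        split; [|lra].
        assert (exp (- (2 * c * INR N + 2 * c)) <= / 2); [|lra].
        rewrite <- (exp_ln (/ 2)), ln_Rinv by lra.
        apply Rlt_le, exp_increasing; generalize (pos_INR N); intros.
        (* [kap * ln 2 < PI / 2 = kap * c] gives [exp (- 2 c) <= 1/2], since [circ_radius_lim_1]
           asks for radii of at least [1/2]. *)
        assert (ln 2 < c); [|nra].
        apply Rmult_lt_reg_l with kap; auto; lra.
      * apply (is_lim_seq_continuous (RInt (side d) e) rad 1); auto.
        apply continuity_pt_derive with (side d 1).
        apply is_derive_RInt with e.
        -- apply (locally_interval _ 1 0 2); simpl; try lra; intros y H1 H2.
           apply (RInt_correct (V := R_CompleteNormedModule)), ex_RInt_side; lra.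
        -- apply continuous_side; lra.
  - intros eps Heps.
    destruct (circ_shift_lim_small e (eps / 3)) as [e1 [He1' H1]]; [lra|lra|].
    destruct (circ_shift_lim_1 (eps / 3)) as [e2 [He2 H2]]; [lra|].
    set (K := / cos (kap * ln 2) ^ 2 / e).
    assert (HK : 0 < K).
    { assert (0 < cos (kap * ln 2)) by (apply cos_gt_0; nra).
      apply Rdiv_lt_0_compat; [|lra]; apply Rinv_0_lt_compat; nra. }
    exists (Rmin (Rmin e1 e2) (eps / 3 / K)); split.
    { repeat apply Rmin_pos; auto; apply Rdiv_lt_0_compat; lra. }
    intros s [Hs Hsm].
    assert (Hsa := Rmin_l (Rmin e1 e2) (eps / 3 / K));
      assert (Hsb := Rmin_r (Rmin e1 e2) (eps / 3 / K)).
    assert (Hsc := Rmin_l e1 e2); assert (Hsd := Rmin_r e1 e2).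
    assert (Hd := Hash s Hs); assert (Hds := sinh_ge_id (arcsinh s) ltac:(lra)).
    assert (H3 := side_bound (arcsinh s) e Hd ltac:(lra)); fold K in H3.
    rewrite sinh_arcsinh in Hds, H3.
    specialize (H1 (arcsinh s) ltac:(lra)); specialize (H2 (arcsinh s) ltac:(lra)).
    assert (H4 : s * K < eps / 3).
    { apply (Rmult_lt_reg_r (/ K)); [now apply Rinv_0_lt_compat|].
      rewrite Rmult_assoc, Rinv_r by lra; unfold Rdiv in *; lra. }
    unfold A; apply Rabs_def2 in H1; apply Rabs_def2 in H2; apply Rabs_le_between in H3.
    apply Rabs_def1; lra.
Qed.

(** By [circ_small_radius_value] all small radii give the same [circ kap 0 e], and this tends to
    [PI] as [e] tends to [0]. *)
Lemma circ_value : circ kap 0 1 = PI - PI / kap * ((theta3_sq c - 1) / 4).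
Proof.
  set (X := PI / kap * ((theta3_sq c - 1) / 4)).
  apply Rminus_diag_uniq, Rabs_eq_0, Rle_antisym; [|apply Rabs_pos].
  apply le_epsilon; intros eps He; rewrite Rplus_0_l.
  destruct (circ_lim_0 eps He) as [d [Hd H]].
  assert (H1 : exp (- (c / 2)) < 1) by (rewrite <- exp_0; apply exp_increasing; lra).
  set (e := Rmin (d / 2) (1 - exp (- (c / 2)))).
  assert (He0 : 0 < e) by (apply Rmin_pos; lra).
  assert (Hea := Rmin_l (d / 2) (1 - exp (- (c / 2))));
    assert (Heb := Rmin_r (d / 2) (1 - exp (- (c / 2)))).
  fold e in Hea, Heb.
  specialize (H e ltac:(lra) ltac:(lra)).
  assert (E := circ_small_radius_value e ltac:(lra)); fold X in E.
  replace (circ kap 0 1 - (PI - X)) with (circ kap 0 e - PI) by lra; lra.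
Qed.

End Pole_outside.
End Main.

(** * The integral over the quarter period *)

(** The denominator is [cosh (2 B) + cos (2 A) = 2 (cos A ^ 2 + sinh B ^ 2)]. *)
Lemma integrand_sec_re (alpha x : R) : 0 < alpha ->
  integrand alpha x = / 2 * sec_re (ln (2 * cos x) / (2 * alpha)) (x / (2 * alpha)).
Proof.
  intros Ha; unfold integrand, sec_re.
  set (A := ln (2 * cos x) / (2 * alpha)); set (B := x / (2 * alpha)).
  replace (ln (2 * cos x) / alpha) with (2 * A) by (unfold A; field; lra).
  replace (x / alpha) with (B + B) by (unfold B; field; lra).
  assert (E : cosh (B + B) + cos (2 * A) = 2 * sec_den A B).
  { rewrite cos_2a_cos; assert (H := cosh_plus_cosh B B).
    rewrite Rminus_diag, cosh_0 in H; assert (H2 := cosh2 B); unfold sec_den; nra. }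
  rewrite E; unfold Rdiv; rewrite Rinv_mult; ring.
Qed.

Theorem theorem2 (alpha k : R) (halpha : ln 2 / PI < alpha)
  (hk : 0 < k < 1) (hmod : ellK (comp_modulus k) / ellK k = alpha) :
  is_RInt (integrand alpha) 0 (PI / 2)
    (PI / 8 * (alpha + 2) - alpha / 4 * ellK k).
Proof.
  assert (HP := PI_RGT_0).
  assert (Hln2 : 0 < ln 2) by (rewrite <- ln_1; apply ln_increasing; lra).
  assert (Hla : ln 2 < PI * alpha).
  { apply (Rmult_lt_compat_r PI) in halpha; auto.
    replace (ln 2 / PI * PI) with (ln 2) in halpha by (field; lra); lra. }
  assert (Ha : 0 < alpha) by nra.
  rewrite (ellK_theta alpha k Ha hk hmod).
  (* With this [kap] the first zero [PI / 2 / kap] is [PI * alpha], the argument of [theta3_sq] in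
     [ellK_theta]. *)
  set (kap := / (2 * alpha)).
  assert (Hk : 0 < kap) by (apply Rinv_0_lt_compat; lra).
  assert (Hpole : kap * ln 2 < PI / 2).
  { apply Rmult_lt_reg_l with (2 * alpha); [lra|].
    unfold kap; rewrite <- Rmult_assoc, Rinv_r by lra; lra. }
  assert (Hcirc := circ_value kap Hk Hpole).
  replace (PI / 2 / kap) with (PI * alpha) in Hcirc by (unfold kap; field; lra).
  assert (HI : is_RInt (sec_log_re kap 0 1) (2 * 0 + 0) (2 * (PI / 2) + 0) (circ kap 0 1)).
  { replace (2 * 0 + 0) with 0 by ring; replace (2 * (PI / 2) + 0) with PI by field.
    apply (RInt_correct (V := R_CompleteNormedModule)), ex_RInt_sec_log_re_1; auto. }
  apply (is_RInt_comp_lin (V := R_NormedModule)) in HI.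
  (* One factor [1/2] is that of [integrand_sec_re], the other undoes [dth = 2 dx] in the
     substitution [th = 2 x]. *)
  apply (is_RInt_scal (V := R_NormedModule) _ _ _ (/ 4)) in HI.
  replace (PI / 8 * (alpha + 2) - alpha / 4 * (PI / 2 * theta3_sq (PI * alpha))) with
    (scal (/ 4) (circ kap 0 1)).
  - apply (is_RInt_ext (V := R_NormedModule)) with (2 := HI); intros x.
    rewrite Rmin_left, Rmax_right by lra; intros Hx.
    rewrite integrand_sec_re by auto; unfold sec_log_re, scal; simpl; unfold mult; simpl.
    rewrite log_re_1, log_im_1 by lra.
    replace ((2 * x + 0) / 2) with x by field.
    replace (kap * ln (2 * cos x)) with (ln (2 * cos x) / (2 * alpha)) by (unfold kap; field; lra).
    replace (kap * x + 0) with (x / (2 * alpha)) by (unfold kap; field; lra).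
    real_eq; field.
  - rewrite Hcirc; unfold scal; simpl; unfold mult; simpl; unfold kap; field; lra.
Qed.
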